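(* Let $\Delta\in \mathbb N^+$ be a constant and $d: \mathbb N^+\to \mathbb N^+$ a computable function. Then there is an fpt-algorithm that on input a graph $G$ and a parameter $k\in \mathbb N$ with $6 \mid k+1$ constructs a bipartite graph $H= (A \,\dot\cup\, B, E)$ together with two colorings $\alpha: A\to [\Delta s]$ and $\beta: B\to [d(k)]$, where $s=\binom{k}{2}$, such that: (H1) if $G$ contains a clique of size $k$, then there are $\Delta s$ vertices of pairwise distinct $\alpha$-colors in $A$ having $d(k)$ common neighbors in $B$ of pairwise distinct $\beta$-colors; (H2) if $G$ contains no clique of size $k$, then every set of $\Delta(s-1)+ 1$ vertices in $A$ has at most $(k+1)!$ common neighbors in $B$.
   Context: Graphs are finite, simple and undirected; $|G|$ is the number of vertices plus edges. $[n]=\{1,\dots,n\}$. An fpt-algorithm here is one whose running time on input $(G,k)$ is bounded by $f(k)\cdot|G|^{O(1)}$ for some computable $f:\mathbb N\to\mathbb N$. *)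

(* Defs.v *)
(* A small unit-cost RAM model (successor/predecessor
   arithmetic only, indirect addressing) is used to formalize
   "fpt-algorithm" and "computable function". *)
From mathcomp Require Import all_boot.
Set Implicit Arguments. Unset Strict Implicit. Unset Printing Implicit Defensive.

Inductive instr :=
  | Inc of nat
  | Dec of nat
  | Jz of nat & nat
  | Jmp of nat
  | Ld of nat & nat
  | St of nat & nat
  | Halt.

Definition program := seq instr.

Record config := Config { pc : nat; mem : nat -> nat }.

Definition upd (M : nat -> nat) (a v : nat) : nat -> nat :=
  fun x => if x == a then v else M x.

(* One step; None means the machine has halted
   (Halt instruction or program counter out of range). *)
Definition step (p : program) (c : config) : option config :=
  let M := mem c in
  match nth Halt p (pc c) with
  | Inc i => Some (Config (pc c).+1 (upd M i (M i).+1))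
  | Dec i => Some (Config (pc c).+1 (upd M i (M i).-1))
  | Jz i l => Some (Config (if M i == 0 then l else (pc c).+1) M)
  | Jmp l => Some (Config l M)
  | Ld i j => Some (Config (pc c).+1 (upd M i (M (M j))))
  | St i j => Some (Config (pc c).+1 (upd M (M i) (M j)))
  | Halt => None
  end.

Definition halted (p : program) (c : config) : bool :=
  if step p c is None then true else false.

Fixpoint exec (p : program) (t : nat) (c : config) : config :=
  match t with
  | 0 => c
  | t'.+1 => if step p c is Some c' then exec p t' c' else c
  end.

Definition init_mem (w : seq nat) : nat -> nat :=
  fun x => if x is x'.+1 then nth 0 w x' else size w.

Definition init (w : seq nat) : config := Config 0 (init_mem w).

Definition output (c : config) : seq nat :=
  [seq mem c i.+1 | i <- iota 0 (mem c 0)].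

Definition runs_within (p : program) (w : seq nat) (t : nat) (o : seq nat) :=
  halted p (exec p t (init w)) /\ output (exec p t (init w)) = o.

Definition computable (f : nat -> nat) : Prop :=
  exists p : program, forall k, exists t, runs_within p [:: k] t [:: f k].

Definition simple_graph (n : nat) (e : rel 'I_n) : Prop :=
  symmetric e /\ irreflexive e.

Definition edge_list (n : nat) (e : rel 'I_n) : seq (nat * nat) :=
  [seq (nat_of_ord p.1, nat_of_ord p.2)
   | p : 'I_n * 'I_n <- [seq (x, y) | x <- enum 'I_n, y <- enum 'I_n]
   & (p.1 < p.2) && e p.1 p.2].

Definition gsize (n : nat) (e : rel 'I_n) : nat := n + size (edge_list e).

Definition encode_instance (n : nat) (e : rel 'I_n) (k : nat) : seq nat :=
  [:: k, n, size (edge_list e)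
    & flatten [seq [:: uv.1; uv.2] | uv <- edge_list e]].

Definition has_clique (n : nat) (e : rel 'I_n) (k : nat) : Prop :=
  exists K : {set 'I_n}, #|K| = k /\ {in K &, forall x y, x != y -> e x y}.

(* Output word format:
     [:: na; nb; m; alpha_0 .. alpha_(na-1); beta_0 .. beta_(nb-1);
         x_1; y_1; ...; x_m; y_m]
   A = {0,..,na-1}, B = {0,..,nb-1}, edges (x_i, y_i) with x_i in A,
   y_i in B.  Colours are in [N] = {1,..,N}. *)
Section Output.
Variable w : seq nat.
Definition o_na := nth 0 w 0.
Definition o_nb := nth 0 w 1.
Definition o_m := nth 0 w 2.
Definition o_alpha (x : nat) := nth 0 w (3 + x).
Definition o_beta (y : nat) := nth 0 w (3 + o_na + y).
Definition o_edge (i : nat) : nat * nat :=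
  (nth 0 w (3 + o_na + o_nb + 2 * i), nth 0 w (3 + o_na + o_nb + 2 * i + 1)).
Definition o_adj (x y : nat) : bool := (x, y) \in [seq o_edge i | i <- iota 0 o_m].

Definition wf_output (ncA ncB : nat) : bool :=
  [&& size w == 3 + o_na + o_nb + 2 * o_m,
      all (fun x => 0 < o_alpha x <= ncA) (iota 0 o_na),
      all (fun y => 0 < o_beta y <= ncB) (iota 0 o_nb) &
      all (fun i => (o_edge i).1 < o_na) (iota 0 o_m)
      && all (fun i => (o_edge i).2 < o_nb) (iota 0 o_m)].

Definition is_subset_A (S : seq nat) := uniq S && all (fun x => x < o_na) S.
Definition is_subset_B (T : seq nat) := uniq T && all (fun y => y < o_nb) T.

Definition common_nbrs (S : seq nat) : seq nat :=
  [seq y <- iota 0 o_nb | all (fun x => o_adj x y) S].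
End Output.

Definition H1_prop (w : seq nat) (a b : nat) : Prop :=
  exists S T : seq nat,
    [/\ [/\ is_subset_A w S, size S = a & uniq [seq o_alpha w x | x <- S]],
        [/\ is_subset_B w T, size T = b & uniq [seq o_beta w y | y <- T]] &
        all (fun y => all (fun x => o_adj w x y) S) T].

Definition H2_prop (w : seq nat) (a b : nat) : Prop :=
  forall S : seq nat, is_subset_A w S -> size S = a ->
    size (common_nbrs w S) <= b.

(* Main.v *)
(* Let t = k + 1 = 6h and D = 2h = t/3, and let p be a prime with p^h >= 2nk and p >= t! d(k). A node
   x of the product G x K_k, a pair of a vertex and a number below k, gets a point a_x of the field with
   p^D elements, such that no two points are conjugate over F_p. The B-vertices are the polynomials Y
   over F_p with t coefficients (together with a colouring chi, see below), and x sees Y through the norm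
   class of Y(a_x), one of p possible values. An A-vertex is an edge of G x K_k together with one class
   for either end, and is adjacent to the Y which have both of these classes.

   The polynomials that have prescribed classes at t nodes are common zeros of t equations, each
   setting a product of D linear forms (the conjugates of the evaluation at a_x) to a constant. Any
   choice of one form per equation is a Vandermonde basis, so a Bezout argument leaves at most
   D^t = (2h)^(6h) <= (6h)! = (k+1)! of them. Now s distinct edges of G x K_k, taken from Delta (s - 1) + 1
   A-vertices, touch more than k nodes, which yields (H2), or form a K_k, whose projection is
   a clique of G. Conversely, the nodes of a clique have p^k tuples of classes; by averaging, some tuple is attained
   with d(k) different constant coefficients below L >= t! d(k), the point 0 acting as a t-th node. Since all colourings chi : [L] -> [d(k)] of the constant coefficients are
   present, one of them makes these colours distinct.

   The graph is computed by structured code for the RAM. Functions which it evaluates in time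
   polynomial in a bound on their values are closed under limited recursion; running the given program
   for d with a step counter and exponentiating a few times yields such a bound f(k) |G|^O(1), and shows
   that f itself is computable. *)

Require Import Defs.
From mathcomp Require Import all_boot all_algebra all_fingroup all_solvable all_field zify.
Set Implicit Arguments. Unset Strict Implicit. Unset Printing Implicit Defensive.
Implicit Types Q : (nat -> nat) -> Prop.

(** * Structured code on the RAM *)

(** The size of the output dictates the parameters. B holds about [p ^ (k + 1)] polynomials, which
    must be f(k) times a fixed power of n, so p can only be about the h-th root of n, and F_p has
    too few points for n k nodes. The points are taken from the field with [p ^ (2 * h)] elements
    instead; exponents below [p ^ h] and prime to p exclude conjugacy. Recording the value at such a
    point would create [p ^ (2 * h)] classes and ruin the averaging. The norm has only p values and
    is a product of D linear forms in the coefficients, at the price of degree D per equation. The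
    divisibility by 6 arises here: [n ^ n <= 3 ^ n * n!] gives (t/3)^t <= t!, so D may be t/3, while
    non-conjugacy wants D = 2h. Both directions use exactly t = k + 1 conditions: more than k nodes
    in (H2), k nodes and the point 0 in (H1). The colouring chi is also a field of the A-vertices;
    it separates disjoint copies and so adds no common neighbours. On the machine side all counting
    is unary: a computation is polynomial only if its values are, which explains the cut-offs and
    the bounded recursion. *)

Inductive cmd :=
  | CInc of nat
  | CDec of nat
  | CLd of nat & nat
  | CSt of nat & nat
  | CSkip
  | CSeq of cmd & cmd
  | CIf of nat & cmd & cmd
  | CWhile of nat & cmd.

Inductive bigstep : cmd -> (nat -> nat) -> nat -> (nat -> nat) -> Prop :=
  | BInc i M : bigstep (CInc i) M 1 (upd M i (M i).+1)
  | BDec i M : bigstep (CDec i) M 1 (upd M i (M i).-1)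
  | BLd i j M : bigstep (CLd i j) M 1 (upd M i (M (M j)))
  | BSt i j M : bigstep (CSt i j) M 1 (upd M (M i) (M j))
  | BSkip M : bigstep CSkip M 0 M
  | BSeq c1 c2 M t1 M1 t2 M2 :
      bigstep c1 M t1 M1 -> bigstep c2 M1 t2 M2 ->
      bigstep (CSeq c1 c2) M (t1 + t2) M2
  | BIfZ r c1 c2 M t M' : M r = 0 -> bigstep c1 M t M' ->
      bigstep (CIf r c1 c2) M t.+1 M'
  | BIfS r c1 c2 M t M' : M r <> 0 -> bigstep c2 M t M' ->
      bigstep (CIf r c1 c2) M t.+2 M'
  | BWhileZ r c M : M r = 0 -> bigstep (CWhile r c) M 1 M
  | BWhileS r c M t1 M1 t2 M2 : M r <> 0 ->
      bigstep c M t1 M1 -> bigstep (CWhile r c) M1 t2 M2 ->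
      bigstep (CWhile r c) M (t1 + t2).+2 M2.

Fixpoint csize (c : cmd) : nat :=
  match c with
  | CInc _ | CDec _ | CLd _ _ | CSt _ _ => 1
  | CSkip => 0
  | CSeq c1 c2 => csize c1 + csize c2
  | CIf _ c1 c2 => csize c1 + csize c2 + 2
  | CWhile _ c => (csize c).+2
  end.

Fixpoint assemble (o : nat) (c : cmd) : program :=
  match c with
  | CInc i => [:: Inc i]
  | CDec i => [:: Dec i]
  | CLd i j => [:: Ld i j]
  | CSt i j => [:: St i j]
  | CSkip => [::]
  | CSeq c1 c2 => assemble o c1 ++ assemble (o + csize c1) c2
  | CIf r c1 c2 =>
      let l1 := o + csize c2 + 2 in
      Jz r l1 :: assemble o.+1 c2 ++ Jmp (l1 + csize c1) :: assemble l1 c1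
  | CWhile r c => Jz r (o + (csize c).+2) :: assemble o.+1 c ++ [:: Jmp o]
  end.

Lemma size_assemble c o : size (assemble o c) = csize c.
Proof.
elim: c o => //= [c1 IH1 c2 IH2|r c1 IH1 c2 IH2|r c IH] o.
- by rewrite size_cat IH1 IH2.
- by rewrite size_cat /= IH1 IH2; lia.
- by rewrite size_cat /= IH; lia.
Qed.

Definition code_at (p : program) (o : nat) (s : program) :=
  forall i, i < size s -> nth Halt p (o + i) = nth Halt s i.

Lemma code_at_cat p o s1 s2 :
  code_at p o (s1 ++ s2) -> code_at p o s1 /\ code_at p (o + size s1) s2.
Proof.
move=> H; split=> i Hi.
- by rewrite H ?nth_cat ?Hi // size_cat; lia.
- rewrite -addnA H ?nth_cat ?size_cat; last by lia.
  rewrite ifF; last by lia.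
  by congr nth; lia.
Qed.

Lemma code_at_cons p o i s :
  code_at p o (i :: s) -> nth Halt p o = i /\ code_at p o.+1 s.
Proof.
move=> H; split; first by move: (H 0 isT); rewrite addn0.
by move=> j Hj; move: (H j.+1 Hj); rewrite addnS.
Qed.

Definition steps (p : program) (c : config) (t : nat) (c' : config) :=
  forall t', exec p (t + t') c = exec p t' c'.

Lemma steps_trans p c1 t1 c2 t2 c3 :
  steps p c1 t1 c2 -> steps p c2 t2 c3 -> steps p c1 (t1 + t2) c3.
Proof. by move=> H1 H2 t; rewrite -addnA H1 H2. Qed.

Lemma steps1 p c c' : step p c = Some c' -> steps p c 1 c'.
Proof. by move=> H t; rewrite add1n /= H. Qed.

Lemma assemble_steps p c M t M' o :
  bigstep c M t M' -> code_at p o (assemble o c) ->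
  steps p (Config o M) t (Config (o + csize c) M').
Proof.
move=> H; elim: H o => {c M t M'} /=.
1-2: by move=> i M o /code_at_cons[H _]; apply: steps1; rewrite /step /= H addn1.
1-2: by move=> i j M o /code_at_cons[H _]; apply: steps1; rewrite /step /= H addn1.
- by move=> M o _; rewrite addn0.
- move=> c1 c2 M t1 M1 t2 M2 _ IH1 _ IH2 o /code_at_cat[H1].
  rewrite size_assemble addnA => H2.
  exact: steps_trans (IH1 _ H1) (IH2 _ H2).
- move=> r c1 c2 M t M' Mr _ IH o /code_at_cons[H0 /code_at_cat[H2]].
  rewrite size_assemble => /code_at_cons[H3 H1].
  rewrite -add1n.
  have -> : o + (csize c1 + csize c2 + 2) = o + csize c2 + 2 + csize c1 by lia.
  apply: steps_trans; last apply: IH; last first.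
    by move: H1; rewrite (_ : (o.+1 + csize c2).+1 = o + csize c2 + 2) //; lia.
  by apply: steps1; rewrite /step /= H0 Mr eqxx.
- move=> r c1 c2 M t M' Mr _ IH o /code_at_cons[H0 /code_at_cat[H2]].
  rewrite size_assemble => /code_at_cons[H3 H1].
  have -> : t.+2 = 1 + (t + 1) by lia.
  apply: (@steps_trans _ _ _ (Config o.+1 M)).
    by apply: steps1; rewrite /step /= H0; case: eqP Mr.
  apply: steps_trans (IH _ H2) _; apply: steps1.
  by rewrite /step /= H3; congr (Some (Config _ _)); lia.
- move=> r c M Mr o /code_at_cons[H0 _].
  by apply: steps1; rewrite /step /= H0 Mr eqxx.
- move=> r c M t1 M1 t2 M2 Mr _ IH1 _ IH2 o Hc.
  have /code_at_cons[H0 /code_at_cat[H2]] := Hc.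
  rewrite size_assemble => /code_at_cons[H3 _].
  have -> : (t1 + t2).+2 = 1 + (t1 + (1 + t2)) by lia.
  apply: (@steps_trans _ _ _ (Config o.+1 M)).
    by apply: steps1; rewrite /step /= H0; case: eqP Mr.
  apply: steps_trans (IH1 _ H2) _; apply: steps_trans (IH2 _ Hc).
  by apply: steps1; rewrite /step /= H3.
Qed.

Definition tri (c : cmd) (M : nat -> nat) (T : nat) (Q : (nat -> nat) -> Prop) :=
  exists M' t, [/\ bigstep c M t M', t <= T & Q M'].

Lemma tri_runs c w T Q :
  tri c (init_mem w) T Q ->
  exists t M, [/\ t <= T, Q M & runs_within (assemble 0 c) w t (output (Config 0 M))].
Proof.
move=> [M' [t [H tT QM]]]; exists t, M'; split=> //.
have H' : steps (assemble 0 c) (init w) t (Config (csize c) M').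
  by apply: assemble_steps H _ => i; rewrite add0n.
have E : exec (assemble 0 c) t (init w) = Config (csize c) M'.
  by rewrite -[t]addn0 H'.
rewrite /runs_within E; split=> //.
by rewrite /halted /step /= nth_default // size_assemble.
Qed.

Lemma tri_sub c M T T' Q Q' :
  tri c M T Q -> T <= T' -> (forall M', Q M' -> Q' M') -> tri c M T' Q'.
Proof.
move=> [M' [t [H tT QM]]] HT HQ; exists M', t; split=> //; last exact: HQ.
exact: leq_trans tT HT.
Qed.

Lemma tri_le c M T T' Q : tri c M T Q -> T <= T' -> tri c M T' Q.
Proof. by move=> H HT; apply: tri_sub H HT _. Qed.

Lemma tri_skip M Q : Q M -> tri CSkip M 0 Q.
Proof. by move=> H; exists M, 0; split=> //; constructor. Qed.

Lemma tri_seq c1 c2 M T1 T2 Q :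
  tri c1 M T1 (fun M1 => tri c2 M1 T2 Q) -> tri (CSeq c1 c2) M (T1 + T2) Q.
Proof.
move=> [M1 [t1 [H1 Ht1 [M2 [t2 [H2 Ht2 HQ]]]]]].
exists M2, (t1 + t2); split=> //; last exact: leq_add.
exact: BSeq H1 H2.
Qed.

Lemma tri_inc i M Q :
  Q (upd M i (M i).+1) -> tri (CInc i) M 1 Q.
Proof. by move=> H; exists (upd M i (M i).+1), 1; split=> //; constructor. Qed.

Lemma tri_dec i M Q :
  Q (upd M i (M i).-1) -> tri (CDec i) M 1 Q.
Proof. by move=> H; exists (upd M i (M i).-1), 1; split=> //; constructor. Qed.

Lemma tri_ld i j M Q :
  Q (upd M i (M (M j))) -> tri (CLd i j) M 1 Q.
Proof. by move=> H; exists (upd M i (M (M j))), 1; split=> //; constructor. Qed.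

Lemma tri_st i j M Q :
  Q (upd M (M i) (M j)) -> tri (CSt i j) M 1 Q.
Proof. by move=> H; exists (upd M (M i) (M j)), 1; split=> //; constructor. Qed.

Lemma tri_if r c1 c2 M T Q :
  (M r = 0 -> tri c1 M T Q) -> (M r <> 0 -> tri c2 M T Q) ->
  tri (CIf r c1 c2) M T.+2 Q.
Proof.
move=> H1 H2; case: (M r =P 0) => Hr.
- have [M' [t [H Ht HQ]]] := H1 Hr; exists M', t.+1; split=> //; first by constructor.
  lia.
- have [M' [t [H Ht HQ]]] := H2 Hr; exists M', t.+2; split=> //.
  exact: BIfS.
Qed.

(** The invariant is indexed by the number of rounds still to run, so it doubles as the variant.
    Every round pays two jumps, and the failing test at the end one step. *)
Lemma tri_while (I : nat -> (nat -> nat) -> Prop) r c T n M Q :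
  (forall M, I 0 M -> M r = 0) ->
  (forall j M, I j.+1 M -> M r <> 0) ->
  (forall j M, j < n -> I j.+1 M -> tri c M T (I j)) ->
  I n M -> (forall M, I 0 M -> Q M) ->
  tri (CWhile r c) M (n * T.+2 + 1) Q.
Proof.
move=> H0 HS Hb HI HQ.
elim: n M HI Hb => [|n IHn] M HI Hb.
  by exists M, 1; split=> //; [constructor; exact: H0|exact: HQ].
have [M1 [t1 [B1 L1 I1]]] := Hb n M (ltnSn n) HI.
have [M2 [t2 [B2 L2 I2]]] := IHn M1 I1 (fun j M Hj => Hb j M (ltnW Hj)).
exists M2, (t1 + t2).+2; split=> //; first exact: BWhileS (HS _ _ HI) B1 B2.
by rewrite mulSn; lia.
Qed.

Fixpoint cincn (a m : nat) : cmd := if m is m'.+1 then CSeq (CInc a) (cincn a m') else CSkip.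
Fixpoint cdecn (a m : nat) : cmd := if m is m'.+1 then CSeq (CDec a) (cdecn a m') else CSkip.

(** Memories are functions and are only compared pointwise; hence the postcondition is demanded for
    every memory that agrees with the updated one. *)
Lemma tri_cincn a m M Q :
  (forall M', M' =1 upd M a (M a + m) -> Q M') -> tri (cincn a m) M m Q.
Proof.
elim: m M => [|m IH] M HQ /=.
  apply: tri_skip; apply: HQ => x; rewrite /upd addn0.
  by case: eqP => // ->.
rewrite -add1n; apply/tri_seq/tri_inc; apply: IH => M' HM'.
apply: HQ => x; rewrite HM' /upd eqxx.
by case: eqP => // _; rewrite addSnnS.
Qed.

Lemma tri_cdecn a m M Q :
  (forall M', M' =1 upd M a (M a - m) -> Q M') -> tri (cdecn a m) M m Q.
Proof.
elim: m M => [|m IH] M HQ /=.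
  apply: tri_skip; apply: HQ => x; rewrite /upd subn0.
  by case: eqP => // ->.
rewrite -add1n; apply/tri_seq/tri_dec; apply: IH => M' HM'.
apply: HQ => x; rewrite HM' /upd eqxx.
by case: eqP => // _; lia.
Qed.

(* Cell 0, which must hold 0, serves as a scratch pointer. *)
Definition czero (a : nat) : cmd := CLd a 0.
Definition cset (a m : nat) : cmd := CSeq (czero a) (cincn a m).
Definition ccopy (a b : nat) : cmd := CSeq (cincn 0 a) (CSeq (CLd b 0) (cdecn 0 a)).

Lemma tri_czero a M Q : M 0 = 0 ->
  (forall M', M' =1 upd M a 0 -> Q M') -> tri (czero a) M 1 Q.
Proof.
by move=> M0 HQ; apply: tri_ld; apply: HQ => x; rewrite /upd !M0.
Qed.

Lemma tri_cset a m M Q : M 0 = 0 ->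
  (forall M', M' =1 upd M a m -> Q M') -> tri (cset a m) M m.+1 Q.
Proof.
move=> M0 HQ; rewrite -add1n; apply/tri_seq/tri_czero => // M1 H1.
apply: tri_cincn => M2 H2; apply: HQ => x; rewrite H2 /upd !H1 /upd eqxx.
by case: eqP => // /eqP/negbTE ->.
Qed.

(** There is no register-to-register move: cell 0 is raised to the address [a], used as a pointer,
    and lowered again. The cost is therefore linear in the address, and the target must not be cell
    0 itself. *)
Lemma tri_ccopy a b M Q : M 0 = 0 -> 0 < b ->
  (forall M', M' =1 upd M b (M a) -> Q M') -> tri (ccopy a b) M (2 * a + 1) Q.
Proof.
move=> M0 b0 HQ; have -> : 2 * a + 1 = a + (1 + a) by lia.
apply/tri_seq/tri_cincn => M1 H1.
apply/tri_seq/tri_ld; apply: tri_cdecn => M2 H2.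
apply: HQ => x; rewrite H2 /upd.
have -> : (0 == b) = false by lia.
have E1 : M1 0 = a by rewrite H1 /upd eqxx M0 add0n.
rewrite E1.
case: eqP => [->|x0].
  by rewrite subnn; have -> : (0 == b) = false by lia; rewrite M0.
case: eqP => [_|xb].
  by rewrite H1 /upd; case: eqP => [->|//]; rewrite !M0.
by rewrite H1 /upd; case: eqP.
Qed.

(** * Calculus of bounds of the form [(B + 2) ^ c] *)

Section PolynomialBounds.
Implicit Types (B a b c x y : nat).

Lemma pb_gt0 B c : 0 < (B + 2) ^ c.
Proof. by rewrite expn_gt0; lia. Qed.

Lemma pb_wide B a b : a <= b -> (B + 2) ^ a <= (B + 2) ^ b.
Proof. by move=> H; apply: leq_pexp2l; lia. Qed.

Lemma pb_const B m : m <= (B + 2) ^ m.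
Proof. by apply: ltnW; apply: ltn_expl; lia. Qed.

(** For u, v at least 1, u + v <= 2uv, and the factor 2 is absorbed by one more power of the base.
    This is why the base is [B + 2] and not [B]. *)
Lemma pb_add B a b x y :
  x <= (B + 2) ^ a -> y <= (B + 2) ^ b -> x + y <= (B + 2) ^ (a + b).+1.
Proof.
move=> Hx Hy; rewrite expnS expnD.
have := pb_gt0 B a; have := pb_gt0 B b.
move: ((B + 2) ^ a) ((B + 2) ^ b) Hx Hy => u v Hx Hy Hv Hu.
have : u <= u * v by rewrite leq_pmulr.
have : v <= u * v by rewrite leq_pmull.
by nia.
Qed.

Lemma pb_mul B a b x y :
  x <= (B + 2) ^ a -> y <= (B + 2) ^ b -> x * y <= (B + 2) ^ (a + b).
Proof. by move=> Hx Hy; rewrite expnD leq_mul. Qed.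

Lemma pb_id B x : x <= B -> x <= (B + 2) ^ 1.
Proof. by rewrite expn1; lia. Qed.

Lemma pb_comp B B' a c : B' <= (B + 2) ^ a -> (B' + 2) ^ c <= (B + 2) ^ ((a + 2).+1 * c).
Proof.
move=> H; rewrite expnM; case: c => [|c]; first by rewrite !expn0.
by rewrite leq_exp2r //; exact: pb_add H (pb_const _ 2).
Qed.

End PolynomialBounds.

(** * Polynomial-time computable functions *)

(* The input word occupies the even cells R + 2 i; the odd cells R + 2 i + 1 form a second array, for the
   memory of the simulated program and later for the output. *)
Definition ambient (R : nat) (inp M : nat -> nat) :=
  M 0 = 0 /\ forall i, M (R + 2 * i) = inp i.

Definition keeps (R top : nat) (M M' : nat -> nat) :=
  forall x, x < top \/ R <= x -> M' x = M x.

Lemma keeps_ambient R top inp M M' :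
  0 < top -> keeps R top M M' -> ambient R inp M -> ambient R inp M'.
Proof.
move=> t0 K [A0 A]; split; first by rewrite K //; left.
by move=> i; rewrite K ?A //; right; lia.
Qed.

Lemma keeps_trans R t1 t2 M1 M2 M3 :
  t1 <= t2 -> keeps R t1 M1 M2 -> keeps R t2 M2 M3 -> keeps R t1 M1 M3.
Proof.
move=> t12 K1 K2 x Hx; rewrite K2 ?K1 //.
by case: Hx => [/leq_trans H|]; [left; exact: H|right].
Qed.

Definition loads (b n : nat) (E : seq nat) (M : nat -> nat) :=
  forall i, i < n -> M (b + i) = nth 0 E i.

Lemma keeps_loads R top b n E M M' :
  b + n <= top -> keeps R top M M' -> loads b n E M -> loads b n E M'.
Proof. by move=> bt K H i Hi; rewrite K ?H //; left; lia. Qed.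

Definition bounded_by (B : nat) (inp : nat -> nat) (E : seq nat) :=
  (forall i, inp i <= B) /\ (forall i, nth 0 E i <= B).

(* [ptimes n m G] : from the [n] values [E] in the cells [b ..], and the input array, the code
   writes the [m] values [G inp E] to the cells [top ..], using only cells between [top] and [R]. *)
Definition ptimes (n m : nat) (G : (nat -> nat) -> seq nat -> seq nat) :=
  exists (code : nat -> nat -> nat -> cmd) (w c : nat),
  forall R b top inp E B M,
    0 < b -> b + n <= top -> top + m + w < R -> R <= B -> size E = n ->
    ambient R inp M -> loads b n E M -> bounded_by B inp E ->
    [/\ forall i, nth 0 (G inp E) i <= (B + 2) ^ c, size (G inp E) = m &
        tri (code R b top) M ((B + 2) ^ c)
          (fun M' => loads top m (G inp E) M' /\ keeps R top M M')].

Definition ptime (n : nat) (F : (nat -> nat) -> seq nat -> nat) :=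
  ptimes n 1 (fun inp E => [:: F inp E]).

Lemma ptimes_ext n m G G' :
  (forall inp E, size E = n -> G inp E = G' inp E) -> ptimes n m G -> ptimes n m G'.
Proof.
move=> H [code [w [c Hc]]]; exists code, w, c => R b top inp E B M ? ? ? ? sE *.
by rewrite -H //; apply: Hc.
Qed.

Lemma ptime_ext n F F' :
  (forall inp E, size E = n -> F inp E = F' inp E) -> ptime n F -> ptime n F'.
Proof. by move=> H; apply: ptimes_ext => inp E sE; rewrite H. Qed.

Lemma ptimeI n F (code : nat -> nat -> nat -> cmd) (w c : nat) :
  (forall R b top inp E B M,
    0 < b -> b + n <= top -> top + 1 + w < R -> R <= B -> size E = n ->
    ambient R inp M -> loads b n E M -> bounded_by B inp E ->
    F inp E <= (B + 2) ^ c /\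
    tri (code R b top) M ((B + 2) ^ c)
          (fun M' => M' top = F inp E /\ keeps R top M M')) -> ptime n F.
Proof.
move=> H; exists code, w, c => R b top inp E B M b0 bt tR RB sE A L BB.
have [H1 H2] := H R b top inp E B M b0 bt tR RB sE A L BB.
split=> //; first by case=> [|[|i]].
apply: tri_sub H2 _ _ => // M' [H2 H3]; split=> //.
by case=> // _; rewrite addn0 H2.
Qed.

Lemma ptimeE n F : ptime n F ->
  exists (code : nat -> nat -> nat -> cmd) (w c : nat),
  forall R b top inp E B M,
    0 < b -> b + n <= top -> top + 1 + w < R -> R <= B -> size E = n ->
    ambient R inp M -> loads b n E M -> bounded_by B inp E ->
    F inp E <= (B + 2) ^ c /\
    tri (code R b top) M ((B + 2) ^ c)
          (fun M' => M' top = F inp E /\ keeps R top M M').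
Proof.
move=> [code [w [c H]]]; exists code, w, c => R b top inp E B M b0 bt tR RB sE A L BB.
have [H1 _ H2] := H R b top inp E B M b0 bt tR RB sE A L BB.
split; first exact: (H1 0).
apply: tri_sub H2 _ _ => // M' [H2 H3]; split=> //.
by have := H2 0 isT; rewrite addn0.
Qed.

Lemma keeps_upd R top a v M M' : top <= a < R -> M' =1 upd M a v -> keeps R top M M'.
Proof. by move=> Ha E x Hx; rewrite E /upd; case: eqP => //; lia. Qed.

Lemma upd_at M a v M' : M' =1 upd M a v -> M' a = v.
Proof. by move=> ->; rewrite /upd eqxx. Qed.

Lemma ptime_proj n i : i < n -> ptime n (fun _ E => nth 0 E i).
Proof.
move=> Hi; apply: (@ptimeI _ _ (fun R b top => ccopy (b + i) top) 0 4) => R b top inp E B M.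
move=> b0 bt tR RB sE A L BB; split.
  by apply: leq_trans (pb_wide _ (_ : 1 <= 4)) => //; apply: pb_id; apply BB.
apply: (@tri_le _ _ (2 * (b + i) + 1)); last first.
  by rewrite !expnS expn0; nia.
apply: tri_ccopy; [by case: A|lia|] => M' E1; split; last by apply: keeps_upd E1; lia.
by rewrite (upd_at E1) L.
Qed.

Lemma ptime_const n v : ptime n (fun _ _ => v).
Proof.
apply: (@ptimeI _ _ (fun R b top => cset top v) 0 v.+1) => R b top inp E B M.
move=> b0 bt tR RB sE A L BB; split.
  exact: leq_trans (pb_const B v) (pb_wide _ _).
apply: tri_le (pb_const B v.+1).
apply: tri_cset; [by case: A|] => M' E1; split; last by apply: keeps_upd E1; lia.
by rewrite (upd_at E1).
Qed.

Lemma ptimes_nil n : ptimes n 0 (fun _ _ => [::]).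
Proof.
exists (fun _ _ _ => CSkip), 0, 0 => R b top inp E B M b0 bt tR RB sE A L BB.
split=> //; first by move=> i; rewrite nth_nil.
by apply: tri_le (leq0n _); apply: tri_skip; split.
Qed.

Lemma ptimes_cons n m F G :
  ptime n F -> ptimes n m G -> ptimes n m.+1 (fun inp E => F inp E :: G inp E).
Proof.
move=> /ptimeE[f [wf [cf Hf]]] [g [wg [cg Hg]]].
exists (fun R b top => CSeq (f R b top) (g R b top.+1)), (wf + wg), (cf + cg).+1.
move=> R b top inp E B M b0 bt tR RB sE A L BB.
have [F1 F2] := Hf R b top inp E B M b0 bt ltac:(lia) RB sE A L BB.
have [G1 G2 _] := Hg R b top.+1 inp E B M b0 ltac:(lia) ltac:(lia) RB sE A L BB.
split; last first.
- apply: tri_le (pb_add (leqnn _) (leqnn _)).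
  apply: tri_seq; apply: tri_sub F2 (leqnn _) _ => M1 [E1 K1].
  have A1 : ambient R inp M1 by apply: keeps_ambient K1 A; lia.
  have L1 : loads b n E M1 by apply: keeps_loads K1 L; lia.
  have [_ _ G3] := Hg R b top.+1 inp E B M1 b0 ltac:(lia) ltac:(lia) RB sE A1 L1 BB.
  apply: tri_sub G3 (leqnn _) _ => M2 [L2 K2]; split; last first.
    exact: keeps_trans K1 K2.
  case=> [_|i Hi]; first by rewrite addn0 K2 //; left.
  by rewrite addnS -addSn L2.
- by rewrite /= G2.
- case=> [|i] /=; first by apply: leq_trans F1 (pb_wide _ _); lia.
  by apply: leq_trans (G1 i) (pb_wide _ _); lia.
Qed.

(** The values of [G] may exceed [B], so [F] is run with the larger bound [B']; [pb_comp] turns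
    powers of [B' + 2] back into powers of [B + 2]. The result appears above the intermediate values
    and is copied down to [top]. *)
Lemma ptime_comp n m F G :
  ptime m F -> ptimes n m G -> ptime n (fun inp E => F inp (G inp E)).
Proof.
move=> /ptimeE[f [wf [cf Hf]]] [g [wg [cg Hg]]].
pose C := (cg + 1).+1.
pose C1 := ((C + 2).+1 * cf).
apply: (@ptimeI _ _ (fun R b top => CSeq (g R b top) (CSeq (f R top (top + m)) (ccopy (top + m) top)))
   (m + wf + wg) (cg + (C1 + 4).+1).+1) => R b top inp E B M b0 bt tR RB sE A L BB.
have [G1 G2 G3] := Hg R b top inp E B M b0 bt ltac:(lia) RB sE A L BB.
set B' := (B + 2) ^ cg + B.
have HB' : B' <= (B + 2) ^ C by apply: pb_add => //; exact: pb_id.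
have BB' : bounded_by B' inp (G inp E).
  case: BB => BB1 BB2; split=> i; last by apply: leq_trans (G1 i) _; rewrite /B'; lia.
  by apply: leq_trans (BB1 i) _; rewrite /B'; lia.
have X : forall M1, loads top m (G inp E) M1 -> keeps R top M M1 ->
   F inp (G inp E) <= (B + 2) ^ C1 /\
    tri (f R top (top + m)) M1 ((B + 2) ^ C1)
          (fun M' => M' (top + m) = F inp (G inp E) /\ keeps R (top + m) M1 M').
  move=> M1 L1 K1.
  have A1 : ambient R inp M1 by apply: keeps_ambient K1 A; lia.
  have [//|F1 F2] := Hf R top (top + m) inp (G inp E) B' M1 ltac:(lia) ltac:(lia) ltac:(lia) ltac:(rewrite /B'; lia) G2 A1 L1.
  split; first by apply: leq_trans F1 (pb_comp _ HB').
  by apply: tri_le F2 (pb_comp _ HB').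
split.
  have [M1 [t1 [_ _ [L1 K1]]]] := G3.
  have [F1 _] := X M1 L1 K1; apply: leq_trans F1 (pb_wide _ _); lia.
apply: tri_le (pb_add (leqnn _) (leqnn _)).
apply: tri_seq; apply: tri_sub G3 (leqnn _) _ => M1 [L1 K1].
have [_ F2] := X M1 L1 K1.
apply: tri_le (pb_add (leqnn _) (leqnn _)).
apply: tri_seq; apply: tri_sub F2 (leqnn _) _ => M2 [E2 K2].
have A2 : ambient R inp M2.
  by apply: keeps_ambient K2 _; [lia|]; apply: keeps_ambient K1 A; lia.
apply: (@tri_le _ _ (2 * (top + m) + 1)); last first.
  by rewrite !expnS expn0; nia.
apply: tri_ccopy; [by case: A2|lia|] => M3 E3.
rewrite (upd_at E3); split=> //.
apply: (keeps_trans (leqnn top) _ (keeps_upd _ E3)); last lia.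
by apply: keeps_trans K1 K2; lia.
Qed.

Lemma ptime_succ n F : ptime n F -> ptime n (fun inp E => (F inp E).+1).
Proof.
move=> /ptimeE[f [w [c H]]].
apply: (@ptimeI _ _ (fun R b top => CSeq (f R b top) (CInc top)) w (c + 1).+1).
move=> R b top inp E B M b0 bt tR RB sE A L BB.
have [F1 F2] := H R b top inp E B M b0 bt ltac:(lia) RB sE A L BB.
have X1 : 1 <= (B + 2) ^ 1 by rewrite expn1; lia.
split; first by rewrite -addn1; apply: pb_add.
apply: tri_le (pb_add (leqnn _) X1).
apply: tri_seq; apply: tri_sub F2 (leqnn _) _ => M1 [E1 K1].
apply: tri_inc; split; first by rewrite /upd eqxx E1.
by apply: (keeps_trans (leqnn top) K1 (keeps_upd _ (frefl _))); lia.
Qed.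

Lemma ptime_pred n F : ptime n F -> ptime n (fun inp E => (F inp E).-1).
Proof.
move=> /ptimeE[f [w [c H]]].
apply: (@ptimeI _ _ (fun R b top => CSeq (f R b top) (CDec top)) w (c + 1).+1).
move=> R b top inp E B M b0 bt tR RB sE A L BB.
have [F1 F2] := H R b top inp E B M b0 bt ltac:(lia) RB sE A L BB.
have X1 : 1 <= (B + 2) ^ 1 by rewrite expn1; lia.
split.
  by apply: leq_trans (leq_pred _) _; apply: leq_trans F1 (pb_wide _ _); lia.
apply: tri_le (pb_add (leqnn _) X1).
apply: tri_seq; apply: tri_sub F2 (leqnn _) _ => M1 [E1 K1].
apply: tri_dec; split; first by rewrite /upd eqxx E1.
by apply: (keeps_trans (leqnn top) K1 (keeps_upd _ (frefl _))); lia.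
Qed.

Lemma ptime_if n P F G : ptime n P -> ptime n F -> ptime n G ->
  ptime n (fun inp E => if P inp E == 0 then F inp E else G inp E).
Proof.
move=> /ptimeE[p [wp [cp Hp]]] /ptimeE[f [wf [cf Hf]]] /ptimeE[g [wg [cg Hg]]].
apply: (@ptimeI _ _ (fun R b top => CSeq (p R b top) (CIf top (f R b top) (g R b top)))
   (wp + wf + wg) (cp + (cf + cg + 2).+1).+1) => R b top inp E B M b0 bt tR RB sE A L BB.
have [P1 P2] := Hp R b top inp E B M b0 bt ltac:(lia) RB sE A L BB.
have [F1 _] := Hf R b top inp E B M b0 bt ltac:(lia) RB sE A L BB.
have [G1 _] := Hg R b top inp E B M b0 bt ltac:(lia) RB sE A L BB.
split.
  by case: ifP => _; [apply: leq_trans F1 (pb_wide _ _)|apply: leq_trans G1 (pb_wide _ _)]; lia.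
apply: tri_le (pb_add (leqnn _) (leqnn _)).
apply: tri_seq; apply: tri_sub P2 (leqnn _) _ => M1 [E1 K1].
have A1 : ambient R inp M1 by apply: keeps_ambient K1 A; lia.
have L1 : loads b n E M1 by apply: keeps_loads K1 L; lia.
apply: tri_le (pb_add (leqnn _) (pb_const B 2)); rewrite addn2.
have [_ F2] := Hf R b top inp E B M1 b0 bt ltac:(lia) RB sE A1 L1 BB.
have [_ G2] := Hg R b top inp E B M1 b0 bt ltac:(lia) RB sE A1 L1 BB.
apply: tri_if => EM; rewrite E1 in EM.
- apply: tri_sub F2 (pb_wide _ _) _; first lia.
  move=> M2 [E2 K2]; rewrite EM eqxx; split=> //.
  exact: keeps_trans K1 K2.
- apply: tri_sub G2 (pb_wide _ _) _; first lia.
  move=> M2 [E2 K2]; case: eqP => // _; split=> //.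
  exact: keeps_trans K1 K2.
Qed.

(** The address [R + 2 * v] is reached by v rounds of counting, affordable because v is itself
    polynomially bounded. *)
Lemma ptime_inp n F : ptime n F -> ptime n (fun inp E => inp (F inp E)).
Proof.
move=> /ptimeE[f [w [c H]]].
pose body top := CSeq (CDec top) (CSeq (CInc top.+1) (CInc top.+1)).
apply: (@ptimeI _ _ (fun R b top => CSeq (f R b top) (CSeq (cset top.+1 R)
   (CSeq (CWhile top (body top)) (CLd top top.+1)))) (w + 1) (c + (1 + ((c + 5) + 1 + 1).+2).+1).+1).
move=> R b top inp E B M b0 bt tR RB sE A L BB.
have [F1 F2] := H R b top inp E B M b0 bt ltac:(lia) RB sE A L BB.
split.
  by apply: leq_trans (proj1 BB _) (leq_trans (pb_id (leqnn _)) (pb_wide _ _)); lia.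
have X1 : 1 <= (B + 2) ^ 1 by rewrite expn1; lia.
apply: tri_le (pb_add (leqnn _) (leqnn _)).
apply: tri_seq; apply: tri_sub F2 (leqnn _) _ => M1 [E1 K1].
have A1 : ambient R inp M1 by apply: keeps_ambient K1 A; lia.
have X2 : R.+1 <= (B + 2) ^ 1 by rewrite expn1; lia.
apply: tri_le (pb_add X2 (leqnn _)).
apply/tri_seq/tri_cset; first by case: A1.
move=> M2 E2.
set v := F inp E in F1 E1 *.
apply: (@tri_le _ _ ((v * 5 + 1) + 1)); last first.
  have X5 : v * 5 <= (B + 2) ^ (c + 5) by apply: pb_mul => //; apply: pb_const.
  exact: (pb_add (pb_add X5 X1) X1).
apply: tri_seq.
apply: (@tri_while (fun j M' => [/\ M' top = j, M' top.+1 = R + 2 * (v - j), j <= v & forall x, x < top \/ R <= x -> M' x = M x])).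
- by move=> M' [].
- by move=> j M' [-> _ _ _].
- move=> j M' Hj [I1 I2 I3 I4]; rewrite -[3]/(1 + (1 + 1)).
  apply/tri_seq/tri_dec; apply/tri_seq/tri_inc; apply: tri_inc.
  split; rewrite /upd ?eqxx.
  + have -> : (top == top.+1) = false by lia. by rewrite I1.
  + have -> : (top.+1 == top) = false by lia. by rewrite I2; lia.
  + exact: ltnW.
  + move=> x Hx; have -> : (x == top.+1) = false by lia.
    have -> : (x == top) = false by lia. exact: I4.
- split=> //.
  + by rewrite E2 /upd (_ : (top == top.+1) = false) ?E1 //; lia.
  + by rewrite (upd_at E2) subnn addn0.
  + move=> x Hx; rewrite E2 /upd; have -> : (x == top.+1) = false by lia.
    exact: K1.
- move=> M3 [I1 I2 I3 I4]; apply: tri_ld; split.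
    by rewrite /upd eqxx I2 subn0 I4; [case: A|lia].
  move=> x Hx; rewrite /upd; have -> : (x == top) = false by lia.
  exact: I4.
Qed.

(** The bound on the value sits inside the specification of the code, which speaks about a memory;
    an explicit memory with the arguments in cells 1 to n brings it out. *)
Lemma ptime_value n F : ptime n F ->
  exists c, forall inp E B, size E = n -> bounded_by B inp E -> F inp E <= (B + 2) ^ c.
Proof.
move=> /ptimeE[f [w [c H]]].
pose R := n + 4 + w; exists ((R + 2).+1 * c) => inp E B sE [BB1 BB2].
pose M x := if x < R then nth 0 (0 :: E) x else inp ((x - R)./2).
have [||||||||H1 _] := H R 1 n.+1 inp E (B + R) M; rewrite /R //; try lia.
- split=> [|i]; first by rewrite /M ifT // /R; lia.
  rewrite /M ifF; last by rewrite /R; lia.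
  by rewrite addKn mul2n doubleK.
- by move=> i Hi; rewrite /M ifT // /R; lia.
- by split=> i; [move: (BB1 i)|move: (BB2 i)]; lia.
apply: leq_trans H1 _; rewrite expnM.
case: c {H} => [|c]; first by rewrite !expn0.
rewrite leq_exp2r // -/R.
have -> : B + R + 2 = (B + 2) + R by lia.
have X : B + 2 <= (B + 2) ^ 1 by rewrite expn1.
by apply: leq_trans (pb_add X (pb_const _ R)) (pb_wide _ _); lia.
Qed.

(** Arguments are prepended one projection at a time, from the last; for [i = n] the whole
    environment stays available next to newly computed values. *)
Lemma ptimes_suffix n m G i : i <= n -> ptimes n m G ->
  ptimes n (i + m) (fun inp E => drop (n - i) E ++ G inp E).
Proof.
move=> Hi HG; elim: i Hi => [|i IH] Hi.
  by apply: ptimes_ext HG => inp E sE; rewrite subn0 drop_oversize ?sE.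
apply: ptimes_ext (ptimes_cons (ptime_proj (_ : n - i.+1 < n)) (IH (ltnW Hi))); last lia.
move=> inp E sE.
rewrite [drop (n - i.+1) E](@drop_nth _ 0); last by rewrite sE; lia.
by rewrite cat_cons; congr (_ :: drop _ _ ++ _); lia.
Qed.

Lemma ptimes_env n m G : ptimes n m G -> ptimes n (n + m) (fun inp E => E ++ G inp E).
Proof.
move=> /(ptimes_suffix (leqnn n)); apply: ptimes_ext => inp E sE.
by rewrite subnn drop0.
Qed.

Lemma ptimes1 n F : ptime n F -> ptimes n 1 (fun inp E => [:: F inp E]).
Proof. by []. Qed.

Definition iterate (Fb Fz Fs : (nat -> nat) -> seq nat -> nat) (inp : nat -> nat) (E : seq nat) (j : nat) :=
  iteri j (fun i a => Fs inp (E ++ [:: i; a])) (Fz inp E).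

Lemma nth_env2 E i a j : nth 0 (E ++ [:: i; a]) j <= nth 0 E j + i + a.
Proof.
rewrite nth_cat; case: ltnP => H; first lia.
by case: (j - size E) => [|[|k]] /=; rewrite ?nth_nil; lia.
Qed.

(* The iterates must be polynomially bounded: this is the limited recursion of Grzegorczyk. *)
Lemma ptime_rec n Fb Fz Fs : ptime n Fb -> ptime n Fz -> ptime n.+2 Fs ->
  (exists c, forall inp E B, size E = n -> bounded_by B inp E ->
     forall j, j <= Fb inp E -> iterate Fb Fz Fs inp E j <= (B + 2) ^ c) ->
  ptime n (fun inp E => iterate Fb Fz Fs inp E (Fb inp E)).
Proof.
move=> /ptimeE[f [wf [cf Hf]]] Pz /ptimeE[g [wg [cg Hg]]] [ci Hi].
have [s [ws [cs Hs]]] : ptimes n (n + 2) (fun inp E => E ++ [:: 0; Fz inp E]).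
  apply: ptimes_env; apply: ptimes_cons (ptime_const _ 0) _; exact: ptimes1.
(* Cell [top] counts the remaining rounds. From [top.+1] on lie a copy of E, the index at
   [top + n + 1] and the accumulator at [top + n + 2], in the order in which [Fs] expects them;
   [top + n + 3] receives the next value. *)
pose body R top := CSeq (CDec top) (CSeq (g R top.+1 (top + n + 3))
   (CSeq (ccopy (top + n + 3) (top + n + 2)) (CInc (top + n + 1)))).
pose C := ((1 + cf).+1 + ci).+1.
pose C1 := (C + 2).+1 * cg.
pose C2 := (cf + (C1 + 4 + 4).+2).
apply: (@ptimeI _ _ (fun R b top => CSeq (f R b top) (CSeq (s R b top.+1)
   (CSeq (CWhile top (body R top)) (ccopy (top + n + 2) top))))
   (n + 5 + wf + wg + ws) (cf + (cs + ((C2 + 1).+1 + 4).+1).+1 + ci).+1).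
move=> R b top inp E B M b0 bt tR RB sE A L BB.
have X1 : 1 <= (B + 2) ^ 1 by rewrite expn1; lia.
have X4 : forall y, y < R -> 2 * y + 1 <= (B + 2) ^ 4.
  by move=> y Hy; rewrite !expnS expn0; nia.
have [F1 F2] := Hf R b top inp E B M b0 bt ltac:(lia) RB sE A L BB.
set v := Fb inp E in F1 *.
have HI := Hi inp E B sE BB; rewrite -/v in HI.
set acc := iterate Fb Fz Fs inp E in HI *.
split; first by apply: leq_trans (HI _ (leqnn _)) (pb_wide _ _); lia.
apply: (@tri_le _ _ ((B + 2) ^ (cf + (cs + ((C2 + 1).+1 + 4).+1).+1).+1)); last first.
  by apply: pb_wide; lia.
apply: tri_le (pb_add (leqnn _) (leqnn _)).
apply: tri_seq; apply: tri_sub F2 (leqnn _) _ => M1 [E1 K1].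
have A1 : ambient R inp M1 by apply: keeps_ambient K1 A; lia.
have L1 : loads b n E M1 by apply: keeps_loads K1 L; lia.
apply: tri_le (pb_add (leqnn _) (leqnn _)).
have [_ sG S3] := Hs R b top.+1 inp E B M1 b0 ltac:(lia) ltac:(lia) RB sE A1 L1 BB.
apply: tri_seq; apply: tri_sub S3 (leqnn _) _ => M2 [L2 K2].
have K2' : keeps R top M M2 by apply: keeps_trans K1 K2.
apply: tri_le (pb_add (leqnn _) (X4 (top + n + 2) _)); last lia.
apply: tri_seq.
have XC : v * (1 + ((B + 2) ^ C1 + ((2 * (top + n + 3) + 1) + 1))).+2 + 1 <= (B + 2) ^ (C2 + 1).+1.
  apply: pb_add => //; apply: pb_mul F1 _.
  have -> : (1 + ((B + 2) ^ C1 + ((2 * (top + n + 3) + 1) + 1))).+2 =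
     (B + 2) ^ C1 + (2 * (top + n + 3) + 1) + 4 by lia.
  apply: leq_trans (pb_add (pb_add (leqnn _) (X4 _ _)) (pb_const B 4)) _; first lia.
  by apply: pb_wide; lia.
apply: tri_le XC.
apply: (@tri_while (fun j M' => [/\ M' top = j, j <= v, loads top.+1 (n + 2) (E ++ [:: v - j; acc (v - j)]) M' & keeps R top M M'])).
- by move=> M' [].
- by move=> j M' [-> _ _ _].
- move=> j M' Hj [I1 I2 I3 I4].
  apply/tri_seq/tri_dec.
  set M3 := upd _ _ _.
  have K3 : keeps R top M M3.
    apply: (keeps_trans (leqnn _) I4); apply: (@keeps_upd _ _ top (M' top).-1) => //; lia.
  have E3 : M3 top = j by rewrite /M3 /upd eqxx I1.
  have L3 : loads top.+1 (n + 2) (E ++ [:: v - j.+1; acc (v - j.+1)]) M3.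
    by move=> i Hi'; rewrite /M3 /upd ifF ?I3 //; lia.
  have A3 : ambient R inp M3 by apply: keeps_ambient K3 A; lia.
  apply: tri_seq.
  (* Bounds the extended environment: the index is at most v, and the accumulator at most
     [(B + 2) ^ ci] by the assumption of limited recursion. *)
  set B' := (B + v) + (B + 2) ^ ci.
  have HB' : B' <= (B + 2) ^ C.
    by apply: pb_add => //; apply: pb_add => //; exact: pb_id.
  have HA := HI (v - j.+1) (leq_subr _ _).
  have BB' : bounded_by B' inp (E ++ [:: v - j.+1; acc (v - j.+1)]).
    case: BB => BB1 BB2; split=> i; first by move: (BB1 i); rewrite /B'; lia.
    by apply: leq_trans (nth_env2 _ _ _ _) _; move: (BB2 i); rewrite /B'; lia.
  have [_ G2] := Hg R top.+1 (top + n + 3) inp (E ++ [:: v - j.+1; acc (v - j.+1)]) B' M3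
    ltac:(lia) ltac:(lia) ltac:(lia) ltac:(rewrite /B'; lia) ltac:(by rewrite size_cat sE /= addn2) A3
    ltac:(by move=> i Hi'; apply: L3; lia) BB'.
  apply: tri_sub G2 (pb_comp _ HB') _ => M4 [E4 K4].
  have K4' : keeps R top M M4 by apply: keeps_trans K3 K4; lia.
  apply/tri_seq/tri_ccopy; [by rewrite K4'; [case: A|left; lia]|lia|] => M5 E5.
  apply: tri_inc.
  have K5 : keeps R top M M5.
    by apply: (keeps_trans (leqnn _) K4' (keeps_upd _ E5)); lia.
  split.
  + rewrite /upd ifF; last lia.
    by rewrite E5 /upd ifF ?K4 //; [left|]; lia.
  + lia.
  + move=> i Hi'; rewrite /upd nth_cat sE.
    case: ltnP => Hin.
      rewrite ifF; last lia.
      rewrite E5 /upd ifF; last lia.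
      rewrite K4; last lia.
      by rewrite L3 ?nth_cat ?sE ?Hin //; lia.
    case: eqP => Hx.
      have -> : i - n = 0 by lia.
      rewrite /= E5 /upd ifF; last lia.
      rewrite K4; last lia.
      have -> : top + n + 1 = top.+1 + n by lia.
      rewrite L3 ?nth_cat ?sE ?ltnn ?subnn /=; lia.
    have -> : i - n = 1 by lia.
    have -> : top.+1 + i = top + n + 2 by lia.
    rewrite (upd_at E5) E4 /=.
    have -> : v - j = (v - j.+1).+1 by lia.
    by [].
  + apply: (keeps_trans (leqnn _) K5); apply: (@keeps_upd _ _ (top + n + 1) (M5 (top + n + 1)).+1) => //; lia.
- split=> //.
  + by rewrite K2 //; left.
  + by move=> i Hi'; rewrite L2 // subnn.
- move=> M3 [I1 I2 I3 I4].
  apply: tri_ccopy; [by rewrite I4; [case: A|left; lia]|lia|] => M4 E4; split; last first.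
    by apply: (keeps_trans (leqnn _) I4 (keeps_upd _ E4)); lia.
  rewrite (upd_at E4) (_ : top + n + 2 = top.+1 + (n + 1)); last lia.
  rewrite I3; last lia.
  by rewrite nth_cat sE ifF ?addKn ?subn0 //; lia.
Qed.

Lemma ptimes_map n (s : seq nat) : (forall i, i \in s -> i < n) ->
  ptimes n (size s) (fun _ E => [seq nth 0 E i | i <- s]).
Proof.
elim: s => [|i s IH] H; first exact: ptimes_nil.
apply: ptimes_cons (ptime_proj _) (IH _); first by apply: H; rewrite mem_head.
by move=> j Hj; apply: H; rewrite inE Hj orbT.
Qed.

Lemma ptime_weaken n m F : ptime n F -> ptime (n + m) (fun inp E => F inp (take n E)).
Proof.
move=> PF; have := @ptimes_map (n + m) (iota 0 n); rewrite size_iota => PS.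
apply: (ptime_comp PF); apply: ptimes_ext (PS _).
  by move=> inp E sE; rewrite map_nth_iota0 // sE leq_addr.
by move=> i; rewrite mem_iota; lia.
Qed.

Lemma ptime_app2 n f A1 A2 : ptime 2 (fun inp E => f inp (nth 0 E 0) (nth 0 E 1)) ->
  ptime n A1 -> ptime n A2 -> ptime n (fun inp E => f inp (A1 inp E) (A2 inp E)).
Proof. by move=> Pf P1 P2; apply: (ptime_comp Pf (ptimes_cons P1 (ptimes1 P2))). Qed.

Section Loops.
Variables (n : nat).

(** A form of limited recursion in which the step receives index and accumulator as proper
    arguments. In exchange it must ignore the two entries appended to the environment; similar side
    conditions recur below for one appended entry. *)
Lemma ptime_loop Fb Fz (s : (nat -> nat) -> seq nat -> nat -> nat -> nat) :
  ptime n Fb -> ptime n Fz ->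
  ptime n.+2 (fun inp E => s inp E (nth 0 E n) (nth 0 E n.+1)) ->
  (forall inp E x y i a, size E = n -> s inp (E ++ [:: x; y]) i a = s inp E i a) ->
  (exists c, forall inp E B, size E = n -> bounded_by B inp E ->
     forall j, j <= Fb inp E -> iteri j (s inp E) (Fz inp E) <= (B + 2) ^ c) ->
  ptime n (fun inp E => iteri (Fb inp E) (s inp E) (Fz inp E)).
Proof.
move=> Pb Pz Ps Hs [c Hc].
have E1 inp E j : size E = n ->
    iterate Fb Fz (fun inp E => s inp E (nth 0 E n) (nth 0 E n.+1)) inp E j
    = iteri j (s inp E) (Fz inp E).
  move=> sE; elim: j => // j; rewrite /iterate /= => IH; rewrite !IH Hs //.
  by rewrite !nth_cat sE ltnn subnn ltnNge leqnSn /= subSnn.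
apply: ptime_ext (ptime_rec Pb Pz Ps _).
  by move=> inp E sE; rewrite E1.
by exists c => inp E B sE BB j Hj; rewrite E1 //; apply: Hc Hj.
Qed.

End Loops.

(** * Arithmetic, tests, bounded sums and bounded search *)

Lemma ptime_addn n F G : ptime n F -> ptime n G -> ptime n (fun inp E => F inp E + G inp E).
Proof.
apply: (@ptime_app2 n (fun _ => addn)).
apply: ptime_ext (@ptime_loop 2 (fun _ E => nth 0 E 1) (fun _ E => nth 0 E 0) (fun _ _ _ a => a.+1) _ _ _ _ _).
- move=> inp E sE; elim: (nth 0 E 1) => [|m IH] /=; first by rewrite addn0.
  by rewrite IH addnS.
- exact: ptime_proj.
- exact: ptime_proj.
- by apply: ptime_succ; apply: ptime_proj.
- by [].
exists 2 => inp E B sE [_ BB] j Hj.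
apply: (@leq_trans (nth 0 E 0 + j)).
  by elim: j {Hj} => [|j IH] /=; rewrite ?addn0 ?addnS.
by rewrite !expnS expn0; move: (BB 0) (BB 1); nia.
Qed.

Lemma ptime_muln n F G : ptime n F -> ptime n G -> ptime n (fun inp E => F inp E * G inp E).
Proof.
apply: (@ptime_app2 n (fun _ => muln)).
have X (E : seq nat) j : iteri j (fun _ a => a + nth 0 E 0) 0 = nth 0 E 0 * j.
  by elim: j => [|j IH]; rewrite ?muln0 //= IH mulnS addnC.
apply: ptime_ext (@ptime_loop 2 (fun _ E => nth 0 E 1) (fun _ E => 0) (fun _ E _ a => a + nth 0 E 0) _ _ _ _ _).
- by move=> inp E sE; exact: X.
- exact: ptime_proj.
- exact: ptime_const.
- by apply: ptime_addn; apply: ptime_proj.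
- by move=> inp E x y i a sE; rewrite nth_cat sE.
exists 2 => inp E B sE [_ BB] j Hj; rewrite X.
by rewrite !expnS expn0; move: (BB 0) (BB 1); nia.
Qed.

Lemma ptime_subn n F G : ptime n F -> ptime n G -> ptime n (fun inp E => F inp E - G inp E).
Proof.
apply: (@ptime_app2 n (fun _ => subn)).
have X (E : seq nat) j : iteri j (fun _ a => a.-1) (nth 0 E 0) = nth 0 E 0 - j.
  by elim: j => [|j IH]; rewrite ?subn0 //= IH; lia.
apply: ptime_ext (@ptime_loop 2 (fun _ E => nth 0 E 1) (fun _ E => nth 0 E 0) (fun _ E _ a => a.-1) _ _ _ _ _).
- by move=> inp E sE; exact: X.
- exact: ptime_proj.
- exact: ptime_proj.
- by apply: ptime_pred; apply: ptime_proj.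
- by [].
exists 1 => inp E B sE [_ BB] j Hj; rewrite X.
by rewrite expn1; move: (BB 0); lia.
Qed.

Section Booleans.
Variable n : nat.
Implicit Types (F G : (nat -> nat) -> seq nat -> nat) (P : (nat -> nat) -> seq nat -> bool).

Lemma ptime_ifb P F G : ptime n (fun inp E => P inp E) -> ptime n F -> ptime n G ->
  ptime n (fun inp E => if P inp E then F inp E else G inp E).
Proof.
move=> PP PF PG; apply: ptime_ext (ptime_if PP PG PF) => inp E _.
by case: (P inp E).
Qed.

Lemma ptime_true : ptime n (fun _ _ => true).
Proof. exact: ptime_const. Qed.

Lemma ptime_false : ptime n (fun _ _ => false).
Proof. exact: ptime_const. Qed.

Lemma ptime_andb P P' : ptime n (fun inp E => P inp E) -> ptime n (fun inp E => P' inp E) ->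
  ptime n (fun inp E => P inp E && P' inp E).
Proof.
move=> PP PQ; apply: ptime_ext (ptime_ifb PP PQ ptime_false) => inp E _.
by case: (P inp E).
Qed.

Lemma ptime_orb P P' : ptime n (fun inp E => P inp E) -> ptime n (fun inp E => P' inp E) ->
  ptime n (fun inp E => P inp E || P' inp E).
Proof.
move=> PP PQ; apply: ptime_ext (ptime_ifb PP ptime_true PQ) => inp E _.
by case: (P inp E).
Qed.

Lemma ptime_negb P : ptime n (fun inp E => P inp E) -> ptime n (fun inp E => ~~ P inp E).
Proof.
move=> PP; apply: ptime_ext (ptime_ifb PP ptime_false ptime_true) => inp E _.
by case: (P inp E).
Qed.

Lemma ptime_leq F G : ptime n F -> ptime n G -> ptime n (fun inp E => F inp E <= G inp E).
Proof.
move=> PF PG; apply: ptime_ext (ptime_if (ptime_subn PF PG) ptime_true ptime_false) => inp E _.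
by rewrite subn_eq0; case: leqP.
Qed.

Lemma ptime_ltn F G : ptime n F -> ptime n G -> ptime n (fun inp E => F inp E < G inp E).
Proof. by move=> PF PG; apply: ptime_leq (ptime_succ PF) PG. Qed.

Lemma ptime_eqn F G : ptime n F -> ptime n G -> ptime n (fun inp E => F inp E == G inp E).
Proof.
move=> PF PG; apply: ptime_ext (ptime_andb (ptime_leq PF PG) (ptime_leq PG PF)) => inp E _.
by rewrite eqn_leq.
Qed.

Lemma ptime_minn F G : ptime n F -> ptime n G -> ptime n (fun inp E => minn (F inp E) (G inp E)).
Proof.
by move=> PF PG; apply: ptime_ext (ptime_ifb (ptime_ltn PF PG) PF PG) => inp E _.
Qed.

End Booleans.

Section BoundedLoops.
Variable n : nat.
Implicit Types (G : (nat -> nat) -> seq nat -> nat).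

Lemma ptime_sum G (b : (nat -> nat) -> seq nat -> nat -> nat) :
  ptime n G -> ptime n.+1 (fun inp E => b inp E (nth 0 E n)) ->
  (forall inp E x j, size E = n -> b inp (rcons E x) j = b inp E j) ->
  ptime n (fun inp E => \sum_(j < G inp E) b inp E j).
Proof.
move=> PG Pb Hb.
have X inp E j : iteri j (fun i a => a + b inp E i) 0 = \sum_(i < j) b inp E i.
  by elim: j => [|j IH]; rewrite ?big_ord0 // big_ord_recr /= IH.
have X2 E x y : size E = n -> take n.+1 (E ++ [:: x; y]) = rcons E x.
  by move=> sE; rewrite take_cat sE ltnNge leqnSn /= subSnn /= cats1.
apply: ptime_ext (@ptime_loop n G (fun _ _ => 0) (fun inp E i a => a + b inp (take n E) i) PG (ptime_const _ _) _ _ _).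
- by move=> inp E sE; rewrite take_oversize ?sE // X.
- apply: ptime_addn; first by apply: ptime_proj.
  have := ptime_weaken 1 Pb; rewrite addn1; apply: ptime_ext => inp E sE.
  rewrite nth_take //.
  have -> : take n.+1 E = rcons (take n E) (nth 0 E n) by rewrite (take_nth 0) // sE.
  by rewrite Hb // size_take sE; case: ltnP => //; lia.
- by move=> inp E x y i a sE; rewrite take_cat sE ltnn subnn take0 cats0 take_oversize ?sE.
have [c Hc] := ptime_value Pb; have [cG HG] := ptime_value PG.
pose C := (1 + cG).+1; exists (cG + (C + 2).+1 * c) => inp E B sE BB j Hj.
rewrite take_oversize ?sE // X.
apply: (@leq_trans (\sum_(i < j) (B + 2) ^ ((C + 2).+1 * c))); last first.
  rewrite sum_nat_const card_ord; apply: pb_mul => //.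
  exact: leq_trans Hj (HG _ _ _ sE BB).
apply: leq_sum => i _.
have Hi := leq_trans (ltn_ord i) (leq_trans Hj (HG _ _ _ sE BB)).
have Y : B + G inp E <= (B + 2) ^ C.
  by apply: pb_add; [exact: pb_id|exact: HG].
apply: leq_trans (pb_comp _ Y).
have := Hc inp (rcons E i) (B + G inp E); rewrite size_rcons sE Hb // nth_rcons sE ltnn eqxx.
apply=> //; case: BB => B1 B2; split=> m; first by move: (B1 m); lia.
rewrite nth_rcons; case: ifP => _; first by move: (B2 m); lia.
by case: ifP => // _; move: (ltn_ord i); lia.
Qed.

Lemma ptime_has G (b : (nat -> nat) -> seq nat -> nat -> bool) :
  ptime n G -> ptime n.+1 (fun inp E => b inp E (nth 0 E n)) ->
  (forall inp E x j, size E = n -> b inp (rcons E x) j = b inp E j) ->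
  ptime n (fun inp E => has (b inp E) (iota 0 (G inp E))).
Proof.
move=> PG Pb Hb.
apply: ptime_ext (ptime_ltn (ptime_const n 0) (@ptime_sum G (fun inp E j => b inp E j) PG Pb _)).
  move=> inp E _; congr nat_of_bool.
  rewrite has_count -(big_mkord xpredT (fun j => nat_of_bool (b inp E j))) -sum1_count.
  by rewrite /index_iota subn0 [in RHS]big_mkcond /=.
by move=> inp E x j sE; rewrite Hb.
Qed.

Lemma ptime_all G (b : (nat -> nat) -> seq nat -> nat -> bool) :
  ptime n G -> ptime n.+1 (fun inp E => b inp E (nth 0 E n)) ->
  (forall inp E x j, size E = n -> b inp (rcons E x) j = b inp E j) ->
  ptime n (fun inp E => all (b inp E) (iota 0 (G inp E))).
Proof.
move=> PG Pb Hb.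
apply: ptime_ext (ptime_negb (@ptime_has G (fun inp E j => ~~ b inp E j) PG (ptime_negb Pb) _)).
  by move=> inp E _; rewrite -all_predC; congr nat_of_bool; apply: eq_all => j /=; rewrite negbK.
by move=> inp E x j sE; rewrite Hb.
Qed.

End BoundedLoops.

(** The position of the first hit is the number of j with no hit up to and including j. This reduces
    bounded search to bounded summation. *)
Lemma find_iota_sum (P : pred nat) m :
  find P (iota 0 m) = \sum_(j < m) ~~ has P (iota 0 j.+1).
Proof.
elim: m => [|m IH]; first by rewrite big_ord0.
have iS : iota 0 m.+1 = iota 0 m ++ [:: m] by rewrite -addn1 iotaD.
rewrite big_ord_recr [nat_of_ord _]/= -IH iS find_cat has_cat /= size_iota orbF.
have := find_size P (iota 0 m); have := has_find P (iota 0 m); rewrite size_iota.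
by case: (has P (iota 0 m)); case: (P m) => /=; lia.
Qed.

Lemma ptime_find n G (b : (nat -> nat) -> seq nat -> nat -> bool) :
  ptime n G -> ptime n.+1 (fun inp E => b inp E (nth 0 E n)) ->
  (forall inp E x j, size E = n -> b inp (rcons E x) j = b inp E j) ->
  ptime n (fun inp E => find (b inp E) (iota 0 (G inp E))).
Proof.
move=> PG Pb Hb.
apply: ptime_ext (@ptime_sum n G (fun inp E j => ~~ has (b inp (take n E)) (iota 0 j.+1)) PG _ _).
- by move=> inp E sE; rewrite find_iota_sum take_oversize ?sE.
- apply: ptime_negb.
  apply: (@ptime_has n.+1 (fun inp E => (nth 0 E n).+1) (fun inp E j => b inp (take n E) j)).
  + by apply: ptime_succ; apply: ptime_proj.
  + have PP : ptimes n.+2 n.+1 (fun _ E => rcons (take n E) (nth 0 E n.+1)).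
      have := @ptimes_map n.+2 (rcons (iota 0 n) n.+1); rewrite size_rcons size_iota => PS.
      apply: ptimes_ext (PS _); last first.
        by move=> i; rewrite mem_rcons inE mem_iota; lia.
      by move=> inp E sE; rewrite map_rcons map_nth_iota0 // sE ltnW.
    apply: ptime_ext (ptime_comp Pb PP) => inp E sE.
    have sT : size (take n E) = n by rewrite size_take sE; case: ltnP => //; lia.
    by rewrite Hb // nth_rcons sT ltnn eqxx.
  + by move=> inp E x j sE; rewrite -cats1 take_cat sE ltnSn.
- by move=> inp E x j sE; rewrite -cats1 take_cat sE ltnn subnn take0 cats0 take_oversize ?sE.
Qed.

(** The quotient a / b counts the j < a with (j + 1) b <= a; division by 0 is split off because it
    has to give 0. *)
Lemma ptime_divn n F G : ptime n F -> ptime n G -> ptime n (fun inp E => F inp E %/ G inp E).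
Proof.
apply: (@ptime_app2 n (fun _ => divn)).
apply: ptime_ext (@ptime_ifb 2 (fun _ E => nth 0 E 1 == 0) (fun _ _ => 0)
   (fun _ E => \sum_(j < nth 0 E 0) (j.+1 * nth 0 E 1 <= nth 0 E 0)) _ _ _).
- move=> inp E _; case: eqP => [->|/eqP b0]; first by rewrite divn0.
  rewrite -lt0n in b0; set a := nth 0 E 0; set b := nth 0 E 1 in b0 *.
  have X q m : \sum_(j < m) (j.+1 <= q) = minn m q.
    by elim: m => [|m IH]; rewrite ?big_ord0 ?min0n // big_ord_recr /= IH; lia.
  rewrite (eq_bigr (fun j : 'I_a => nat_of_bool (j.+1 <= a %/ b))) => [|j _]; last by rewrite leq_divRL.
  by rewrite X; apply/minn_idPr; exact: leq_div.
- by apply: ptime_eqn; [apply: ptime_proj|apply: ptime_const].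
- exact: ptime_const.
- apply: (@ptime_sum 2 _ (fun _ E j => j.+1 * nth 0 E 1 <= nth 0 E 0)).
  + exact: ptime_proj.
  + by apply: ptime_leq; [apply: ptime_muln; [apply: ptime_succ|]|]; apply: ptime_proj.
  + by move=> inp [|? [|? []]].
Qed.

Lemma ptime_modn n F G : ptime n F -> ptime n G -> ptime n (fun inp E => F inp E %% G inp E).
Proof.
move=> PF PG; apply: ptime_ext (ptime_subn PF (ptime_muln (ptime_divn PF PG) PG)) => inp E _.
by rewrite {1}(divn_eq (F inp E) (G inp E)) addKn.
Qed.

(** A step whose result never exceeds [H] keeps all iterates bounded. The [minn N] inside [cpow] and
    [genpow] is there to meet this condition. *)
Lemma ptime_iter n G Z (s : (nat -> nat) -> seq nat -> nat -> nat) H :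
  ptime n G -> ptime n Z -> ptime n.+1 (fun inp E => s inp E (nth 0 E n)) ->
  (forall inp E x j, size E = n -> s inp (rcons E x) j = s inp E j) -> ptime n H ->
  (forall inp E a, size E = n -> s inp E a <= H inp E) ->
  ptime n (fun inp E => iter (G inp E) (s inp E) (Z inp E)).
Proof.
move=> PG PZ Ps Hs PH Hb.
have X inp E z j : iteri j (fun _ a => s inp E a) z = iter j (s inp E) z.
  by elim: j => //= j ->.
apply: ptime_ext (@ptime_loop n G Z (fun inp E _ a => s inp (take n E) a) PG PZ _ _ _).
- by move=> inp E sE; rewrite take_oversize ?sE // X.
- have := @ptimes_map n.+2 (rcons (iota 0 n) n.+1); rewrite size_rcons size_iota => PS.
  have HS : forall i, i \in rcons (iota 0 n) n.+1 -> i < n.+2.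
    by move=> i; rewrite mem_rcons inE mem_iota; lia.
  apply: ptime_ext (ptime_comp Ps (PS HS)) => inp E sE.
  rewrite map_rcons map_nth_iota0; last by rewrite sE; lia.
  have sT : size (take n E) = n by rewrite size_take sE; case: ltnP => //; lia.
  by rewrite Hs // nth_rcons sT ltnn eqxx.
- by move=> inp E x y i a sE; rewrite take_cat sE ltnn subnn take0 cats0 take_oversize ?sE.
have [cH HH] := ptime_value PH; have [cZ HZ] := ptime_value PZ.
exists (cZ + cH).+1 => inp E B sE BB j _.
rewrite take_oversize ?sE // X.
apply: leq_trans (pb_add (HZ _ _ _ sE BB) (HH _ _ _ sE BB)).
by case: j => [|j] /=; [lia|apply: leq_trans (Hb _ _ _ sE) _; lia].
Qed.

Lemma ptime_expc n F c : ptime n F -> ptime n (fun inp E => F inp E ^ c).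
Proof.
move=> PF; elim: c => [|c IH]; first exact: ptime_const.
by apply: ptime_ext (ptime_muln PF IH) => inp E _; rewrite expnS.
Qed.

Lemma ptime_sumn n G (b : (nat -> nat) -> seq nat -> nat -> nat) :
  ptime n G -> ptime n.+1 (fun inp E => b inp E (nth 0 E n)) ->
  (forall inp E x j, size E = n -> b inp (rcons E x) j = b inp E j) ->
  ptime n (fun inp E => \sum_(0 <= j < G inp E) b inp E j).
Proof.
move=> PG Pb Hb; apply: ptime_ext (ptime_sum PG Pb Hb) => inp E _.
by rewrite big_mkord.
Qed.

(** * The reduction as a function on numbers *)

(* Powers are cut off at [N] so that every intermediate value stays polynomial in [N]. *)
Definition cpow (N p j : nat) : nat := iter j (fun a => minn N (a * p)) (minn N 1).

Lemma cpowE N p j : 0 < p -> cpow N p j = minn N (p ^ j).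
Proof.
move=> p0; elim: j => //= j ->; rewrite expnSr.
by rewrite minnMl minnA (minn_idPl (leq_pmulr N p0)).
Qed.

Section FieldArithmetic.
Variables (N p D : nat).

(* A number below p ^ D codes the vector of its base-p digits, an element of F_p[T]/(T ^ D - c);
   [lfsr c] is multiplication by T. *)
Definition lfsr (c v : nat) : nat :=
  \sum_(0 <= l < D) (((if l == 0 then 0 else v %/ cpow N p l.-1)
                 + v %/ cpow N p D.-1 * (c %/ cpow N p l)) %% p) * cpow N p l.

Definition genpow (c i : nat) : nat := iter i (fun v => minn N (lfsr c v)) 1.

(** Primitivity of the polynomial [T ^ D - c]: the power of T with exponent p^D - 1 is 1, and the
    powers of T exhaust the nonzero vectors. Checking this by exhaustion avoids any test of
    irreducibility. *)
Definition primitive_feedback (c : nat) : bool :=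
  (genpow c (cpow N p D).-1 == 1) &&
  all (fun v => (v == 0) || has (fun i => genpow c i == v) (iota 0 (cpow N p D).-1))
      (iota 0 (cpow N p D)).

Definition feedback : nat := find primitive_feedback (iota 0 (cpow N p D)).

Definition dlog (c z : nat) : nat := find (fun i => genpow c i == z) (iota 0 (cpow N p D)).

(* The value at T ^ b of the polynomial whose t coefficients are the base-p digits of Y. *)
Definition polyval (c t b Y : nat) : nat :=
  \sum_(0 <= l < D) ((\sum_(0 <= j < t) (Y %/ cpow N p j %% p) * (genpow c (b * j) %/ cpow N p l)) %% p)
     * cpow N p l.

(* Two nonzero elements have the same norm to F_p iff their logarithms agree modulo p - 1. *)
Definition normclass (c z : nat) : nat := if z == 0 then p.-1 else dlog c z %% p.-1.

(* The exponents b not divisible by p, in increasing order. *)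
Definition node (x : nat) : nat := p * (x %/ p.-1) + x %% p.-1 + 1.

Definition nodeclass (c t x Y : nat) : nat := normclass c (polyval c t (node x) Y).

End FieldArithmetic.

Definition isprime (p : nat) : bool :=
  (1 < p) && all (fun q => (q <= 1) || (p %% q != 0)) (iota 0 p).

Definition pickprime (N L m h : nat) : nat :=
  find (fun p => [&& isprime p, L <= p & m <= cpow N p h]) (iota 0 N).

Section Reduction.
Variables (Delta : nat) (inp : nat -> nat) (N d L X : nat).

Definition in_k : nat := inp 1.
Definition in_n : nat := inp 2.
Definition in_m : nat := inp 3.

Definition in_edge (u v : nat) : bool :=
  has (fun i => ((inp (4 + 2 * i) == u) && (inp (5 + 2 * i) == v))
             || ((inp (4 + 2 * i) == v) && (inp (5 + 2 * i) == u))) (iota 0 in_m).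

Definition hdeg : nat := in_k.+1 %/ 6.
Definition chr : nat := pickprime N L (2 * in_n * in_k) hdeg.
Definition fb : nat := feedback N chr (2 * hdeg).
Definition gcls (x Y : nat) : nat := nodeclass N chr (2 * hdeg) fb in_k.+1 x Y.
Definition npoly : nat := cpow N chr in_k.+1.

(* A vertex of A codes (chi, u, v, i, j, c1, c2, delta) in mixed radix. *)
Definition a_delta (x : nat) := x %% Delta.
Definition a_c2 (x : nat) := x %/ Delta %% chr.
Definition a_c1 (x : nat) := x %/ Delta %/ chr %% chr.
Definition a_j (x : nat) := x %/ Delta %/ chr %/ chr %% in_k.
Definition a_i (x : nat) := x %/ Delta %/ chr %/ chr %/ in_k %% in_k.
Definition a_v (x : nat) := x %/ Delta %/ chr %/ chr %/ in_k %/ in_k %% in_n.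
Definition a_u (x : nat) := x %/ Delta %/ chr %/ chr %/ in_k %/ in_k %/ in_n %% in_n.
Definition a_chi (x : nat) := x %/ Delta %/ chr %/ chr %/ in_k %/ in_k %/ in_n %/ in_n.

Definition num_A : nat := X * in_n * in_n * in_k * in_k * chr * chr * Delta.
Definition num_B : nat := X * npoly.

(** The pair i < j has rank C(j, 2) + i among the C(k, 2) pairs, and each rank owns [Delta] colours.
    Codes with i >= j are isolated vertices, which still need some legal colour. *)
Definition col_A (x : nat) : nat :=
  if a_i x < a_j x then Delta * ((a_j x * (a_j x).-1) %/ 2 + a_i x) + a_delta x + 1 else 1.
(** A B-vertex is a pair of a number [y %/ npoly], whose base-d digits list the values of the
    colouring chi, and a polynomial [y %% npoly]; chi is read at the constant coefficient of the
    latter. *)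
Definition col_B (y : nat) : nat := (y %/ npoly) %/ cpow N d (y %% npoly %% chr) %% d + 1.

Definition adj (x y : nat) : bool :=
  [&& a_chi x == y %/ npoly, a_i x < a_j x, in_edge (a_u x) (a_v x),
      gcls (a_u x * in_k + a_i x) (y %% npoly) == a_c1 x
    & gcls (a_v x * in_k + a_j x) (y %% npoly) == a_c2 x].

(** Edges are listed by increasing code [x * num_B + y]. This is the rank of z in that list, and
    [sel_E] recovers the code from the rank by bounded search. *)
Definition num_before (z : nat) : nat := \sum_(0 <= i < z) adj (i %/ num_B) (i %% num_B).
Definition num_E : nat := num_before (num_A * num_B).
Definition sel_E (r : nat) : nat :=
  find (fun z => adj (z %/ num_B) (z %% num_B) && (num_before z == r)) (iota 0 (num_A * num_B)).

Definition out_size : nat := 3 + num_A + num_B + 2 * num_E.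
Definition out_word (i : nat) : nat :=
  if i == 0 then num_A else if i == 1 then num_B else if i == 2 then num_E
  else if i < 3 + num_A then col_A (i - 3)
  else if i < 3 + num_A + num_B then col_B (i - (3 + num_A))
  else let r := i - (3 + num_A + num_B) in
       if r %% 2 == 0 then sel_E (r %/ 2) %/ num_B else sel_E (r %/ 2) %% num_B.

End Reduction.

(** * Polynomial-time bounds for the ingredients of the reduction *)

Ltac locality :=
  let E := fresh in let H := fresh in
  intros ? E ? ? H; repeat (destruct E as [|? E]; try discriminate H);
  reflexivity.

Lemma ptime_app3 n f A1 A2 A3 :
  ptime 3 (fun inp E => f inp (nth 0 E 0) (nth 0 E 1) (nth 0 E 2)) ->
  ptime n A1 -> ptime n A2 -> ptime n A3 ->
  ptime n (fun inp E => f inp (A1 inp E) (A2 inp E) (A3 inp E)).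
Proof.
by move=> Pf P1 P2 P3; apply: (ptime_comp Pf (ptimes_cons P1 (ptimes_cons P2 (ptimes1 P3)))).
Qed.

Lemma ptime_app4 n f A1 A2 A3 A4 :
  ptime 4 (fun inp E => f inp (nth 0 E 0) (nth 0 E 1) (nth 0 E 2) (nth 0 E 3)) ->
  ptime n A1 -> ptime n A2 -> ptime n A3 -> ptime n A4 ->
  ptime n (fun inp E => f inp (A1 inp E) (A2 inp E) (A3 inp E) (A4 inp E)).
Proof.
move=> Pf P1 P2 P3 P4.
exact: (ptime_comp Pf (ptimes_cons P1 (ptimes_cons P2 (ptimes_cons P3 (ptimes1 P4))))).
Qed.

Lemma ptime_app5 n f A1 A2 A3 A4 A5 :
  ptime 5 (fun inp E => f inp (nth 0 E 0) (nth 0 E 1) (nth 0 E 2) (nth 0 E 3) (nth 0 E 4)) ->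
  ptime n A1 -> ptime n A2 -> ptime n A3 -> ptime n A4 -> ptime n A5 ->
  ptime n (fun inp E => f inp (A1 inp E) (A2 inp E) (A3 inp E) (A4 inp E) (A5 inp E)).
Proof.
move=> Pf P1 P2 P3 P4 P5.
exact: (ptime_comp Pf (ptimes_cons P1 (ptimes_cons P2 (ptimes_cons P3 (ptimes_cons P4 (ptimes1 P5)))))).
Qed.

Lemma ptime_app7 n f A1 A2 A3 A4 A5 A6 A7 :
  ptime 7 (fun inp E => f inp (nth 0 E 0) (nth 0 E 1) (nth 0 E 2) (nth 0 E 3) (nth 0 E 4)
    (nth 0 E 5) (nth 0 E 6)) ->
  ptime n A1 -> ptime n A2 -> ptime n A3 -> ptime n A4 -> ptime n A5 -> ptime n A6 -> ptime n A7 ->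
  ptime n (fun inp E => f inp (A1 inp E) (A2 inp E) (A3 inp E) (A4 inp E) (A5 inp E) (A6 inp E)
    (A7 inp E)).
Proof.
move=> Pf P1 P2 P3 P4 P5 P6 P7.
exact: (ptime_comp Pf (ptimes_cons P1 (ptimes_cons P2 (ptimes_cons P3 (ptimes_cons P4
  (ptimes_cons P5 (ptimes_cons P6 (ptimes1 P7)))))))).
Qed.

Ltac polystep :=
  lazymatch goal with
  | |- ptime _ (fun _ E => nth 0 E _) => apply: ptime_proj; reflexivity
  | |- ptime _ (fun _ _ => ?c) => exact: ptime_const
  | |- ptime _ (fun inp E => _.+1) => apply: ptime_succ
  | |- ptime _ (fun inp E => _.-1) => apply: ptime_pred
  | |- ptime _ (fun inp E => _ + _) => apply: ptime_addn
  | |- ptime _ (fun inp E => _ * _) => apply: ptime_muln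
  | |- ptime _ (fun inp E => _ - _) => apply: ptime_subn
  | |- ptime _ (fun inp E => _ %/ _) => apply: ptime_divn
  | |- ptime _ (fun inp E => _ %% _) => apply: ptime_modn
  | |- ptime _ (fun inp E => minn _ _) => apply: ptime_minn
  | |- ptime _ (fun inp E => if _ then _ else _) => apply: ptime_ifb
  | |- ptime _ (fun inp E => nat_of_bool (_ && _)) => apply: ptime_andb
  | |- ptime _ (fun inp E => nat_of_bool (_ || _)) => apply: ptime_orb
  | |- ptime _ (fun inp E => nat_of_bool (~~ _)) => apply: ptime_negb
  | |- ptime _ (fun inp E => nat_of_bool (_ <= _)) => apply: ptime_leq
  | |- ptime _ (fun inp E => nat_of_bool (_ == _)) => apply: ptime_eqn
  | |- ptime _ (fun inp E => bigop _ _ _) => apply: ptime_sumn; [| |locality]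
  | |- ptime _ (fun inp E => nat_of_bool (has _ _)) => apply: ptime_has; [| |locality]
  | |- ptime _ (fun inp E => nat_of_bool (all _ _)) => apply: ptime_all; [| |locality]
  | |- ptime _ (fun inp E => find _ _) => apply: ptime_find; [| |locality]
  | |- ptime _ (fun inp E => inp _) => apply: ptime_inp
  end.

Lemma ptime_cpow n A1 A2 A3 : ptime n A1 -> ptime n A2 -> ptime n A3 ->
  ptime n (fun inp E => cpow (A1 inp E) (A2 inp E) (A3 inp E)).
Proof.
apply: (@ptime_app3 n (fun _ => cpow)).
apply: (@ptime_iter 3 (fun _ E => nth 0 E 2) (fun _ E => minn (nth 0 E 0) 1)
  (fun _ E a => minn (nth 0 E 0) (a * nth 0 E 1)) (fun _ E => nth 0 E 0)).
all: try by repeat polystep.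
- locality.
- by move=> _ E a _; apply: geq_minl.
Qed.

Lemma ptime_lfsr n A1 A2 A3 A4 A5 : ptime n A1 -> ptime n A2 -> ptime n A3 -> ptime n A4 -> ptime n A5 ->
  ptime n (fun inp E => lfsr (A1 inp E) (A2 inp E) (A3 inp E) (A4 inp E) (A5 inp E)).
Proof.
apply: (@ptime_app5 n (fun _ => lfsr)).
rewrite /lfsr; repeat first [polystep | apply: ptime_cpow].
Qed.

Lemma ptime_genpow n A1 A2 A3 A4 A5 : ptime n A1 -> ptime n A2 -> ptime n A3 -> ptime n A4 -> ptime n A5 ->
  ptime n (fun inp E => genpow (A1 inp E) (A2 inp E) (A3 inp E) (A4 inp E) (A5 inp E)).
Proof.
apply: (@ptime_app5 n (fun _ => genpow)).
apply: (@ptime_iter 5 (fun _ E => nth 0 E 4) (fun _ E => 1)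
  (fun _ E a => minn (nth 0 E 0) (lfsr (nth 0 E 0) (nth 0 E 1) (nth 0 E 2) (nth 0 E 3) a))
  (fun _ E => nth 0 E 0)).
all: try by repeat first [polystep | apply: ptime_lfsr].
- locality.
- by move=> _ E a _; apply: geq_minl.
Qed.

Lemma ptime_polyval n A1 A2 A3 A4 A5 A6 A7 : ptime n A1 -> ptime n A2 -> ptime n A3 -> ptime n A4 -> ptime n A5 -> ptime n A6 -> ptime n A7 ->
  ptime n (fun inp E => polyval (A1 inp E) (A2 inp E) (A3 inp E) (A4 inp E) (A5 inp E) (A6 inp E) (A7 inp E)).
Proof.
apply: (@ptime_app7 n (fun _ => polyval)).
rewrite /polyval; repeat first [polystep | apply: ptime_cpow | apply: ptime_genpow].
Qed.

Lemma ptime_chr n A1 A2 : ptime n A1 -> ptime n A2 ->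
  ptime n (fun inp E => chr inp (A1 inp E) (A2 inp E)).
Proof.
apply: (@ptime_app2 n chr).
rewrite /chr /pickprime /isprime /hdeg /in_n /in_k;
  repeat first [polystep | apply: ptime_cpow].
Qed.

Lemma ptime_fb n A1 A2 : ptime n A1 -> ptime n A2 ->
  ptime n (fun inp E => fb inp (A1 inp E) (A2 inp E)).
Proof.
apply: (@ptime_app2 n fb).
rewrite /fb /feedback /primitive_feedback /hdeg /in_k;
  repeat first [polystep | apply: ptime_genpow | apply: ptime_cpow | apply: ptime_chr].
Qed.

Lemma ptime_gcls n A1 A2 A3 A4 : ptime n A1 -> ptime n A2 -> ptime n A3 -> ptime n A4 ->
  ptime n (fun inp E => gcls inp (A1 inp E) (A2 inp E) (A3 inp E) (A4 inp E)).
Proof.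
apply: (@ptime_app4 n gcls).
rewrite /gcls /nodeclass /normclass /dlog /node /hdeg /in_k;
  repeat first [polystep | apply: ptime_polyval | apply: ptime_genpow | apply: ptime_cpow | apply: ptime_fb | apply: ptime_chr].
Qed.

Lemma ptime_npoly n A1 A2 : ptime n A1 -> ptime n A2 ->
  ptime n (fun inp E => npoly inp (A1 inp E) (A2 inp E)).
Proof.
apply: (@ptime_app2 n npoly).
rewrite /npoly /in_k; repeat first [polystep | apply: ptime_cpow | apply: ptime_chr].
Qed.

Lemma ptime_num_A Delta n A1 A2 A3 : ptime n A1 -> ptime n A2 -> ptime n A3 ->
  ptime n (fun inp E => num_A Delta inp (A1 inp E) (A2 inp E) (A3 inp E)).
Proof.
apply: (@ptime_app3 n (num_A Delta)).
rewrite /num_A /in_k /in_n; repeat first [polystep | apply: ptime_chr].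
Qed.

Lemma ptime_num_B n A1 A2 A3 : ptime n A1 -> ptime n A2 -> ptime n A3 ->
  ptime n (fun inp E => num_B inp (A1 inp E) (A2 inp E) (A3 inp E)).
Proof.
apply: (@ptime_app3 n num_B).
rewrite /num_B; repeat first [polystep | apply: ptime_npoly].
Qed.

Lemma ptime_col_A Delta n A1 A2 A3 : ptime n A1 -> ptime n A2 -> ptime n A3 ->
  ptime n (fun inp E => col_A Delta inp (A1 inp E) (A2 inp E) (A3 inp E)).
Proof.
apply: (@ptime_app3 n (col_A Delta)).
rewrite /col_A /a_i /a_j /a_delta /in_k; repeat first [polystep | apply: ptime_chr].
Qed.

Lemma ptime_col_B n A1 A2 A3 A4 : ptime n A1 -> ptime n A2 -> ptime n A3 -> ptime n A4 ->
  ptime n (fun inp E => col_B inp (A1 inp E) (A2 inp E) (A3 inp E) (A4 inp E)).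
Proof.
apply: (@ptime_app4 n col_B).
rewrite /col_B; repeat first [polystep | apply: ptime_npoly | apply: ptime_cpow | apply: ptime_chr].
Qed.

Lemma ptime_adj Delta n A1 A2 A3 A4 : ptime n A1 -> ptime n A2 -> ptime n A3 -> ptime n A4 ->
  ptime n (fun inp E => nat_of_bool (adj Delta inp (A1 inp E) (A2 inp E) (A3 inp E) (A4 inp E))).
Proof.
apply: (@ptime_app4 n (fun inp a0 a1 a2 a3 => nat_of_bool (adj Delta inp a0 a1 a2 a3))).
rewrite /adj /in_edge /a_chi /a_i /a_j /a_u /a_v /a_c1 /a_c2 /in_k /in_n /in_m;
  repeat first [polystep | apply: ptime_chr | apply: ptime_npoly | apply: ptime_gcls].
Qed.

Lemma ptime_num_E Delta n A1 A2 A3 : ptime n A1 -> ptime n A2 -> ptime n A3 ->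
  ptime n (fun inp E => num_E Delta inp (A1 inp E) (A2 inp E) (A3 inp E)).
Proof.
apply: (@ptime_app3 n (num_E Delta)).
rewrite /num_E /num_before;
  repeat first [polystep | apply: ptime_adj | apply: ptime_num_A | apply: ptime_num_B].
Qed.

Lemma ptime_sel_E Delta n A1 A2 A3 A4 : ptime n A1 -> ptime n A2 -> ptime n A3 -> ptime n A4 ->
  ptime n (fun inp E => sel_E Delta inp (A1 inp E) (A2 inp E) (A3 inp E) (A4 inp E)).
Proof.
apply: (@ptime_app4 n (sel_E Delta)).
rewrite /sel_E /num_before;
  repeat first [polystep | apply: ptime_adj | apply: ptime_num_A | apply: ptime_num_B].
Qed.

Lemma ptime_out_size Delta n A1 A2 A3 : ptime n A1 -> ptime n A2 -> ptime n A3 ->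
  ptime n (fun inp E => out_size Delta inp (A1 inp E) (A2 inp E) (A3 inp E)).
Proof.
apply: (@ptime_app3 n (out_size Delta)).
rewrite /out_size;
  repeat first [polystep | apply: ptime_num_A | apply: ptime_num_B | apply: ptime_num_E].
Qed.

Lemma ptime_out_word Delta n A1 A2 A3 A4 A5 : ptime n A1 -> ptime n A2 -> ptime n A3 -> ptime n A4 -> ptime n A5 ->
  ptime n (fun inp E => out_word Delta inp (A1 inp E) (A2 inp E) (A3 inp E) (A4 inp E) (A5 inp E)).
Proof.
apply: (@ptime_app5 n (out_word Delta)).
rewrite /out_word;
  repeat first [polystep | apply: ptime_num_A | apply: ptime_num_B | apply: ptime_num_E | apply: ptime_col_A | apply: ptime_col_B | apply: ptime_sel_E].
Qed.

Ltac cases_if :=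
  repeat match goal with
  | |- context [if ?b then _ else _] => let H := fresh in case: (boolP b) => H
  end; try done; try lia.

(** * Relocating the input *)

Definition cclear (r : nat) : cmd := CWhile r (CDec r).

Lemma tri_cclear r M Q :
  (forall M', M' =1 upd M r 0 -> Q M') -> tri (cclear r) M (M r * 3 + 1) Q.
Proof.
move=> HQ; apply: (@tri_while (fun j M' => M' =1 upd M r j)).
- by move=> M' ->; rewrite /upd eqxx.
- by move=> j M' ->; rewrite /upd eqxx.
- move=> j M' _ HM; apply: tri_dec => x; rewrite /upd !HM /upd eqxx.
  by case: eqP.
- by move=> x; rewrite /upd; case: eqP => // ->.
- exact: HQ.
Qed.

Fixpoint cclears (a m : nat) : cmd :=
  if m is m'.+1 then CSeq (cclear a) (cclears a.+1 m') else CSkip.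

Lemma tri_cclears a m M V Q :
  (forall x, a <= x < a + m -> M x <= V) ->
  (forall M', (forall x, M' x = if a <= x < a + m then 0 else M x) -> Q M') ->
  tri (cclears a m) M (m * (V * 3 + 1)) Q.
Proof.
elim: m a M => [|m IH] a M HV HQ /=.
  by apply: tri_le (leq0n _); apply: tri_skip; apply: HQ => x; case: ifP => //; lia.
rewrite mulSn; apply: tri_seq.
apply: (@tri_le _ _ (M a * 3 + 1)); last by rewrite leq_add2r leq_mul2r HV ?orbT //; lia.
apply: tri_cclear => M1 H1; apply: IH => [x Hx|M2 H2].
  by rewrite H1 /upd ifF ?HV //; lia.
apply: HQ => x; rewrite H2 H1 /upd.
by cases_if.
Qed.

Fixpoint csave (a m : nat) : cmd :=
  if m is m'.+1 then CSeq (CInc 0) (CSeq (CSt 0 a) (csave a.+1 m')) else CSkip.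

(** The condition [a + m <= (M 0).+1] puts all targets beyond all sources, so no cell is overwritten
    before it is saved. *)
Lemma tri_csave a m M Q :
  0 < a -> a + m <= (M 0).+1 ->
  (forall M', M' 0 = M 0 + m ->
     (forall x, 0 < x -> M' x = if M 0 < x <= M 0 + m then M (x - (M 0).+1 + a) else M x) -> Q M') ->
  tri (csave a m) M (2 * m) Q.
Proof.
elim: m a M => [|m IH] a M a0 Ha HQ /=.
  by apply: tri_skip; apply: HQ; rewrite ?addn0 // => x Hx; rewrite ifF //; lia.
have -> : 2 * m.+1 = 1 + (1 + 2 * m) by lia.
apply/tri_seq/tri_inc; apply/tri_seq/tri_st.
set M1 := upd _ _ _.
have E0 : upd M 0 (M 0).+1 0 = (M 0).+1 by rewrite /upd eqxx.
have E1 : M1 0 = (M 0).+1 by rewrite /M1 E0 /upd /=.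
have E2 x : 0 < x -> M1 x = if x == (M 0).+1 then M a else M x.
  move=> Hx; rewrite /M1 E0 /upd; case: eqP => // _.
    by rewrite ifF //; lia.
  by rewrite ifF //; lia.
apply: IH; rewrite ?E1; [lia|lia|] => M2 F1 F2.
apply: HQ => [|x Hx]; first by rewrite F1; lia.
by rewrite F2 //; case: ifP => H1; rewrite E2; cases_if; congr M; lia.
Qed.

(* Relocates the input word: memory cell i moves to cell R + 2 i, the odd cells R + 2 i + 1 and
   cell 0 are cleared. The cells below R are first saved behind the input. *)
Definition prologue (R : nat) : cmd :=
  CSeq (cincn 0 R) (CSeq (csave 1 R.-1) (CSeq (cclear 2) (CSeq (CInc 2) (CSeq (CSt 2 0)
  (CSeq (cclears 2 (R - 2)) (CSeq (cclear 0)
  (CSeq (ccopy 1 7) (CSeq (cdecn 7 (2 * R).-1) (CSeq (ccopy 1 6) (CSeq (cset 2 R)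
  (CSeq (CWhile 6 (CSeq (CDec 6) (CSeq (CInc 2) (CInc 2))))
  (CSeq (ccopy 2 4) (CSeq (ccopy 1 3) (CSeq (cdecn 3 R.-1)
  (CSeq (CWhile 3 (CSeq (CDec 3) (CSeq (CLd 5 1) (CSeq (CSt 2 5) (CSeq (CInc 2) (CSeq (czero 5)
     (CSeq (CSt 2 5) (CSeq (cdecn 2 3) (CDec 1)))))))))
  (CSeq (cset 3 R.-1)
  (CSeq (CWhile 3 (CSeq (CDec 3) (CSeq (CLd 5 4) (CSeq (CSt 2 5) (CSeq (czero 5) (CSeq (CSt 4 5)
     (CSeq (CInc 2) (CSeq (CSt 2 5) (CSeq (cdecn 2 3) (cdecn 4 2))))))))))
  (CSeq (ccopy 7 R) (czero R.+1))))))))))))))))))).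

Lemma init_mem_oversize w x : size w < x -> init_mem w x = 0.
Proof. by case: x => // x Hx; rewrite /= nth_default. Qed.

Lemma tri_prologue R w B : 8 < R -> R <= B -> (forall x, init_mem w x <= B) ->
  tri (prologue R) (init_mem w) (400 * (B + 2) ^ 2)
    (fun M => ambient R (init_mem w) M /\ forall i, M (R + 2 * i).+1 = 0).
Proof.
move=> R8 RB WB; set W := init_mem w; set sz := size w.
have szB : sz <= B by exact: (WB 0).
have W0 : W 0 = sz by [].
have Wz x : sz < x -> W x = 0 by exact: init_mem_oversize.
(* The running time stays a metavariable which the commands fill in one after the other; it is
   compared with the bound only at the end. *)
have : exists T, T <= 400 * (B + 2) ^ 2 /\ tri (prologue R) W T
    (fun M => ambient R W M /\ forall i, M (R + 2 * i).+1 = 0); last first.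
  by case=> T [HT H]; apply: tri_le H HT.
eexists; split; last first.
rewrite /prologue.
eapply tri_seq, tri_cincn => M1 H1.
have {}H1 x : M1 x = if x == 0 then sz + R else W x by exact: H1.
eapply tri_seq, tri_csave; [done| |move=> M2 H20 H2].
  by rewrite H1 /=; lia.
have {}H20 : M2 0 = sz + 2 * R - 1 by rewrite H20 H1 /=; lia.
have {}H2 x : 0 < x -> M2 x = if sz + R < x < sz + 2 * R then W (x - (sz + R)) else W x.
  move=> Hx; rewrite H2 // !H1 /upd /=.
  by cases_if; congr W; lia.
eapply tri_seq, (@tri_le _ _ _ (B * 3 + 1)); [apply: tri_cclear => M3 H3| ]; last first.
  by rewrite leq_add2r leq_mul2r H2 // ifF ?WB //; lia.
eapply tri_seq, tri_inc, tri_seq, tri_st.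
set M4 := upd _ _ _.
have E4 : M4 =1 upd (upd M2 2 1) 1 (sz + 2 * R - 1).
  by move=> x; rewrite /M4 /upd !H3 /upd /= H20; cases_if.
clearbody M4; clear H1 M1 H3 M3.
eapply tri_seq, (@tri_cclears _ _ _ (B + 1)) => [x Hx|M5 H5].
  rewrite E4 /upd; cases_if; rewrite H2; last lia.
  by rewrite ifF; [move: (WB x); rewrite -/W|]; lia.
eapply tri_seq, (@tri_le _ _ _ ((3 * B) * 3 + 1)); [apply: tri_cclear => M6 H6| ]; last first.
  by rewrite leq_add2r leq_mul2r H5 /= E4 /upd /= H20; lia.
have {H5}H6 x : M6 x = if x == 0 then 0 else if x == 1 then sz + 2 * R - 1 else if x < R then 0
   else if sz + R < x < sz + 2 * R then W (x - (sz + R)) else W x.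
  by rewrite H6 /upd H5 E4 /upd; cases_if; rewrite H2; cases_if.
clear E4 M4 M5 H2 H20 M2.
eapply tri_seq, tri_ccopy; [by rewrite H6|done|move=> M7 H7].
eapply tri_seq, tri_cdecn => M8 H8.
have {H7}H8 : M8 =1 upd M6 7 sz.
  by move=> x; rewrite H8 /upd !H7 /upd /= !H6 /=; cases_if.
eapply tri_seq, tri_ccopy; [by rewrite H8 /upd /= H6|done|move=> M9 H9].
eapply tri_seq, tri_cset; [by rewrite H9 /upd /= H8 /upd /= H6|move=> M10 H10].
have {}H10 x : M10 x = if x == 2 then R else if x == 6 then sz + 2 * R - 1 else if x == 7 then sz else M6 x.
  by rewrite H10 /upd H9 /upd !H8 /upd /= H6 /=; cases_if.
clear H9 M9 H8 M8 M7.
(* The last cell in use: the saved registers 1, ..., R - 1 follow the cell [sz + R]. *)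
have [n Hn] : exists n, n = sz + 2 * R - 1 by eexists.
have nB : n <= 3 * B by lia.
eapply tri_seq, (@tri_le _ _ _ (3 * B * 5 + 1)); last first.
  by apply: (@leq_trans (n * 5 + 1)); [exact: leqnn|lia].
apply: (@tri_while (fun j M' => j <= n /\ M' =1 upd (upd M10 6 j) 2 (R + 2 * (n - j)))).
- by move=> M' [_ ->].
- by move=> j M' [_ ->].
- move=> j M' Hj [Hj' HM]; rewrite -[3]/(1 + (1 + 1)).
  apply/tri_seq/tri_dec; apply/tri_seq/tri_inc; apply: tri_inc.
  split; first lia.
  by move=> x; rewrite /upd /= !HM /upd /=; cases_if.
- split=> // x; rewrite /upd !H10; cases_if.
move=> M11 [_ H11].
eapply tri_seq, tri_ccopy; [by rewrite H11 /upd /= H10 H6|done|move=> M12 H12].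
eapply tri_seq, tri_ccopy; [by rewrite H12 /upd /= H11 /upd /= H10 H6|done|move=> M13 H13].
eapply tri_seq, tri_cdecn => M14 H14.
have {}H14 x : M14 x = if x == 3 then sz + R else if x == 4 then R + 2 * n else if x == 2 then R + 2 * n
   else if x == 1 then n else if x == 0 then 0 else if x == 7 then sz else if x < R then 0 else
   if sz + R < x < sz + 2 * R then W (x - (sz + R)) else W x.
  by rewrite H14 /upd !H13 /upd /= !H12 /upd /= !H11 /upd /= !H10 /= !H6 /=; cases_if.
clear H10 M10 H11 M11 H12 M12 H13 M13 H6 M6.
pose V x := if sz + R < x < sz + 2 * R then W (x - (sz + R)) else W x.
have Vz x : n < x -> V x = 0 by move=> Hx; rewrite /V ifF ?Wz //; lia.
eapply tri_seq, (@tri_le _ _ _ ((sz + R) * (1 + (1 + (1 + (1 + (1 + (1 + (3 + 1))))))).+2 + 1)); last exact: leqnn.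
(* Cell x moves to [R + 2 * x], from the top down to x = R: targets lie above the sources still to
   be read, so nothing unread is destroyed. Registers 1 and 2 point to source and target. *)
pose I3 j (M' : nat -> nat) := [/\ j <= sz + R, [/\ M' 0 = 0, M' 1 = R.-1 + j, M' 2 = R + 2 * (R.-1 + j), M' 3 = j & M' 4 = R + 2 * n /\ M' 7 = sz],
   forall x, R <= x <= R.-1 + j -> M' x = V x,
   forall i, R + j <= i -> M' (R + 2 * i) = V i & forall i, R + j <= i -> M' (R + 2 * i).+1 = 0].
apply: (@tri_while I3).
- by move=> M' [_ [_ _ _ ->]].
- by move=> j M' [_ [_ _ _ ->]].
- move=> j M' Hj [Hj' [F0 F1 F2 F3 [F4 F7]] G1 G2 G3].
  apply/tri_seq/tri_dec; apply/tri_seq/tri_ld; apply/tri_seq/tri_st.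
  apply/tri_seq/tri_inc; apply/tri_seq/tri_czero => [|N1 N1E].
    by rewrite /upd /= F0 F2 F1; cases_if.
  apply/tri_seq/tri_st; apply/tri_seq/tri_cdecn => N2 N2E; apply: tri_dec.
  have Fs : M' (R + j) = V (R + j) by apply: G1; lia.
  set N3 := upd _ _ _.
  have Ri : R.-1 + j.+1 = R + j by lia.
  rewrite Ri in F1 F2.
  have NE x : N3 x = if x == 1 then R.-1 + j else if x == 2 then R + 2 * (R.-1 + j) else if x == 3 then j
     else if x == 5 then 0 else if x == (R + 2 * (R + j)).+1 then 0
     else if x == R + 2 * (R + j) then V (R + j) else M' x.
    rewrite /N3 /upd !N2E /upd /= !N1E /upd /= F1 F2 F3 /= -Fs.
    pose a := R + 2 * (R + j); rewrite -/a.
    have e1 r : r < 9 -> (a == r = false) * (r == a = false) by move=> Hr; split; rewrite /a; lia.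
    have e2 r : r < 9 -> (a.+1 == r = false) * (r == a.+1 = false) by move=> Hr; split; rewrite /a; lia.
    have e3 : (R + j == 3) = false by lia.
    rewrite ?(e3, e1 1 isT, e1 2 isT, e1 5 isT, e2 1 isT, e2 2 isT) /a; clear e1 e2 e3 a.
    by cases_if.
  clearbody N3; split; first lia.
  + by rewrite !NE /=; do ?split; cases_if.
  + by move=> x Hx; rewrite NE; cases_if; apply: G1; lia.
  + move=> i Hi; rewrite NE; case: (eqVneq i (R + j)) => [->|Hne]; cases_if.
    by apply: G2; lia.
  + move=> i Hi; rewrite NE; case: (eqVneq i (R + j)) => [->|Hne]; cases_if.
    by apply: G3; lia.
- split=> //.
  + by rewrite !H14 /=; do ?split; lia.
  + by move=> x Hx; rewrite H14 /V; cases_if.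
  + by move=> i Hi; rewrite Vz ?H14; cases_if; rewrite Wz //; lia.
  + by move=> i Hi; rewrite H14; cases_if; rewrite Wz //; lia.
move=> M15 [_ [F0 F1 F2 F3 [F4 F7]] G1 G2 G3].
rewrite !addn0 in F1 F2 G2 G3; clear H14 M14 G1 I3.
eapply tri_seq, tri_cset; [done|move=> M16 H16].
eapply tri_seq, (@tri_le _ _ _ (R.-1 * (1 + (1 + (1 + (1 + (1 + (1 + (1 + (3 + 2)))))))).+2 + 1)); last exact: leqnn.
(* Second pass: the saved copy of register j was moved along to [R + 2 * (sz + R + j)]; it is now
   brought to its place [R + 2 * j] and erased behind the input. *)
pose I4 j (M' : nat -> nat) := [/\ j < R, [/\ M' 0 = 0, M' 2 = R + 2 * j, M' 3 = j & M' 4 = R + 2 * (sz + R + j) /\ M' 7 = sz],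
   forall i, R <= i -> M' (R + 2 * i) = if sz + R + j < i then 0 else V i,
   forall i, j < i < R -> M' (R + 2 * i) = W i & forall i, j < i -> M' (R + 2 * i).+1 = 0].
apply: (@tri_while I4).
- by move=> M' [_ [_ _ ->]].
- by move=> j M' [_ [_ _ ->]].
- move=> j M' Hj [Hj' [E0 E2 E3 [E4 E7]] K1 K2 K3].
  have Fs : M' (R + 2 * (sz + R + j.+1)) = W j.+1.
    by rewrite K1 ?ifF /V ?ifT; [congr W|..]; lia.
  apply/tri_seq/tri_dec; apply/tri_seq/tri_ld; apply/tri_seq/tri_st.
  apply/tri_seq/tri_czero => [|N1 N1E].
    by rewrite /upd /= E2 E0; cases_if.
  apply/tri_seq/tri_st; apply/tri_seq/tri_inc; apply/tri_seq/tri_st.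
  apply/tri_seq/tri_cdecn => N2 N2E; apply: tri_cdecn => N3 N3E.
  pose a := R + 2 * j.+1; pose s := R + 2 * (sz + R + j.+1).
  have e1 r : r < 9 -> (a == r = false) * (r == a = false) by move=> Hr; split; rewrite /a; lia.
  have e2 r : r < 9 -> (a.+1 == r = false) * (r == a.+1 = false) by move=> Hr; split; rewrite /a; lia.
  have e3 r : r < 9 -> (s == r = false) * (r == s = false) by move=> Hr; split; rewrite /s; lia.
  rewrite -/s in Fs; rewrite -/a in E2; rewrite -/s in E4.
  have NE x : N3 x = if x == 2 then R + 2 * j else if x == 3 then j else if x == 4 then R + 2 * (sz + R + j)
     else if x == 5 then 0 else if x == a.+1 then 0 else if x == s then 0
     else if x == a then W j.+1 else M' x.
    rewrite N3E /upd !N2E /upd /= !N1E /upd /=.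
    do 3 rewrite ?(E2, E3, E4, Fs, e1 2 isT, e1 3 isT, e1 4 isT, e1 5 isT, e2 2 isT, e2 4 isT, e2 5 isT, e3 2 isT, e3 3 isT, e3 4 isT,
      e3 5 isT) /=.
    by clear -E2 E4 R8; cases_if; rewrite /a /s in E2 E4 *; lia.
  clear N3E N2E N1E N1 N2; split; first lia.
  + by rewrite !NE /= /a /s E0; do ?split; cases_if.
  + move=> i Hi; rewrite NE K1 // /a /s; cases_if.
  + move=> i Hi; rewrite NE /a /s.
    by case: (eqVneq i j.+1) => [->|Hne]; cases_if; rewrite K2 //; lia.
  + move=> i Hi; rewrite NE /a /s.
    by case: (eqVneq i j.+1) => [->|Hne]; cases_if; rewrite K3 //; lia.
- split; first lia.
  + rewrite !H16 /upd /= F0 F2 F4; do ?split=> //; lia.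
  + by move=> i Hi; rewrite H16 /upd; cases_if; rewrite G2 // Vz //; lia.
  + by move=> i Hi; lia.
  + by move=> i Hi; rewrite H16 /upd; cases_if; rewrite G3 //; lia.
move=> M17 [_ [E0 E2 E3 [E4 E7]] K1 K2 K3].
eapply tri_seq, tri_ccopy; [done|lia|move=> M18 H18].
eapply tri_czero => [|M19 H19]; first by rewrite H18 /upd ifF //; lia.
have K x : M19 x = if x == R.+1 then 0 else if x == R then sz else M17 x.
  by rewrite H19 /upd H18 /upd E7; cases_if.
split; [split|].
- by rewrite K; cases_if.
- move=> i; rewrite K; case: (ltnP i R) => Hi.
    case: i Hi => [|i] Hi; first by cases_if.
    by cases_if; rewrite K2 //; lia.
  by cases_if; rewrite K1 // /V; cases_if; rewrite ?Wz //; lia.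
- move=> i; rewrite K; case: i => [|i]; first by cases_if.
  by cases_if; rewrite K3.
have -> : (B + 2) ^ 2 = (B + 2) * (B + 2) by rewrite expnS expn1.
have : (R - 2) * ((B + 1) * 3 + 1) <= (B + 2) * (3 * B + 4) by apply: leq_mul; lia.
nia.
Qed.

(** * Simulating the program for d *)

Section Simulation.

(** The instruction is an argument, separate from the program counter, to match the branch that
    [dispatch] selects. *)
Definition exec_instr (i : instr) (c : config) : option config :=
  let M := Defs.mem c in
  match i with
  | Inc i => Some (Config (pc c).+1 (upd M i (M i).+1))
  | Dec i => Some (Config (pc c).+1 (upd M i (M i).-1))
  | Jz i l => Some (Config (if M i == 0 then l else (pc c).+1) M)
  | Jmp l => Some (Config l M)
  | Ld i j => Some (Config (pc c).+1 (upd M i (M (M j))))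
  | St i j => Some (Config (pc c).+1 (upd M (M i) (M j)))
  | Halt => None
  end.

Lemma execS p t c : exec p t.+1 c = if step p (exec p t c) is Some c' then c' else exec p t c.
Proof.
have E t' c' : exec p t'.+1 c' = if step p c' is Some c'' then exec p t' c'' else c' by [].
elim: t c => [|t IH] c //; rewrite E [in RHS]E.
by case Ec: (step p c) => [c'|]; rewrite ?IH // Ec.
Qed.

(** Only [Inc] creates a new value, so the maximum grows by at most one per step. Hence every
    address and value met in the simulation is bounded in terms of the running time. *)
Lemma exec_mem_le p c V t x : (forall x, Defs.mem c x <= V) -> Defs.mem (exec p t c) x <= V + t.
Proof.
move=> HV; elim: t x => [|t IH] x; first by rewrite addn0.
have L : Defs.mem (exec p t c) x <= V + t.+1 by apply: leq_trans (IH x) _; lia.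
rewrite execS /step.
case: (nth Halt p _) => [i|i|i l|l|i j|i j|] //=; rewrite /upd; case: ifP => // _.
- by rewrite addnS ltnS.
- by apply: leq_trans (leq_pred _) _; apply: leq_trans (IH i) _; lia.
- by apply: leq_trans (IH _) _; lia.
- by apply: leq_trans (IH _) _; lia.
Qed.

Variables (R : nat).

Definition simcell (x : nat) : nat := (R + 2 * x).+1.

Definition caddress : cmd :=
  CSeq (cset 6 R.+1) (CWhile 7 (CSeq (CDec 7) (CSeq (CInc 6) (CInc 6)))).

Definition cnext : cmd := CSeq (CInc 3) (CInc 2).

(* Registers: 2 counts the simulated steps, 3 holds the simulated program counter, 4 is nonzero while
   the simulated program runs; cell x of the simulated machine is the real cell simcell x. *)
Definition sim_instr (i : instr) : cmd :=
  match i with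
  | Inc a => CSeq (CInc (simcell a)) cnext
  | Dec a => CSeq (CDec (simcell a)) cnext
  | Jz a l => CSeq (CIf (simcell a) (cset 3 l) (CInc 3)) (CInc 2)
  | Jmp l => CSeq (cset 3 l) (CInc 2)
  | Ld a b => CSeq (ccopy (simcell b) 7) (CSeq caddress (CSeq (CLd (simcell a) 6) cnext))
  | St a b => CSeq (ccopy (simcell a) 7) (CSeq caddress
                (CSeq (ccopy (simcell b) 8) (CSeq (CSt 6 8) cnext)))
  | Halt => czero 4
  end.

(** Register 5 holds a copy of the simulated program counter and is counted down along the program.
    Running off the end acts as [Halt], in accordance with the default value in [step]. *)
Fixpoint dispatch (p : program) : cmd :=
  if p is i :: p' then CIf 5 (sim_instr i) (CSeq (CDec 5) (dispatch p')) else czero 4.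

Definition simulate (p : program) : cmd :=
  CSeq (cset (simcell 0) 1) (CSeq (ccopy (R + 2) (simcell 1)) (CSeq (czero 2) (CSeq (czero 3)
  (CSeq (cset 4 1) (CSeq (CWhile 4 (CSeq (ccopy 3 5) (dispatch p))) (ccopy (simcell 1) 1)))))).

Variable inp : nat -> nat.

Definition simulates (c : config) (s flag : nat) (M : nat -> nat) :=
  [/\ ambient R inp M, M 2 = s, M 3 = pc c, M 4 = flag & forall x, M (simcell x) = Defs.mem c x].

Hypothesis R8 : 8 < R.

Lemma simulates_upd c s f M M' :
  (forall x, x < 5 \/ R <= x -> M' x = M x) -> simulates c s f M -> simulates c s f M'.
Proof.
move=> K [[A0 A] M2 M3 M4 Ms]; split; rewrite ?K; try (by left); try done.
- split; first by rewrite K //; left.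
  by move=> i; rewrite K ?A //; right; lia.
- by move=> x; rewrite K ?Ms //; right; rewrite /simcell; lia.
Qed.

Definition instr_bound (i : instr) (K : nat) : bool :=
  match i with
  | Inc a | Dec a => a <= K
  | Jz a l => (a <= K) && (l <= K)
  | Jmp l => l <= K
  | Ld a b | St a b => (a <= K) && (b <= K)
  | Halt => true
  end.

Lemma simcell_inj x y : simcell x = simcell y -> x = y.
Proof. by rewrite /simcell; lia. Qed.

Lemma tri_caddress M V Q : M 0 = 0 -> M 7 <= V ->
  (forall M', M' =1 upd (upd M 7 0) 6 (simcell (M 7)) -> Q M') ->
  tri caddress M (R.+2 + (V * 5 + 1)) Q.
Proof.
move=> M0 MV HQ; apply/tri_seq/tri_cset => // M1 H1.
apply: (@tri_le _ _ (M 7 * 5 + 1)); last by lia.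
apply: (@tri_while (fun j M' => j <= M 7 /\ M' =1 upd (upd M 7 j) 6 (R + 2 * (M 7 - j)).+1)).
- by move=> M' [_ ->].
- by move=> j M' [_ ->].
- move=> j M' Hj [Hj' HM]; apply: (@tri_le _ _ (1 + (1 + 1))) => //.
  apply/tri_seq/tri_dec; apply/tri_seq/tri_inc; apply: tri_inc.
  split; first lia.
  by move=> x; rewrite /upd /= !HM /upd /=; cases_if.
- by split=> // x; rewrite !H1 /upd; cases_if; congr M; lia.
- move=> M' [_ HM]; apply: HQ => x; rewrite HM /upd /simcell; cases_if.
Qed.

Lemma tri_sim_instr i c s M V K :
  simulates c s 1 M -> (forall x, Defs.mem c x <= V) -> instr_bound i K ->
  tri (sim_instr i) M (20 * (R + K + V))
    (fun M' => if exec_instr i c is Some c' then simulates c' s.+1 1 M' else simulates c s 0 M').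
Proof.
move=> [[A0 A] M2 M3 M4 Ms] HV.
have ne r x : r < 9 -> (r == simcell x) = false by rewrite /simcell; lia.
have ne' r x : r < 9 -> (simcell x == r) = false by rewrite /simcell; lia.
have ne2 y x : (R + 2 * y == simcell x) = false by rewrite /simcell; lia.
have ne3 r x : r < 9 -> (R + 2 * x == r) = false by lia.
have nn x y : (simcell x == simcell y) = (x == y).
  by apply/eqP/eqP => [/simcell_inj//|->].
have nes := (ne2, nn, ne3, ne', ne).
case: i => [a|a|a l|l|a b|a b|] /= HK.
- apply: (@tri_le _ _ (1 + (1 + 1))); last lia.
  apply/tri_seq/tri_inc; apply/tri_seq/tri_inc; apply: tri_inc.
  split; [split|..]; rewrite /upd ?nes //= ?M2 ?M3 //.
  + by move=> i; rewrite !nes ?A.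
  + by move=> x; rewrite !nes //= !Ms.
- apply: (@tri_le _ _ (1 + (1 + 1))); last lia.
  apply/tri_seq/tri_dec; apply/tri_seq/tri_inc; apply: tri_inc.
  split; [split|..]; rewrite /upd ?nes //= ?M2 ?M3 //.
  + by move=> i; rewrite !nes ?A.
  + by move=> x; rewrite !nes //= !Ms.
- apply: (@tri_le _ _ (l.+3 + 1)); last lia.
  apply/tri_seq/tri_if => Ha.
  + apply: tri_cset => // M1 H1; apply: tri_inc.
    split; [split|..]; rewrite /upd ?H1 /upd //= ?M2 ?M3 //.
    * by move=> i; rewrite nes // H1 /upd nes.
    * by rewrite -Ms Ha.
    * by move=> x; rewrite nes // H1 /upd nes // Ms.
  + apply: (@tri_le _ _ 1) => //; apply: tri_inc; apply: tri_inc.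
    split; [split|..]; rewrite /upd //= ?M2 ?M3 //.
    * by move=> i; rewrite !nes ?A.
    * by rewrite -Ms; case: eqP.
    * by move=> x; rewrite !nes.
- apply: (@tri_le _ _ (l.+1 + 1)); last lia.
  apply/tri_seq/tri_cset => // M1 H1; apply: tri_inc.
  split; [split|..]; rewrite /upd ?H1 /upd //= ?M2 ?M3 //.
  + by move=> i; rewrite nes // H1 /upd nes.
  + by move=> x; rewrite nes // H1 /upd nes // Ms.
- apply: (@tri_le _ _ ((2 * simcell b + 1) + ((R.+2 + (V * 5 + 1)) + (1 + (1 + 1))))); last first.
    by rewrite /simcell; lia.
  apply/tri_seq/tri_ccopy => // M1 H1.
  apply/tri_seq/tri_caddress => [||M5 H5]; first by rewrite H1 /upd.
    by rewrite H1 /upd /= Ms.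
  have {}H5 : M5 =1 upd (upd M 7 0) 6 (simcell (Defs.mem c b)).
    by move=> x; rewrite H5 /upd !H1 /upd /= Ms; cases_if.
  apply/tri_seq/tri_ld; apply/tri_seq/tri_inc; apply: tri_inc.
  have E6 : M5 (M5 6) = Defs.mem c (Defs.mem c b) by rewrite !H5 /upd /= !nes // Ms.
  split; [split|..]; rewrite /upd ?nes //= ?E6 ?H5 /upd //= ?M2 ?M3 //.
  + by move=> i; rewrite !nes // H5 /upd !nes.
  + by move=> x; rewrite !nes //= H5 /upd !nes // Ms.
- apply: (@tri_le _ _ ((2 * simcell a + 1) + ((R.+2 + (V * 5 + 1)) + ((2 * simcell b + 1) + (1 + (1 + 1)))))); last first.
    by rewrite /simcell; lia.
  apply/tri_seq/tri_ccopy => // M1 H1.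
  apply/tri_seq/tri_caddress => [||M5 H5]; first by rewrite H1 /upd.
    by rewrite H1 /upd /= Ms.
  have {}H5 : M5 =1 upd (upd M 7 0) 6 (simcell (Defs.mem c a)).
    by move=> x; rewrite H5 /upd !H1 /upd /= Ms; cases_if.
  apply/tri_seq/tri_ccopy => // [|M6 H6]; first by rewrite H5.
  have {}H6 : M6 =1 upd (upd (upd M 7 0) 6 (simcell (Defs.mem c a))) 8 (Defs.mem c b).
    by move=> x; rewrite H6 /upd !H5 /upd /= !nes // Ms.
  apply/tri_seq/tri_st; apply/tri_seq/tri_inc; apply: tri_inc.
  have E6 : M6 6 = simcell (Defs.mem c a) by rewrite H6.
  have E8 : M6 8 = Defs.mem c b by rewrite H6.
  rewrite E6 E8.
  split; [split|..]; rewrite /upd ?nes //= ?H6 /upd //= ?M2 ?M3 //.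
  + by move=> i; rewrite !nes // H6 /upd !nes.
  + by move=> x; rewrite !nes //= H6 /upd !nes // Ms.
- apply: (@tri_le _ _ 1); last lia.
  apply: tri_czero => // M1 H1.
  split; [split|..]; rewrite ?H1 /upd //=.
  + by move=> i; rewrite H1 /upd nes.
  + by move=> x; rewrite H1 /upd nes // Ms.
Qed.

Lemma tri_dispatch p c s M V K :
  simulates c s 1 M -> (forall x, Defs.mem c x <= V) -> all (instr_bound^~ K) p ->
  tri (dispatch p) M (20 * (R + K + V) + 3 * size p)
    (fun M' => if exec_instr (nth Halt p (M 5)) c is Some c' then simulates c' s.+1 1 M'
       else simulates c s 0 M').
Proof.
elim: p M => [|i p IH] M HM HV /= HK.
  rewrite nth_nil; apply: tri_sub (tri_sim_instr HM HV (_ : instr_bound Halt K)) _ _ => //.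
  by lia.
case/andP: HK => HK1 HK2.
apply: (@tri_le _ _ (20 * (R + K + V) + (1 + 3 * size p)).+2); last by lia.
apply: tri_if => H5.
  rewrite H5; apply: tri_sub (tri_sim_instr HM HV HK1) _ _ => //.
  by lia.
rewrite addnCA; apply/tri_seq/tri_dec.
case E5: (M 5) H5 => [//|j] _ /=.
have -> : nth Halt p j = nth Halt p (upd M 5 j 5) by rewrite /upd.
apply: IH => //; apply: simulates_upd HM => x Hx; rewrite /upd ifF //; lia.
Qed.

Lemma tri_simulate p M k T K :
  ambient R inp M -> (forall i, M (simcell i) = 0) -> inp 1 = k ->
  all (instr_bound^~ K) p ->
  (forall t, t < T -> ~~ halted p (exec p t (init [:: k]))) ->
  halted p (exec p T (init [:: k])) ->
  tri (simulate p) M (20 * (R + 20) + T.+1 * (20 * (R + K + k + T + size p + 10)))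
    (fun M' => [/\ ambient R inp M', M' 1 = Defs.mem (exec p T (init [:: k])) 1 & M' 2 = T]).
Proof.
move=> [A0 A] A1 ik HK HT1 HT2.
pose c t := exec p t (init [:: k]).
have HV t x : t <= T -> Defs.mem (c t) x <= k.+1 + T.
  move=> tT; apply: leq_trans (exec_mem_le (V := k.+1) p t x _) _; last lia.
  by case=> [|[|y]] //=; rewrite nth_nil.
have cS t : t < T -> exec_instr (nth Halt p (pc (c t))) (c t) = Some (c t.+1).
  move=> /HT1; rewrite /halted /c execS.
  by rewrite /step /exec_instr; case: (nth Halt p _).
have cT : exec_instr (nth Halt p (pc (c T))) (c T) = None.
  by move: HT2; rewrite /halted /step /exec_instr; case: (nth Halt p _).
have ne r x : r < 9 -> (simcell x == r) = false by rewrite /simcell; lia.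
have ne2 y x : (R + 2 * y == simcell x) = false by rewrite /simcell; lia.
have ne3 r x : r < 9 -> (R + 2 * x == r) = false by lia.
have nn x y : (simcell x == simcell y) = (x == y).
  by apply/eqP/eqP => [/simcell_inj//|->].
have nes := (ne2, nn, ne3, ne).
apply: (@tri_le _ _ (2 + ((2 * (R + 2) + 1) + (1 + (1 + (2 +
  (T.+1 * ((2 * 3 + 1) + (20 * (R + K + (k.+1 + T)) + 3 * size p)).+2 + 1 + (2 * simcell 1 + 1))))))));
  last by rewrite /simcell; nia.
apply/tri_seq/tri_cset => // M1 H1.
have E1 x y : x < 9 -> (x == simcell y) = false by rewrite /simcell; lia.
apply/tri_seq/tri_ccopy => [|//|M2 H2]; first by rewrite H1 /upd E1.
apply/tri_seq/tri_czero => [|M3 H3]; first by rewrite H2 /upd E1 // H1 /upd E1.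
apply/tri_seq/tri_czero => [|M4 H4]; first by rewrite H3 /upd /= H2 /upd E1 // H1 /upd E1.
apply/tri_seq/tri_cset => [|M5 H5].
  by rewrite H4 /upd /= H3 /upd /= H2 /upd E1 // H1 /upd E1.
apply: tri_seq.
have HI : simulates (c 0) 0 1 M5.
  split; [split|..]; rewrite ?H5 /upd /= ?H4 /upd /= ?H3 /upd /= ?H2 /upd ?E1 // ?H1 /upd ?E1 //.
  - by move=> i; rewrite H5 /upd ?nes // H4 /upd ?nes // H3 /upd ?nes // H2 /upd ?nes // H1 /upd ?nes.
  - move=> x; rewrite H5 /upd ?nes // H4 /upd ?nes // H3 /upd ?nes // H2 /upd ?nes //.
    rewrite [M1 (R + 2)]H1 /upd -[R + 2]/(R + 2 * 1) nes A ik.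
    by case: x => [|[|x]] //=; rewrite H1 /upd nes //= A1 nth_nil.
(* There are T + 1 rounds: the last one meets the halting instruction, executes nothing and only
   clears register 4. *)
apply: (@tri_while (fun j M' => if j is j'.+1 then j' <= T /\ simulates (c (T - j')) (T - j') 1 M'
   else simulates (c T) T 0 M')).
- by move=> M' [].
- by move=> j M' [_ [_ _ _ ->]].
- move=> j M' Hj [jT HM].
  have M'0 : M' 0 = 0 by case: HM => -[].
  apply/tri_seq/tri_ccopy => // N HN.
  have HM' : simulates (c (T - j)) (T - j) 1 N.
    by apply: simulates_upd HM => x Hx; rewrite HN /upd ifF //; lia.
  apply: (tri_sub (tri_dispatch HM' (fun x => HV (T - j) x (leq_subr _ _)) HK)) => // M6.
  have -> : N 5 = pc (c (T - j)) by rewrite HN /upd /=; case: HM.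
  case: j jT {Hj HM HM'} => [|j] jT; first by rewrite subn0 cT.
  rewrite cS; last lia.
  have -> : (T - j.+1).+1 = T - j by lia.
  by split=> //; lia.
- by rewrite subnn.
move=> M6 [[B0 B] B2 B3 B4 B5].
apply: tri_ccopy => // M7 H7; split; [split|..]; rewrite ?H7 /upd //=.
- by move=> i; rewrite H7 /upd nes.
Qed.

End Simulation.

(* The environment starts with d(k) and the running time T(k) left by the simulation and grows by one power
   of 2 per stage; the time is polynomial in its largest entry. *)
Definition prep (m : nat) (env : (nat -> nat) -> seq nat -> seq nat) :=
  (forall inp E0, size E0 = 2 -> size (env inp E0) = m) /\
  exists (code : nat -> cmd) (w c : nat), forall R inp E0 B M,
    size E0 = 2 -> 1 + m + w < R -> R <= B -> ambient R inp M -> loads 1 2 E0 M ->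
    bounded_by B inp (env inp E0) ->
    tri (code R) M ((B + 2) ^ c)
      (fun M' => loads 1 m (env inp E0) M' /\ ambient R inp M').

Lemma prep_base : prep 2 (fun _ E0 => E0).
Proof.
split=> //; exists (fun _ => CSkip), 0, 0 => R inp E0 B M sE Rw RB A L BB.
by apply: tri_le (leq0n _); apply: tri_skip.
Qed.

(** The auxiliary cell is [r.+2] because [r.+1] counts the doublings in the loop around this one. *)
Lemma tri_double r M Q : M 0 = 0 -> 0 < r ->
  (forall M', (forall x, x != r -> x != r.+2 -> M' x = M x) -> M' r = 2 * M r -> Q M') ->
  tri (CSeq (ccopy r r.+2) (CWhile r.+2 (CSeq (CDec r.+2) (CInc r)))) M
    ((2 * r + 1) + (M r * 4 + 1)) Q.
Proof.
move=> M0 r0 HQ; apply/tri_seq/tri_ccopy => // M1 H1.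
apply: (@tri_while (fun j M' => j <= M r /\ M' =1 upd (upd M r (2 * M r - j)) r.+2 j)).
- by move=> M' [_ ->]; rewrite /upd eqxx.
- by move=> j M' [_ ->]; rewrite /upd eqxx.
- move=> j M' Hj [Hj' HM]; apply: (@tri_le _ _ (1 + 1)) => //.
  apply/tri_seq/tri_dec; apply: tri_inc; split; first lia.
  by move=> x; rewrite /upd !HM /upd; cases_if.
- by split=> // x; rewrite H1 /upd; cases_if; have -> : x = r by [apply/eqP]; lia.
- move=> M' [_ HM]; apply: HQ => [x n1 n2|]; rewrite HM /upd.
    by cases_if.
  by cases_if.
Qed.

(** A [ptime] function has polynomially bounded values, so 2^v is out of its reach. It is produced
    by v doublings, and their cost is charged to the result: 2^v belongs to the new environment and
    is thus at most [B]. *)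
Lemma prep_stage m env F : prep m env -> ptime m F ->
  prep m.+1 (fun inp E0 => rcons (env inp E0) (2 ^ F inp (env inp E0))).
Proof.
move=> [sz [code [w [c H]]]] /ptimeE[f [wf [cf Hf]]]; split.
  by move=> inp E0 s0; rewrite size_rcons sz.
exists (fun R => CSeq (code R) (CSeq (f R 1 m.+2) (CSeq (cset m.+1 1)
  (CWhile m.+2 (CSeq (CDec m.+2)
     (CSeq (ccopy m.+1 m.+3) (CWhile m.+3 (CSeq (CDec m.+3) (CInc m.+1)))))))))
  , (w + wf + 5), (c + (cf + (2 + 4).+1).+1).+1.
move=> R inp E0 B M s0 Rw RB A L BB.
set E := env inp E0 in BB *; set v := F inp E in BB *.
have sE : size E = m by exact: sz.
have BBE : bounded_by B inp E.
  case: BB => B1 B2; split=> // i; case: (ltnP i m) => Hi; last by rewrite nth_default ?sE.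
  by move: (B2 i); rewrite nth_rcons sE Hi.
have vB : 2 ^ v <= B by case: BB => _ /(_ m); rewrite nth_rcons sE ltnn eqxx.
have vv : v < 2 ^ v by apply: ltn_expl.
apply: tri_le (pb_add (leqnn _) (leqnn _)).
have {}H := H R inp E0 B M s0 ltac:(lia) RB A L BBE.
apply: tri_seq; apply: (tri_sub H) => // M1 [L1 A1].
apply: tri_le (pb_add (leqnn _) (leqnn _)).
have [_ F2] := Hf R 1 m.+2 inp E B M1 isT ltac:(lia) ltac:(lia) RB sE A1 L1 BBE.
apply: tri_seq; apply: (tri_sub F2) => // M2 [E2 K2].
have A2 : ambient R inp M2 by apply: keeps_ambient K2 A1.
have L2 : loads 1 m E M2 by apply: keeps_loads K2 L1; lia.
have X2 : 2 <= (B + 2) ^ 2 by exact: pb_const.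
apply: tri_le (pb_add X2 (leqnn _)).
apply/tri_seq/tri_cset => [|M3 H3]; first by case: A2.
apply: (@tri_le _ _ (v * (1 + ((2 * m.+1 + 1) + (B * 4 + 1))).+2 + 1)); last first.
  by rewrite !expnS expn0; nia.
apply: (@tri_while (fun j M' => [/\ M' m.+2 = j, j <= v, loads 1 m.+1 (rcons E (2 ^ (v - j))) M' & ambient R inp M'])).
- by move=> M' [].
- by move=> j M' [-> _ _ _].
- move=> j M' Hj [I1 I2 I3 I4].
  apply/tri_seq/tri_dec; set N := upd _ _ _.
  have E1 : N m.+1 = 2 ^ (v - j.+1).
    rewrite /N /upd ifF; last lia.
    by have := I3 m (ltnSn m); rewrite add1n => ->; rewrite nth_rcons sE ltnn eqxx.
  have N0 : N 0 = 0 by rewrite /N /upd /=; case: I4.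
  apply: (@tri_le _ _ ((2 * m.+1 + 1) + (N m.+1 * 4 + 1))); last first.
    rewrite leq_add2l leq_add2r leq_mul2r; apply/orP; right; rewrite E1.
    by apply: leq_trans vB; rewrite leq_exp2l //; lia.
  apply: tri_double => // M4 H4 H4'; split.
  + by rewrite H4 ?/N /upd ?eqxx ?I1 //; lia.
  + lia.
  + move=> i Hi; rewrite add1n nth_rcons sE.
    case: (ltnP i m) => Him.
      rewrite H4; [|lia|lia]; rewrite /N /upd ifF; last lia.
      by rewrite -add1n I3 ?nth_rcons ?sE ?Him //; lia.
    have -> : i = m by lia.
    rewrite eqxx H4' E1 -expnS; congr (2 ^ _); lia.
  + case: I4 => I40 I41; split; first by rewrite H4.
    by move=> i; rewrite H4; [rewrite /N /upd ifF ?I41 //; lia|lia|lia].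
- split=> //.
  + by rewrite H3 /upd ifF ?E2 //; lia.
  + rewrite subnn expn0 => i Hi; rewrite add1n H3 /upd nth_rcons sE.
    case: ltnP => Him; first by rewrite ifF; [rewrite -add1n L2|lia].
    by have -> : i = m by [lia]; rewrite !eqxx.
  + case: A2 => A20 A21; split; first by rewrite H3.
    by move=> i; rewrite H3 /upd ifF ?A21 //; lia.
- by move=> M4 [_ _ L4 A4]; rewrite subn0 in L4.
Qed.

(** * Writing the output *)

(* The word to be output, preceded by its length and padded by R cells; then the contents of the
   first R cells again, cell 0 last, to be loaded over the registers at the very end. *)
Definition layout (Out : nat -> nat) (l R j : nat) : nat :=
  let i := if j <= l + R then j else if j < l + 2 * R then j - (l + R) else 0 in
  if i == 0 then l else if i <= l then Out i.-1 else 0.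

Fixpoint cloads (a m : nat) : cmd :=
  if m is m'.+1 then CSeq (CLd a 0) (CSeq (CInc 0) (CSeq (CInc 0) (cloads a.+1 m'))) else CSkip.

Lemma tri_cloads a m M Q :
  0 < a -> a + m <= M 0 ->
  (forall M', M' 0 = M 0 + 2 * m ->
     (forall x, 0 < x -> M' x = if a <= x < a + m then M (M 0 + 2 * (x - a)) else M x) -> Q M') ->
  tri (cloads a m) M (3 * m) Q.
Proof.
elim: m a M => [|m IH] a M a0 Ha HQ /=.
  by apply: tri_skip; apply: HQ; rewrite ?addn0 // => x Hx; rewrite ifF //; lia.
have -> : 3 * m.+1 = 1 + (1 + (1 + 3 * m)) by lia.
apply/tri_seq/tri_ld; apply/tri_seq/tri_inc; apply/tri_seq/tri_inc.
set N := upd _ _ _.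
have NE x : N x = if x == 0 then (M 0).+2 else if x == a then M (M 0) else M x.
  by rewrite /N /upd; cases_if.
apply: IH => //; first by rewrite NE /=; lia.
move=> M2 F1 F2; apply: HQ => [|x Hx]; first by rewrite F1 NE /=; lia.
rewrite F2 // !NE /=; case: (eqVneq x a) => [->|ne]; last first.
  by cases_if; congr M; lia.
by rewrite ltnn /= ifF ?ifT; [congr M|..]; lia.
Qed.

(** The word must end up in the cells 0, 1, ..., where the registers of the copying loop live. The
    loop therefore fills only the cells from R on, upwards, with sources [R + 2 * x + 1] beyond the
    target x. The rest is loaded by straight-line code whose only register is cell 0, itself loaded
    last. *)
Definition epilogue (m R : nat) : cmd :=
  CSeq (CWhile m.+4 (CSeq (CDec m.+4) (CSeq (CLd (m + 7) (m + 6)) (CSeq (CSt (m + 5) (m + 7))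
     (CSeq (CInc (m + 5)) (CSeq (CInc (m + 6)) (CInc (m + 6))))))))
  (CSeq (cincn 0 (m + 6)) (CSeq (CLd 0 0) (CSeq (cloads 1 R.-1) (CLd 0 0)))).

Lemma tri_epilogue m R l Out M : m + 8 < R -> M 0 = 0 ->
  M m.+4 = l.+1 -> M (m + 5) = R -> M (m + 6) = (R + 2 * R).+1 ->
  (forall j, j <= l + 2 * R -> M (R + 2 * j).+1 = layout Out l R j) ->
  tri (epilogue m R) M (l.+1 * 8 + 10 * R)
    (fun M' => output (Config 0 M') = [seq Out i | i <- iota 0 l]).
Proof.
move=> mR M0 M4 M5 M6 ML.
apply: (@tri_le _ _ ((l.+1 * (1 + (1 + (1 + (1 + (1 + 1))))).+2 + 1) + ((m + 6) + (1 + (3 * R.-1 + 1))))); last lia.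
apply: tri_seq.
apply: (@tri_while (fun j M' => [/\ j <= l.+1, [/\ M' 0 = 0, M' m.+4 = j, M' (m + 5) = R + (l.+1 - j) & M' (m + 6) = (R + 2 * (R + (l.+1 - j))).+1],
   forall x, R <= x < R + (l.+1 - j) -> M' x = layout Out l R x &
   forall i, R + (l.+1 - j) <= i <= l + 2 * R -> M' (R + 2 * i).+1 = layout Out l R i])).
- by move=> M' [_ [_ ->]].
- by move=> j M' [_ [_ -> _]].
- move=> j M' Hj [Hj' [E0 E4 E5 E6] I1 I2].
  have I3 := I2 (R + (l.+1 - j.+1)) ltac:(lia).
  set s := R + (l.+1 - j.+1) in E5 E6 I1 I2 I3.
  have sR : R <= s by rewrite /s; lia.
  apply/tri_seq/tri_dec; apply/tri_seq/tri_ld.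
  set N1 := upd _ _ _.
  have N1E x : N1 x = if x == m.+4 then j else if x == m + 7 then layout Out l R s else M' x.
    have e1 : (m + 6 == m.+4) = false by lia.
    have e2 : ((R + 2 * s).+1 == m.+4) = false by lia.
    by rewrite /N1 /upd E4 e1 E6 e2 I3; cases_if.
  clearbody N1; apply/tri_seq/tri_st.
  have -> : N1 (m + 5) = s by rewrite N1E; cases_if.
  have -> : N1 (m + 7) = layout Out l R s by rewrite N1E; cases_if.
  set N2 := upd _ _ _.
  have N2E x : N2 x = if x == m.+4 then j else if x == m + 7 then layout Out l R s
     else if x == s then layout Out l R s else M' x.
    by rewrite /N2 /upd N1E; cases_if.
  clearbody N2; apply/tri_seq/tri_inc; apply/tri_seq/tri_inc; apply: tri_inc.
  set N := upd _ _ _.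
  have NE x : N x = if x == m.+4 then j else if x == m + 5 then s.+1 else if x == m + 6 then (R + 2 * s).+3
     else if x == m + 7 then layout Out l R s else if x == s then layout Out l R s else M' x.
    have E5' : N2 (m + 5) = s by rewrite N2E; cases_if.
    have E6' : N2 (m + 6) = (R + 2 * s).+1 by rewrite N2E; cases_if.
    have e1 : (m + 6 == m + 5) = false by lia.
    by rewrite /N /upd eqxx e1 E5' E6' N2E; cases_if.
  clearbody N; split; first lia.
  + split; rewrite ?NE; first by cases_if.
    * by cases_if.
    * by cases_if; rewrite /s; lia.
    * by cases_if; rewrite /s; lia.
  + move=> x Hx; rewrite NE; case: (eqVneq x s) => [->|ne]; cases_if.
    by apply: I1; rewrite /s in ne *; lia.
  + move=> i Hi; rewrite NE; cases_if; apply: I2; rewrite /s; lia.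
- split; rewrite ?subnn ?addn0 //; first lia.
  by move=> i Hi; apply: ML; lia.
move=> M1 [_ [E0 E4 E5 E6] I1 I2]; rewrite !subn0 in E5 E6 I1 I2.
apply/tri_seq/tri_cincn => M2 H2.
apply/tri_seq/tri_ld.
set N := upd _ _ _.
have NE x : N x = if x == 0 then (R + 2 * (R + l.+1)).+1 else M1 x.
  by rewrite /N /upd !H2 /upd /= E0 add0n; cases_if; rewrite -E6.
apply/tri_seq/tri_cloads => //; first by rewrite NE /=; lia.
move=> M3 H30 H3; apply: tri_ld.
have E3 : M3 (M3 0) = l.
  rewrite H3 H30 NE /=; last lia.
  rewrite ifF; last lia.
  have -> : (R + 2 * (R + l.+1)).+1 + 2 * R.-1 = (R + 2 * (l + 2 * R)).+1 by lia.
  rewrite NE /= I2; last lia.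
  by rewrite /layout ltnn (_ : (l + 2 * R <= l + R) = false) //; lia.
rewrite /output /= (_ : upd M3 0 (M3 (M3 0)) 0 = l); last by rewrite /upd /= E3.
apply/eq_in_map => i; rewrite mem_iota => Hi.
rewrite /upd /= H3 //.
case: ifP => HR.
  rewrite [N 0]NE ?eqxx.
  have -> : (R + 2 * (R + l.+1)).+1 + 2 * (i.+1 - 1) = (R + 2 * (l + R + i.+1)).+1 by lia.
  rewrite NE /= I2; last lia.
  have e1 : (l + R + i.+1 <= l + R) = false by lia.
  have e2 : l + R + i.+1 < l + 2 * R by lia.
  have e3 : l + R + i.+1 - (l + R) = i.+1 by lia.
  by rewrite /layout e1 e2 e3 /= ifT //; lia.
rewrite NE /= I1; last lia.
have e1 : i.+1 <= l + R by lia.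
by rewrite /layout e1 /= ifT //; lia.
Qed.

Ltac lia_or := first [lia | by left; lia | by right; lia].

Lemma ptime_let n F G : ptime n F -> ptime n.+1 G ->
  ptime n (fun inp E => G inp (rcons E (F inp E))).
Proof.
move=> PF PG; have := ptimes_env (ptimes1 PF); rewrite addn1 => PE.
by apply: ptime_ext (ptime_comp PG PE) => inp E _; rewrite cats1.
Qed.

Lemma ptime_layout m Out : ptime m.+1 Out ->
  ptime (m + 3) (fun inp E => layout (fun i => Out inp (rcons (take m E) i))
     (nth 0 E m) (nth 0 E m.+1) (nth 0 E m.+2)).
Proof.
move=> PO.
have P i : i < m + 3 -> ptime (m + 3) (fun _ E => nth 0 E i) by apply: ptime_proj.
have Pl := P m ltac:(lia); have PR := P m.+1 ltac:(lia); have Pj := P m.+2 ltac:(lia).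
have Pi := ptime_ifb (ptime_leq Pj (ptime_addn Pl PR)) Pj
   (ptime_ifb (ptime_ltn Pj (ptime_addn Pl (ptime_muln (ptime_const _ 2) PR)))
      (ptime_subn Pj (ptime_addn Pl PR)) (ptime_const _ 0)).
have PS := @ptimes_map (m + 3).+1 (rcons (iota 0 m) (m + 3)).
rewrite size_rcons size_iota in PS.
have {PS}PO' := ptime_comp PO (PS _).
have := ptime_ifb (ptime_eqn Pi (ptime_const _ 0)) Pl (ptime_ifb (ptime_leq Pi Pl)
  (ptime_let (ptime_pred Pi) (PO' _)) (ptime_const _ 0)).
move=> H; apply: (ptime_ext _ (H _)).
  move=> inp E sE; rewrite /layout; case: ifP => // _; case: ifP => // _.
  congr (Out inp _); rewrite map_rcons nth_rcons sE ltnn eqxx; congr rcons.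
  apply: (@eq_from_nth _ 0); first by rewrite size_map size_iota size_take sE; case: ltnP => //; lia.
  move=> i; rewrite size_map size_iota => Hi.
  by rewrite (nth_map 0) ?size_iota // nth_iota // nth_take // nth_rcons sE ifT //; lia.
by move=> i; rewrite mem_rcons inE mem_iota; lia.
Qed.

(** [B] is any bound on input, environment, simulated time and output length, not a function of the
    word. The theorem thus serves twice: for the reduction and for the computability of f. *)
Theorem pipeline (p : program) (val T : nat -> nat) m env Len Out :
  (forall k, runs_within p [:: k] (T k) [:: val k]) ->
  (forall k t, t < T k -> ~~ halted p (exec p t (init [:: k]))) ->
  prep m env -> ptime m Len -> ptime m.+1 Out ->
  exists (P : program) (c : nat), forall w B,
    let inp := init_mem w in
    let E := env inp [:: val (inp 1); T (inp 1)] in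
    bounded_by B inp E -> T (inp 1) <= B -> Len inp E <= B ->
    exists2 t, t <= (B + 2) ^ c &
      runs_within P w t [seq Out inp (rcons E i) | i <- iota 0 (Len inp E)].
Proof.
move=> Hrun Hmin [senv [pcode [wp [cp Hp]]]] /ptimeE[lcode [wl [cl Hl]]] PO.
have /ptimeE[ocode [wo [co Ho]]] := ptime_layout PO.
have [K HK] : exists K, all (instr_bound^~ K) p.
  elim: p {Hrun Hmin} => [|i q [K HK]]; first by exists 0.
  pose a := match i with Inc x | Dec x => x | Jz x y | Ld x y | St x y => x + y | Jmp x => x | Halt => 0 end.
  exists (a + K) => /=; apply/andP; split; first by rewrite /a; case: i {a} => //= *; lia.
  apply: sub_all HK => j; case: j => //= *; try lia.
pose R := m + 9 + wp + wl + wo.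
(* Cells 1 to m hold the environment, m + 1 the length, m + 2 the constant R, m + 3 the index, m + 4
   the remaining rounds, m + 5 the address of the odd cell to write, and m + 6 the computed
   value. *)
pose body := CSeq (CDec m.+4) (CSeq (ocode R 1 (m + 6)) (CSeq (CSt (m + 5) (m + 6))
   (CSeq (CInc m.+3) (CSeq (CInc (m + 5)) (CInc (m + 5)))))).
pose code := CSeq (prologue R) (CSeq (simulate R p) (CSeq (pcode R) (CSeq (lcode R 1 m.+1)
  (CSeq (cset m.+2 R) (CSeq (czero m.+3) (CSeq (ccopy m.+1 m.+4) (CSeq (cincn m.+4 (2 * R + 1))
  (CSeq (cset (m + 5) R.+1) (CSeq (CWhile m.+4 body)
  (CSeq (cset (m + 5) R) (CSeq (cset (m + 6) (R + 2 * R).+1) (CSeq (ccopy m.+1 m.+4)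
  (CSeq (CInc m.+4) (epilogue m R)))))))))))))).
exists (assemble 0 code).
(* The bound may be assumed to exceed [R + K + size p]: this number does not depend on the input,
   and adding it to B only changes the exponent. *)
suff [c Hc] : exists c, forall w B,
    let inp := init_mem w in
    let E := env inp [:: val (inp 1); T (inp 1)] in
    R + K + size p <= B -> bounded_by B inp E -> T (inp 1) <= B -> Len inp E <= B ->
    tri code (init_mem w) ((B + 2) ^ c) (fun M => output (Config 0 M)
       = [seq Out inp (rcons E i) | i <- iota 0 (Len inp E)]).
  exists (((1 + (R + K + size p)).+1 + 2).+1 * c) => w B inp E [B1 B2] BT BL.
  have X : B + (R + K + size p) <= (B + 2) ^ (1 + (R + K + size p)).+1.
    by apply: pb_add; [exact: pb_id|exact: pb_const].
  have BB' : bounded_by (B + (R + K + size p)) inp E.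
    by split=> i; [apply: leq_trans (B1 i) _|apply: leq_trans (B2 i) _]; lia.
  have H := Hc w (B + (R + K + size p)) (leq_addl _ _) BB'
     (leq_trans BT (leq_addr _ _)) (leq_trans BL (leq_addr _ _)).
  have [t [M [Ht EM rM]]] := tri_runs H.
  exists t; first exact: leq_trans Ht (pb_comp _ X).
  by rewrite -EM.
eexists => w B inp E HB BB BT BL.
have RB : R <= B by lia.
have BE : bounded_by B inp E by [].
have szE : size E = m by apply: senv.
set k := inp 1 in E BT BB BL szE BE *.
set l := Len inp E in BL *.
have R8 : 8 < R by rewrite /R; lia.
have [B1 B2] := BB.
have [hT oT] := Hrun k.
have v1 : Defs.mem (exec p (T k) (init [:: k])) 1 = val k.
  by move: oT; rewrite /output; case: (Defs.mem _ 0) => [|[|n]] //= [].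
have X1 : 1 <= (B + 2) ^ 1 by rewrite expn1; lia.
have XB x : x <= B -> x <= (B + 2) ^ 1 by exact: pb_id.
have XC x : x <= 20 * (B + 2) -> x <= (B + 2) ^ 6.
  move=> /leq_trans; apply; rewrite expnSr leq_mul2r; apply/orP; right.
  by apply: (@leq_trans (2 ^ 5)) => //; rewrite leq_exp2r //; lia.
have Z q x y : x <= q * (y * (B + 2)) -> y <= B + 2 -> x <= (B + 2) ^ (q + (1 + 1)).
  move=> Hx Hy; apply: leq_trans Hx _; apply: pb_mul; first exact: pb_const.
  by apply: pb_mul; rewrite expn1.
have Y1 := Z 400 (400 * (B + 2) ^ 2) (B + 2) ltac:(by rewrite expnS expn1) (leqnn _).
apply: tri_le (pb_add Y1 (leqnn _)).
apply: tri_seq; apply: (tri_sub (tri_prologue R8 RB B1)) => // M1 [A1 Z1].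
have Y2 := Z 1000 (20 * (R + 20) + (T k).+1 * (20 * (R + K + k + T k + size p + 10))) (B + 2)
  ltac:(move: (B1 1) HB BT; rewrite -/k; clear; nia) (leqnn _).
apply: tri_le (pb_add Y2 (leqnn _)); clear Y1 Y2 Z.
apply: tri_seq; apply: (tri_sub (tri_simulate (p := p) (T := T k) R8 A1 Z1 (erefl k) HK (fun t => @Hmin k t) hT)) => //.
move=> M2 [A2 E21 E22].
have L2 : loads 1 2 [:: val k; T k] M2 by case=> [|[|i]] //= _; rewrite ?E21 ?E22.
apply: tri_le (pb_add (leqnn ((B + 2) ^ cp)) (leqnn _)).
apply: tri_seq; apply: (tri_sub (Hp R inp [:: val k; T k] B M2 erefl ltac:(rewrite /R; lia) RB A2 L2 BE)) => // M3 [L3 A3].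
apply: tri_le (pb_add (leqnn ((B + 2) ^ cl)) (leqnn _)).
have [_ F4] := Hl R 1 m.+1 inp E B M3 isT ltac:(lia) ltac:(rewrite /R; lia) RB szE A3 L3 BE.
apply: tri_seq; apply: (tri_sub F4) => // M4 [E4 K4].
have A4 : ambient R inp M4 by apply: keeps_ambient K4 A3.
have L4 : loads 1 m E M4 by apply: keeps_loads K4 L3; lia.
have A40 : M4 0 = 0 by case: A4.
apply: tri_le (pb_add (XC R.+1 _) (leqnn _)); last lia.
apply/tri_seq/tri_cset => // M5 H5.
apply: tri_le (pb_add X1 (leqnn _)).
apply/tri_seq/tri_czero => [|M6 H6]; first by rewrite H5.
apply: tri_le (pb_add (XC (2 * m.+1 + 1) _) (leqnn _)); last by rewrite /R in RB; lia.
apply/tri_seq/tri_ccopy => // [|M7 H7]; first by rewrite H6 /upd /= H5.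
apply: tri_le (pb_add (XC (2 * R + 1) _) (leqnn _)); last lia.
apply/tri_seq/tri_cincn => M8 H8.
apply: tri_le (pb_add (XC R.+2 _) (leqnn _)); last lia.
apply/tri_seq/tri_cset => [|M9 H9].
  by rewrite H8 /upd /= H7 /upd /= H6 /upd /= H5.
pose n := l + 2 * R + 1.
have {H5 H6 H7 H8}H9 x : M9 x = if x == m.+2 then R else if x == m.+3 then 0 else if x == m.+4 then n
   else if x == m + 5 then R.+1 else M4 x.
  rewrite H9 /upd !H8 /upd !H7 /upd !H6 /upd !H5 /upd E4 /n.
  by cases_if; have e : x = m.+1 by [lia]; rewrite e E4 in H0 *; lia.
clear K4 L3 A3 A40.
pose lay i := layout (fun i => Out inp (rcons E i)) l R i.
pose B' := 10 * B + 10.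
have HB' : B' <= (B + 2) ^ 6 by apply: XC; rewrite /B'; lia.
have nB : n <= 3 * B + 1 by rewrite /n; lia.
have layE j : layout (fun i => Out inp (rcons (take m (E ++ [:: l; R; j])) i))
      (nth 0 (E ++ [:: l; R; j]) m) (nth 0 (E ++ [:: l; R; j]) m.+1) (nth 0 (E ++ [:: l; R; j]) m.+2) = lay j.
  rewrite take_cat szE ltnn subnn take0 cats0 !nth_cat szE ltnn subnn.
  by rewrite !ifF ?subSnn; [have -> : m.+2 - m = 2 by [lia]|lia|lia].
pose cost := (B + 2) ^ ((6 + 2).+1 * co).
apply: tri_le (pb_add (_ : n * (1 + (cost + (1 + (1 + (1 + 1))))).+2 + 1 <= (B + 2) ^ (2 + ((6 + 2).+1 * co + 8).+1 + 1).+1) (leqnn _)); last first.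
  apply: pb_add; last by [].
  apply: pb_mul; first by rewrite !expnS expn0; nia.
  apply: leq_trans (pb_add (leqnn cost) (pb_const B 8)); lia.
apply: tri_seq.
apply: (@tri_while (fun j M' => [/\ j <= n, ambient R inp M', loads 1 (m + 3) (E ++ [:: l; R; n - j]) M',
   M' m.+4 = j /\ M' (m + 5) = (R + 2 * (n - j)).+1 & forall i, i < n - j -> M' (R + 2 * i).+1 = lay i])).
- by move=> M' [_ _ _ []].
- by move=> j M' [_ _ _ [-> _] _].
- move=> j M' Hj [Hj' [A0 A] I1 [I2 I3] I4].
  apply/tri_seq/tri_dec; set N := upd _ _ _.
  have NE x : N x = if x == m.+4 then j else M' x by rewrite /N /upd I2.
  clearbody N.
  have AN : ambient R inp N by split=> [|i]; rewrite NE; cases_if.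
  have LN : loads 1 (m + 3) (E ++ [:: l; R; n - j.+1]) N.
    by move=> i Hi; rewrite NE ifF ?I1 //; lia.
  have BN : bounded_by B' inp (E ++ [:: l; R; n - j.+1]).
    split=> i; first by apply: leq_trans (B1 i) _; rewrite /B'; lia.
    rewrite nth_cat; case: ifP => _; first by apply: leq_trans (B2 i) _; rewrite /B'; lia.
    by case: (i - size E) => [|[|[|y]]]; rewrite /= ?nth_nil /B'; lia.
  have [_ FN] := Ho R 1 (m + 6) inp (E ++ [:: l; R; n - j.+1]) B' N isT ltac:(lia) ltac:(rewrite /R; lia)
     ltac:(rewrite /B'; lia) ltac:(by rewrite size_cat szE) AN LN BN.
  rewrite layE in FN.
  apply: tri_seq; apply: (tri_sub FN); first exact: pb_comp.
  move=> N1 [E1 K1].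
  apply/tri_seq/tri_st; rewrite E1.
  have -> : N1 (m + 5) = (R + 2 * (n - j.+1)).+1.
    by rewrite K1 ?NE ?ifF ?I3 //; lia.
  set N2 := upd _ _ _; apply/tri_seq/tri_inc; apply/tri_seq/tri_inc; apply: tri_inc.
  have N2E x : N2 x = if x == (R + 2 * (n - j.+1)).+1 then lay (n - j.+1) else N1 x by [].
  set N3 := upd _ _ _.
  have Hm : m + 6 < R by rewrite /R; lia.
  have K1' x : x < m + 6 \/ R <= x -> x != (R + 2 * (n - j.+1)).+1 -> x != m.+3 -> x != m + 5 -> x != m.+4 -> N3 x = M' x.
    move=> H1 H2 H3 H4 H5; rewrite /N3 /upd (negbTE H4) (negbTE H3) N2E (negbTE H2) K1 //.
    by rewrite NE (negbTE H5).
  have E3 : N3 m.+3 = n - j.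
    rewrite /N3 /upd (_ : (m.+3 == m + 5) = false); last lia.
    rewrite eqxx N2E ifF; last lia.
    rewrite K1; last by left; lia.
    rewrite NE ifF; last lia.
    have := I1 m.+2 ltac:(lia); rewrite add1n => ->; rewrite nth_cat szE ifF; last lia.
    by have -> : m.+2 - m = 2 by [lia]; rewrite /=; lia.
  have E4' : N3 m.+4 = j.
    rewrite /N3 /upd !ifF; [|lia|lia|lia].
    rewrite N2E ifF; last lia.
    by rewrite K1 ?NE ?eqxx //; left; lia.
  have E5' : N3 (m + 5) = (R + 2 * (n - j)).+1.
    rewrite /N3 /upd eqxx (_ : (m + 5 == m.+3) = false); last lia.
    rewrite N2E ifF; last lia.
    by rewrite K1 ?NE ?ifF ?I3 //; lia.
  have E6' : N3 (R + 2 * (n - j.+1)).+1 = lay (n - j.+1).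
    rewrite /N3 /upd !ifF; [|lia|lia|lia].
    by rewrite N2E eqxx.
  clearbody N3; split.
  + lia.
  + split; first by rewrite K1' //; lia_or.
    by move=> i; rewrite K1' ?A //; lia_or.
  + move=> i Hi; rewrite nth_cat szE; case: (ltnP i m) => Him.
      by rewrite K1' ?I1 ?nth_cat ?szE ?Him //; lia_or.
    case: (eqVneq i m) => [->|n1].
      by rewrite K1' ?I1 ?nth_cat ?szE ?ltnn ?subnn //; lia_or.
    case: (eqVneq i m.+1) => [->|n2].
      by rewrite K1' ?I1 ?nth_cat ?szE ?ltnNge ?leqnSn ?subSnn //; lia_or.
    have -> : i = m.+2 by lia.
    by rewrite add1n E3 (_ : m.+2 - m = 2) //; lia.
  + by [].
  + move=> i Hi; case: (eqVneq i (n - j.+1)) => [->|ne] //.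
    by rewrite K1' ?I4 //; lia_or.
- split=> //.
  + by case: A4 => A40 A41; split=> [|i]; rewrite H9; cases_if; rewrite A41.
  + move=> i Hi; rewrite H9 subnn nth_cat szE; case: (ltnP i m) => Him.
      by rewrite !ifF ?L4 //; lia.
    case: (eqVneq i m) => [->|n1]; first by rewrite !ifF ?subnn ?add1n ?E4 //; lia.
    case: (eqVneq i m.+1) => [->|n2]; first by rewrite add1n eqxx subSnn.
    have -> : i = m.+2 by lia.
    have -> : m.+2 - m = 2 by lia.
    by rewrite add1n ifF ?eqxx //; lia.
  + by rewrite !H9 subnn; split; cases_if.
  + by rewrite subnn.
move=> M10 [_ [A100 A10] I1 [I2 I3] I4]; rewrite subn0 in I1 I3 I4.
apply: tri_le (pb_add (XC R.+1 _) (leqnn _)); last lia.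
apply/tri_seq/tri_cset => // M11 H11.
apply: tri_le (pb_add (XC (R + 2 * R).+2 _) (leqnn _)); last lia.
apply/tri_seq/tri_cset => [|M12 H12]; first by rewrite H11 /upd; cases_if.
apply: tri_le (pb_add (XC (2 * m.+1 + 1) _) (leqnn _)); last by rewrite /R in RB; lia.
apply/tri_seq/tri_ccopy => // [|M13 H13].
  by rewrite H12 /upd H11 /upd; cases_if.
apply: tri_le (pb_add X1 (leqnn _)).
apply/tri_seq/tri_inc; set N := upd _ _ _.
have I1l : M10 m.+1 = l.
  by have := I1 m ltac:(lia); rewrite add1n nth_cat szE ltnn subnn.
have NE x : N x = if x == m.+4 then l.+1 else if x == m + 6 then (R + 2 * R).+1
   else if x == m + 5 then R else M10 x.
  have e1 : (m.+1 == m + 6) = false by lia.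
  have e2 : (m.+1 == m + 5) = false by lia.
  by rewrite /N /upd !H13 /upd eqxx !H12 /upd e1 !H11 /upd e2 I1l; cases_if.
clearbody N.
apply: (tri_le (tri_epilogue (R := R) (m := m) (l := l) (Out := fun i => Out inp (rcons E i)) (M := N) _ _ _ _ _ _)).
- by rewrite /R; lia.
- by rewrite NE; cases_if.
- by rewrite NE; cases_if.
- by rewrite NE; cases_if.
- by rewrite NE; cases_if.
- have Hm : m + 6 < R by rewrite /R; lia.
  by move=> j Hj; rewrite NE !ifF ?I4 // /n; lia.
- by apply: XC; lia.
Qed.

(** * A Bezout bound for products of linear forms *)

Section Bezout.
Import GRing.Theory.
Local Open Scope ring_scope.
Variables (K : fieldType) (t D N : nat) (l : 'I_t -> nat -> 'cV[K]_t) (c : 'I_t -> K)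
  (z : 'I_N -> 'rV[K]_t).

Let lin (v : 'cV[K]_t) (a : 'I_N) : K := (z a *m v) 0 0.

Hypothesis D0 : (0 < D)%N.
Hypothesis zinj : injective z.
Hypothesis gen_pos : forall s : 'I_t -> 'I_D, (\matrix_(i, j) l j (s j) i 0) \in unitmx.
Hypothesis zc : forall a i, \prod_(j < D) lin (l i j) a = c i.

(** These replace the monomials: exponent e i stands for the product of the first e i forms of the
    i-th equation. At exponent D the whole product is the constant [c i], so W, spanned by those
    with all exponents below D, has dimension at most D^t. *)
Let u (e : 'I_t -> nat) (a : 'I_N) : K := \prod_i \prod_(j < e i) lin (l i j) a.
Let fe (s : 'I_#|{ffun 'I_t -> 'I_D}|) : {ffun 'I_t -> 'I_D} := enum_val s.
Let U : 'M[K]_(#|{ffun 'I_t -> 'I_D}|, N) := \matrix_(s, a) u (fun i => fe s i) a.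
Let inW (f : 'I_N -> K) := (\row_a f a <= U)%MS.

Let inW_ext f g : f =1 g -> inW f -> inW g.
Proof.
by move=> fg; rewrite /inW (_ : \row_a f a = \row_a g a) //; apply/rowP => a; rewrite !mxE fg.
Qed.

Let inW_sum (I : finType) (f : I -> 'I_N -> K) :
  (forall i, inW (f i)) -> inW (fun a => \sum_i f i a).
Proof.
move=> H; rewrite /inW; have -> : \row_a (\sum_i f i a) = \sum_i \row_a f i a; last by apply: summx_sub => i _; exact: H.
by apply/rowP => a; rewrite summxE mxE; apply: eq_bigr => i _; rewrite mxE.
Qed.

Let inW_scale k f : inW f -> inW (fun a => k * f a).
Proof.
move=> H; rewrite /inW (_ : \row_a _ = k *: \row_a f a); first exact: scalemx_sub.
by apply/rowP => a; rewrite !mxE.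
Qed.

Let upd1 (e : 'I_t -> nat) (i : 'I_t) (v : nat) (j : 'I_t) := if j == i then v else e j.

Let u_step e i a : u (upd1 e i (e i).+1) a = lin (l i (e i)) a * u e a.
Proof.
rewrite /u (bigD1 i) //= [in RHS](bigD1 i) //= mulrA; congr (_ * _).
  by rewrite /upd1 eqxx big_ord_recr /= mulrC.
by apply: eq_bigr => j /negbTE ji; rewrite /upd1 ji.
Qed.

Let u_wrap e i a : e i = D -> u e a = c i * u (upd1 e i 0%N) a.
Proof.
move=> ei; rewrite /u (bigD1 i) //= [in RHS](bigD1 i) //=.
rewrite [in RHS]/upd1 eqxx big_ord0 mul1r ei zc; congr (_ * _).
by apply: eq_bigr => j /negbTE ji; rewrite /upd1 ji.
Qed.

(** The forms that would come next in each of the t products are a basis by [gen_pos], so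
    multiplying by any form becomes a combination of raisings of single exponents. *)
Let lin_gen (e : 'I_t -> nat) (v : 'cV[K]_t) : (forall i, e i < D)%N ->
  exists g : 'I_t -> K, forall a, lin v a = \sum_i g i * lin (l i (e i)) a.
Proof.
move=> He; pose s i := Ordinal (He i).
have HM := gen_pos s; set M := \matrix_(i, j) _ in HM.
exists (fun i => (invmx M *m v) i 0) => b.
have {1}-> : v = M *m (invmx M *m v) by rewrite mulmxA mulmxV // mul1mx.
rewrite /lin mulmxA mxE; apply: eq_bigr => i _; rewrite mulrC; congr (_ * _).
by rewrite !mxE; apply: eq_bigr => j _; rewrite !mxE.
Qed.

Let sum_upd1 e i v : (\sum_j upd1 e i v j + e i = \sum_j e j + v)%N.
Proof.
rewrite (bigD1 i) //= [in RHS](bigD1 i) //= /upd1 eqxx.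
rewrite (eq_bigr e) => [|j /negbTE ->] //; lia.
Qed.

(* The filtration argument: multiplying u e by a linear form either raises one exponent or, at
   exponent D, lowers the total degree through the equation prod_j l i j = c i. *)
Let span_monomials T m (s : seq 'cV[K]_t) (e : 'I_t -> nat) :
  (\sum_i e i + m = T)%N -> size s = m -> (forall i, e i <= D)%N ->
  inW (fun a => u e a * \prod_(v <- s) lin v a).
Proof.
elim/ltn_ind: T m s e => T IHT; elim=> [|m IHm] s e HT Hs He.
all: case: (pickP (fun i => e i == D)) => [i /eqP ei|He'].
- have := sum_upd1 e i 0; rewrite ei addn0 => HS.
  apply: (@inW_ext (fun a => c i * (u (upd1 e i 0%N) a * \prod_(v <- s) lin v a))).
    by move=> a; rewrite mulrA -u_wrap.
  apply: inW_scale; apply: (IHT (T - D)%N _ 0%N) => //; [lia|lia|].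
  by move=> j; rewrite /upd1; case: eqP.
- have He1 i : (e i < D)%N by rewrite ltn_neqAle He He'.
  pose f : {ffun 'I_t -> 'I_D} := [ffun i => Ordinal (He1 i)].
  rewrite (size0nil Hs); apply: (inW_ext (f := U (enum_rank f))).
    move=> a; rewrite big_nil mulr1 mxE /fe enum_rankK /u.
    by apply: eq_bigr => i _; rewrite ffunE.
  by rewrite /inW (_ : \row_a _ = row (enum_rank f) U) ?row_sub //; apply/rowP => a; rewrite !mxE.
- have := sum_upd1 e i 0; rewrite ei addn0 => HS.
  apply: (@inW_ext (fun a => c i * (u (upd1 e i 0%N) a * \prod_(v <- s) lin v a))).
    by move=> a; rewrite mulrA -u_wrap.
  apply: inW_scale; apply: (IHT (T - D)%N _ m.+1) => //; [lia|lia|].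
  by move=> j; rewrite /upd1; case: eqP.
- have He1 i : (e i < D)%N by rewrite ltn_neqAle He He'.
  case: s Hs => // v s [Hs].
  have [g Hg] := lin_gen v He1.
  apply: (@inW_ext (fun a => \sum_i g i * (u (upd1 e i (e i).+1) a * \prod_(v <- s) lin v a))).
    move=> a; rewrite big_cons (Hg a) mulrA [u e a * _]mulrC !mulr_suml.
    by apply: eq_bigr => i _; rewrite u_step !mulrA.
  apply: inW_sum => i; apply: inW_scale; apply: IHm => //.
    by have := sum_upd1 e i (e i).+1; lia.
  by move=> j; rewrite /upd1; case: eqP => // _; exact: He1.
Qed.

Let inW1 : inW (fun=> 1).
Proof.
apply: (inW_ext _ (@span_monomials 0 0 [::] (fun=> 0%N) _ _ _)) => // [a|].
  by rewrite big_nil mulr1 /u big1 // => i _; rewrite big_ord0.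
by rewrite big1.
Qed.

Let inW_lin v f : inW f -> inW (fun a => lin v a * f a).
Proof.
rewrite {1}/inW => /submxP[B HB].
apply: (@inW_ext (fun a => \sum_s B 0 s * (u (fun i => fe s i) a * \prod_(w <- [:: v]) lin w a))).
  move=> a; rewrite (_ : f a = \sum_s B 0 s * U s a).
    by rewrite mulr_sumr; apply: eq_bigr => s _; rewrite big_seq1 mxE mulrCA -mulrC -mulrA mulrCA [lin v a * _]mulrC.
  by have /rowP/(_ a) := HB; rewrite !mxE.
apply: inW_sum => s; apply: inW_scale.
by apply: span_monomials => // i; apply: ltnW.
Qed.

Let inW_add f g : inW f -> inW g -> inW (fun a => f a + g a).
Proof.
move=> H1 H2; rewrite /inW (_ : \row_a _ = \row_a f a + \row_a g a); first exact: addmx_sub.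
by apply/rowP => a; rewrite !mxE.
Qed.

(** W contains 1 and is closed under multiplication by linear forms, hence contains every product of
    the affine functions which vanish at one point of s and are 1 at [a0]. A coordinate in which the
    two points differ provides each factor. *)
Let inW_indicator a0 (s : seq 'I_N) : a0 \notin s ->
  exists f, [/\ inW f, f a0 = 1 & forall a, a \in s -> f a = 0].
Proof.
elim: s => [|a s IH]; first by exists (fun=> 1).
rewrite inE negb_or => /andP[na /IH[f [Wf f1 f0]]].
have [j Hj] : exists j, z a0 0 j != z a 0 j.
  apply/existsP; apply: contra_neqT na => /existsPn H; apply: zinj.
  by apply/rowP => j; apply/eqP; have := H j; rewrite negbK.
have E b : lin (delta_mx j 0) b = z b 0 j.
  rewrite /lin mxE (bigD1 j) //= mxE !eqxx mulr1 big1 ?addr0 // => i /negbTE ij.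
  by rewrite mxE ij mulr0.
pose d := z a0 0 j - z a 0 j.
have d0 : d != 0 by rewrite subr_eq0.
exists (fun b => d^-1 * (lin (delta_mx j 0) b * f b + - z a 0 j * f b)); split.
- by apply: inW_scale; apply: inW_add; [exact: inW_lin|exact: inW_scale].
- by rewrite E f1 !mulr1 -/d mulVf.
- move=> b; rewrite inE E => /orP[/eqP ->|/f0 ->]; last by rewrite !mulr0 addr0 mulr0.
  by rewrite -mulrDl subrr mul0r mulr0.
Qed.

(** All indicators of single solutions lie in W, so W is the full space of functions on the N
    solutions, while it has D^t generators. *)
Lemma bezout_product_forms : (N <= D ^ t)%N.
Proof.
have -> : (D ^ t = #|{ffun 'I_t -> 'I_D}|)%N by rewrite card_ffun !card_ord.
have : (1%:M <= U)%MS.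
  apply/row_subP => a0.
  have [f [Wf f1 f0]] := @inW_indicator a0 (rem a0 (enum 'I_N)) ltac:(by rewrite mem_rem_uniqF ?enum_uniq).
  rewrite (_ : row a0 1%:M = \row_a f a) //; apply/rowP => a; rewrite !mxE.
  case: (eqVneq a0 a) => [<-|ne]; first by rewrite f1.
  by rewrite f0 // mem_rem_uniq ?enum_uniq // !inE eq_sym ne mem_enum.
by move/mxrankS; rewrite mxrank1 => /leq_trans; apply; exact: rank_leq_row.
Qed.

End Bezout.

Import GRing.Theory.

(** * Coded finite fields *)

Section Digits.
Variable p : nat.
Hypothesis p0 : 0 < p.

Lemma digits_lt D f : \sum_(0 <= l < D) (f l %% p) * p ^ l < p ^ D.
Proof.
elim: D => [|D IH]; first by rewrite big_geq.
rewrite big_nat_recr //= expnS; have := ltn_pmod (f D) p0.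
move: IH; set S := \sum_(_ <= _ < _) _; set q := p ^ D; set r := _ %% _; nia.
Qed.

Lemma digits_nth D f j : j < D ->
  (\sum_(0 <= l < D) (f l %% p) * p ^ l) %/ p ^ j %% p = f j %% p.
Proof.
elim: D => // D IH; rewrite ltnS leq_eqVlt big_nat_recr //= => /orP[/eqP ->|jD].
  rewrite addnC divnMDl ?expn_gt0 ?p0 // divn_small ?digits_lt // addn0.
  by rewrite modn_mod.
have -> : p ^ D = p ^ (D - j).-1 * p * p ^ j.
  by rewrite -expnSr -expnD; congr (_ ^ _); lia.
by rewrite mulnA addnC divnMDl ?expn_gt0 ?p0 // mulnA modnMDl IH.
Qed.

Lemma digits_ext D u v : u < p ^ D -> v < p ^ D ->
  (forall l, l < D -> u %/ p ^ l %% p = v %/ p ^ l %% p) -> u = v.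
Proof.
elim: D u v => [|D IH] u v; first by rewrite expn0; lia.
move=> Hu Hv H; rewrite (divn_eq u p) (divn_eq v p).
have := H 0 isT; rewrite expn0 !divn1 => ->; congr (_ * _ + _).
apply: IH; rewrite ?ltn_divLR // -?expnSr // => l lD.
by have := H l.+1 lD; rewrite expnS !divnMA.
Qed.

End Digits.

Section CodedVectors.
Local Open Scope ring_scope.
Variables (p : nat) (F : fieldType) (w : F).
Hypothesis pp : prime p.
Hypothesis charF : p \in [pchar F].
Let p0 : (0 < p)%N := prime_gt0 pp.

(** The quotients are not reduced to digits: in characteristic p the embedding [%:R] does this. *)
Definition evalcode (D v : nat) : F := \sum_(l < D) (v %/ p ^ l)%:R * w ^+ l.

Lemma evalcode_digits D f :
  evalcode D (\sum_(0 <= l < D) (f l %% p) * p ^ l)%N = \sum_(l < D) (f l)%:R * w ^+ l.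
Proof.
apply: eq_bigr => l _; congr (_ * _).
by rewrite -(GRing.natr_mod_pchar charF) digits_nth // (GRing.natr_mod_pchar charF).
Qed.

Lemma evalcode1 D : (0 < D)%N -> evalcode D 1 = 1.
Proof.
case: D => // D _; rewrite /evalcode big_ord_recl expn0 divn1 mulr1 big1 ?addr0 // => l _.
by rewrite divn_small ?mul0r // -[1%N](exp1n (bump 0 l)) ltn_exp2r // prime_gt1.
Qed.

Lemma frobenius_sum (I : finType) (f : I -> F) m :
  (\sum_i f i) ^+ (p ^ m) = \sum_i f i ^+ (p ^ m).
Proof.
elim: m => [|m IH]; first by rewrite expr1; apply: eq_bigr => i _; rewrite expr1.
rewrite expnSr exprM IH -(pFrobenius_autE charF) rmorph_sum.
by apply: eq_bigr => i _; rewrite exprM -(pFrobenius_autE charF).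
Qed.

Lemma frobenius_natr a m : a%:R ^+ (p ^ m) = a%:R :> F.
Proof.
elim: m => [|m IH]; first by rewrite expr1.
by rewrite expnSr exprM IH -(pFrobenius_autE charF) pFrobenius_aut_nat.
Qed.

End CodedVectors.

Section Lfsr.
Local Open Scope ring_scope.
Variables (p D N c : nat).
Hypothesis pp : prime p.
Hypothesis D0 : (0 < D)%N.
Hypothesis DN : (p ^ D <= N)%N.
Let p0 : (0 < p)%N := prime_gt0 pp.

Lemma cpow_exact l : (l <= D)%N -> cpow N p l = (p ^ l)%N.
Proof.
move=> lD; rewrite cpowE //; apply/minn_idPr; apply: leq_trans DN.
by rewrite leq_exp2l // prime_gt1.
Qed.

Lemma lfsrE v : lfsr N p D c v =
  (\sum_(0 <= l < D) (((if l == 0%N then 0 else v %/ p ^ l.-1)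
                 + v %/ p ^ D.-1 * (c %/ p ^ l)) %% p) * p ^ l)%N.
Proof.
rewrite /lfsr; apply: eq_big_nat => l /andP[_ lD].
by rewrite !cpow_exact //; lia.
Qed.

Lemma lfsr_lt v : (lfsr N p D c v < p ^ D)%N.
Proof. by rewrite lfsrE (digits_lt p0 D (fun l => _)). Qed.

Lemma genpowS i : genpow N p D c i.+1 = lfsr N p D c (genpow N p D c i).
Proof. by rewrite /genpow /=; apply/minn_idPr; apply: leq_trans DN; apply/ltnW/lfsr_lt. Qed.

Lemma genpow_lt i : (genpow N p D c i < p ^ D)%N.
Proof.
case: i => [|i]; last by rewrite genpowS lfsr_lt.
by rewrite /genpow /= -[1%N](exp1n D) ltn_exp2r // prime_gt1.
Qed.

Variables (F : fieldType) (w : F).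
Hypothesis charF : p \in [pchar F].
Hypothesis wD : w ^+ D = evalcode p w D c.

(** The digits shift up by one place, and the digit pushed out, now in front of w^D, is fed back
    through the relation [wD]. *)
Lemma evalcode_lfsr v : evalcode p w D (lfsr N p D c v) = w * evalcode p w D v.
Proof.
rewrite lfsrE (evalcode_digits w pp charF D (fun l => _)).
under eq_bigr => l _ do rewrite natrD natrM mulrDl -mulrA.
rewrite big_split /= -mulr_sumr -/(evalcode p w D c) -wD /evalcode.
have [D' ->] : exists D', D = D'.+1 by exists D.-1; lia.
rewrite big_ord_recl /= mul0r add0r [in RHS]big_ord_recr /= mulrDr mulr_sumr.
congr (_ + _); last by rewrite mulrCA -exprS.
by apply: eq_bigr => l _; rewrite mulrCA -exprS.
Qed.

Lemma evalcode_genpow i : evalcode p w D (genpow N p D c i) = w ^+ i.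
Proof.
elim: i => [|i IH]; first by rewrite /genpow /= evalcode1.
by rewrite genpowS evalcode_lfsr IH -exprS.
Qed.

(** Digitwise subtraction inside nat: [u + p.-1 * v] plays the role of u - v modulo p, and its
    digits form a code in the kernel. *)
Lemma evalcode_inj_of_kernel :
  (forall v, (v < p ^ D)%N -> evalcode p w D v = 0 -> v = 0%N) ->
  forall u v, (u < p ^ D)%N -> (v < p ^ D)%N -> evalcode p w D u = evalcode p w D v -> u = v.
Proof.
move=> ker u v Hu Hv E.
pose f l := (u %/ p ^ l + p.-1 * (v %/ p ^ l))%N.
have Ef : evalcode p w D (\sum_(0 <= l < D) (f l %% p) * p ^ l)%N = 0.
  rewrite evalcode_digits //.
  under eq_bigr => l _ do rewrite natrD natrM mulrDl -mulrA.
  rewrite big_split /= -mulr_sumr -/(evalcode p w D u) -/(evalcode p w D v) E.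
  rewrite -[X in X + _]mul1r -mulrDl -(natrD _ 1 _) add1n prednK //.
  by rewrite (pcharf0 charF) mul0r.
have Z := ker _ (digits_lt p0 D f) Ef.
apply: (digits_ext p0 Hu Hv) => l lD.
have := digits_nth p0 f lD; rewrite Z div0n mod0n /f => H.
set U := (u %/ p ^ l)%N in H *; set V := (v %/ p ^ l)%N in H *.
rewrite -(modnMDl V U p) (_ : V * p + U = (U + p.-1 * V) + V)%N; last first.
  by rewrite -{1}[p]prednK // mulnC mulSn; lia.
by rewrite -modnDml -H add0n.
Qed.

End Lfsr.

Import GRing.Theory.

Section PrimitiveFeedback.
Local Open Scope ring_scope.
Variables (p D N : nat).
Hypothesis pp : prime p.
Hypothesis D1 : (1 < D)%N.
Hypothesis DN : (p ^ D <= N)%N.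
Let p0 : (0 < p)%N := prime_gt0 pp.
Let p1 : (1 < p)%N := prime_gt1 pp.
Let D0 : (0 < D)%N := ltnW D1.

Lemma cpow_D : cpow N p D = (p ^ D)%N.
Proof. exact: (cpow_exact pp DN (leqnn D)). Qed.

(* A relation of degree < D with coefficients in F_p would have the D conjugates of w as roots. *)
Lemma evalcode_kernel (F : fieldType) (w : F) v :
  p \in [pchar F] -> (forall i j, (i < (p ^ D).-1)%N -> (j < (p ^ D).-1)%N -> w ^+ i = w ^+ j -> i = j) ->
  (v < p ^ D)%N -> evalcode p w D v = 0 -> v = 0%N.
Proof.
move=> charF winj vD E; set A := \poly_(l < D) ((v %/ p ^ l)%:R : F).
have rootA j : root A (w ^+ (p ^ j)).
  rewrite /root horner_poly; apply/eqP.
  transitivity ((evalcode p w D v) ^+ (p ^ j)); last by rewrite E expr0n expn_eq0 (gtn_eqF p0).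
  rewrite frobenius_sum //; apply: eq_bigr => l _.
  by rewrite exprMn frobenius_natr // -!exprM mulnC.
have A0 : A = 0.
  apply/eqP; apply/negP => /negP nA.
  have allA : all (root A) [seq w ^+ (p ^ j) | j <- iota 0 D].
    by apply/allP => x /mapP[j _ ->].
  have uniqA : uniq [seq w ^+ (p ^ j) | j <- iota 0 D].
    rewrite map_inj_in_uniq ?iota_uniq // => i j; rewrite !mem_iota !add0n => /andP[_ iD] /andP[_ jD].
    have B k : (k < D)%N -> (p ^ k < (p ^ D).-1)%N.
      move=> kD; apply: (@leq_ltn_trans (p ^ D.-1)); first by rewrite leq_exp2l //; lia.
      rewrite -{2}(prednK D0) expnS.
      have : (p <= p ^ D.-1)%N by rewrite -{1}[p]expn1 leq_exp2l //; lia.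
      move: (p ^ D.-1)%N p1 => x; nia.
    by move=> /(winj _ _ (B _ iD) (B _ jD))/eqP; rewrite eqn_exp2l // => /eqP.
  have := leq_trans (max_poly_roots nA allA uniqA) (size_poly _ _).
  by rewrite size_map size_iota ltnn.
apply: (digits_ext p0 vD); first by rewrite expn_gt0 p0.
move=> l lD; rewrite div0n mod0n.
have : A`_l = 0 by rewrite A0 coef0.
rewrite coef_poly lD => /eqP; rewrite -(dvdn_pcharf charF) => /eqP //.
Qed.

(** Let w generate the cyclic unit group of the field with p^D elements. Evaluation of codes at w is
    injective, hence bijective by cardinality, and c is the code of w^D. *)
Lemma exists_primitive_feedback : exists2 c, (c < p ^ D)%N & primitive_feedback N p D c.
Proof.
have [F charF cardF] := pPrimePowerField pp D0.
have /cyclicP[u Hu] := field_unit_group_cyclic [set: {unit F}]%G.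
pose w : F := FinRing.uval u.
have ou : #[u]%g = (p ^ D).-1 by rewrite /order -Hu card_finField_unit cardF.
have wX i : w ^+ i = FinRing.uval (u ^+ i)%g by rewrite FinRing.val_unitX.
have winj i j : (i < (p ^ D).-1)%N -> (j < (p ^ D).-1)%N -> w ^+ i = w ^+ j -> i = j.
  move=> iq jq; rewrite !wX => /val_inj/eqP; rewrite eq_expg_mod_order ou => /eqP.
  by rewrite !modn_small.
have wsurj x : x != 0 -> exists2 i, (i < (p ^ D).-1)%N & x = w ^+ i.
  rewrite -unitfE => Ux.
  have : FinRing.Unit Ux \in [set: {unit F}]%g by rewrite inE.
  rewrite Hu => /cyclePmin[i]; rewrite ou => iq E; exists i => //.
  by rewrite wX -E.
have inj : forall u v, (u < p ^ D)%N -> (v < p ^ D)%N ->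
    evalcode p w D u = evalcode p w D v -> u = v.
  apply: evalcode_inj_of_kernel => // v vD; exact: evalcode_kernel charF winj vD.
have [c Hc] : exists c : 'I_(p ^ D), evalcode p w D c = w ^+ D.
  pose f (v : 'I_(p ^ D)) := evalcode p w D v.
  have finj : injective f by move=> a b /inj H; apply: val_inj; apply: H.
  have [g fg gf] : bijective f by apply: inj_card_bij finj _; rewrite cardF card_ord.
  by exists (g (w ^+ D)); rewrite -/(f _) gf.
exists c; first exact: ltn_ord.
have G i := evalcode_genpow pp D0 DN charF (esym Hc) i.
have lt i := genpow_lt c pp D0 DN i.
rewrite /primitive_feedback cpow_D; apply/andP; split.
  apply/eqP; apply: inj => //; first by rewrite -[1%N](exp1n D) ltn_exp2r.
  by rewrite G evalcode1 // wX -ou expg_order.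
apply/allP => v; rewrite mem_iota add0n => /andP[_ vD].
case: eqP => //= /eqP v0.
have [|i iq Ei] := wsurj (evalcode p w D v).
  apply: contra v0 => /eqP H; apply/eqP.
  exact: evalcode_kernel charF winj vD H.
by apply/hasP; exists i; [rewrite mem_iota|apply/eqP/inj; rewrite ?G].
Qed.

Lemma feedbackP : primitive_feedback N p D (feedback N p D).
Proof.
have [c cD Pc] := exists_primitive_feedback.
have H : has (primitive_feedback N p D) (iota 0 (cpow N p D)).
  by apply/hasP; exists c => //; rewrite mem_iota cpow_D.
have := nth_find 0%N H; rewrite nth_iota ?add0n //.
by rewrite -[X in (_ < X)%N](size_iota 0) -has_find.
Qed.

End PrimitiveFeedback.

(** * Norms through discrete logarithms *)

Section NormClass.
Local Open Scope ring_scope.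
Variables (p D N c : nat).
Hypothesis pp : prime p.
Hypothesis D1 : (1 < D)%N.
Hypothesis DN : (p ^ D <= N)%N.
Hypothesis Pc : primitive_feedback N p D c.
Let p0 : (0 < p)%N := prime_gt0 pp.
Let p1 : (1 < p)%N := prime_gt1 pp.
Let D0 : (0 < D)%N := ltnW D1.
Let q := (p ^ D)%N.
Let q1 : (1 < q)%N.
Proof. by rewrite -[1%N](exp1n D) ltn_exp2r. Qed.

Lemma genpow_cycle : genpow N p D c q.-1 = 1%N.
Proof. by move: Pc; rewrite /primitive_feedback cpow_D // => /andP[/eqP]. Qed.

Lemma genpow_onto v : (0 < v < q)%N -> exists2 i, (i < q.-1)%N & genpow N p D c i = v.
Proof.
move=> /andP[v0 vq]; move: Pc; rewrite /primitive_feedback cpow_D // => /andP[_ /allP/(_ v)].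
rewrite mem_iota add0n vq => /(_ isT); rewrite (gtn_eqF v0) /= => /hasP[i].
by rewrite mem_iota => iq /eqP; exists i.
Qed.

Lemma genpow_dlog v : (0 < v < q)%N -> genpow N p D c (dlog N p D c v) = v.
Proof.
move=> /genpow_onto[i iq Ei].
have H : has (fun i => genpow N p D c i == v) (iota 0 q).
  by apply/hasP; exists i; [rewrite mem_iota; lia|apply/eqP].
have := nth_find 0%N H; rewrite nth_iota ?add0n /dlog ?cpow_D // => [/eqP //|].
by rewrite -[X in (_ < X)%N](size_iota 0) -has_find.
Qed.

Lemma genpow_inj i j : (i < q.-1)%N -> (j < q.-1)%N ->
  genpow N p D c i = genpow N p D c j -> i = j.
Proof.
move=> iq jq.
have U : uniq [seq genpow N p D c i | i <- iota 0 q.-1].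
  apply: (@leq_size_uniq _ (iota 1 q.-1)); rewrite ?iota_uniq //.
    move=> v; rewrite mem_iota add1n prednK; last lia.
    move=> /genpow_onto[k kq <-]; apply: map_f; by rewrite mem_iota.
  by rewrite size_map !size_iota.
by move/mkseq_uniqP: U; apply.
Qed.

(** The c that the search returns is known only through the numerical test and need not come from
    the generator used to show that one exists. A field is recovered for it by a root of T^D - c in
    an algebraic closure of F_p. *)
Lemma exists_root : exists (F : fieldType) (w : F), p \in [pchar F] /\ w ^+ D = evalcode p w D c.
Proof.
have [F [f _]] := countable_algebraic_closure 'F_p.
have [w Hw] := solve_monicpoly (fun i => (c %/ p ^ i)%:R : F) D0.
by exists F, w; split=> //; apply: (rmorph_pchar f); exact: pchar_Fp.
Qed.

Variables (F : fieldType) (w : F).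
Hypothesis charF : p \in [pchar F].
Hypothesis wD : w ^+ D = evalcode p w D c.
Let code := evalcode p w D.

Lemma code_genpow i : code (genpow N p D c i) = w ^+ i.
Proof. exact: evalcode_genpow. Qed.

Lemma w_order : w ^+ q.-1 = 1.
Proof. by rewrite -code_genpow genpow_cycle /code evalcode1. Qed.

Lemma w_neq0 : w != 0.
Proof.
apply: contra_eq_neq w_order => ->; rewrite expr0n gtn_eqF ?(eq_sym 0) ?oner_eq0 //.
by rewrite -ltnS prednK; lia.
Qed.

(** The test makes every nonzero vector a power of T, so its code is a power of w and does not
    vanish. *)
Lemma code_inj u v : (u < q)%N -> (v < q)%N -> code u = code v -> u = v.
Proof.
apply: (evalcode_inj_of_kernel pp D0 DN charF) => x xq E.
apply/eqP; rewrite -leqn0 leqNgt; apply/negP => x0.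
have [|i iq Ei] := @genpow_onto x; first by rewrite x0.
by move: E; rewrite -Ei -/code code_genpow => /eqP; rewrite expf_eq0 (negbTE w_neq0) andbF.
Qed.

Lemma w_exp_inj i j : (0 < i < q)%N -> (0 < j < q)%N -> w ^+ i = w ^+ j -> i = j.
Proof.
move=> Hi Hj E; suff : i.-1 = j.-1 by lia.
apply: genpow_inj; [lia|lia|].
apply: code_inj; rewrite ?genpow_lt // !code_genpow.
apply: (mulIf w_neq0); rewrite -!exprSr !prednK //; lia.
Qed.

Lemma w_expq i : w ^+ (i * q) = w ^+ i.
Proof.
rewrite mulnC exprM -(prednK (ltnW q1)) exprS w_order mulr1 //.
Qed.

Let E := (\sum_(j < D) p ^ j)%N.

Lemma norm_exponent : (E * p.-1 = q.-1)%N.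
Proof. by rewrite /q /E mulnC -predn_exp. Qed.

(** The norm is the power with exponent E = (q - 1)/(p - 1). As (w^E)^(p - 1) = 1, it depends only
    on the logarithm modulo p - 1; zero has the extra class p - 1, which no residue attains. *)
Lemma normclassP z z' : (z < q)%N -> (z' < q)%N ->
  normclass N p D c z = normclass N p D c z' -> code z ^+ E = code z' ^+ E.
Proof.
have code0 : code 0 = 0.
  by rewrite /code /evalcode big1 // => l _; rewrite div0n mul0r.
have cl x : (dlog N p D c x %% p.-1 < p.-1)%N by rewrite ltn_pmod //; lia.
have wE : (w ^+ E) ^+ p.-1 = 1 by rewrite -exprM norm_exponent w_order.
have ev x : (0 < x < q)%N -> code x ^+ E = (w ^+ E) ^+ (dlog N p D c x %% p.-1).
  move=> Hx; rewrite -{1}(genpow_dlog Hx) code_genpow exprAC.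
  rewrite {1}(divn_eq (dlog N p D c x) p.-1) exprD mulnC exprM.
  by rewrite wE expr1n mul1r.
move=> Hz Hz'; rewrite /normclass; case: eqVneq => [->|z0]; case: eqVneq => [->|z0'] //.
- by move=> H; have := cl z'; rewrite -H ltnn.
- by move=> H; have := cl z; rewrite H ltnn.
- by move=> H; rewrite !ev ?H // ?lt0n ?z0 ?z0'.
Qed.

Lemma code_polyval t b Y : (p ^ t <= N)%N ->
  code (polyval N p D c t b Y) = \sum_(j < t) (Y %/ p ^ j)%:R * (w ^+ b) ^+ j.
Proof.
move=> tN.
have cp j : (j < t)%N -> cpow N p j = (p ^ j)%N.
  move=> jt; rewrite cpowE //; apply/minn_idPr; apply: leq_trans tN.
  by rewrite leq_exp2l //; lia.
have -> : (polyval N p D c t b Y = \sum_(0 <= l < D) (\sum_(j < t) (Y %/ p ^ j %% p)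
      * (genpow N p D c (b * j) %/ p ^ l)) %% p * p ^ l)%N.
  rewrite /polyval; apply: eq_big_nat => l /andP[_ lD]; rewrite (cpow_exact pp DN (ltnW lD)).
  congr (_ %% _ * _)%N; rewrite big_mkord; apply: eq_bigr => j _.
  by rewrite cp.
rewrite /code (evalcode_digits w pp charF D (fun l => _)).
under eq_bigr => l _ do rewrite natr_sum mulr_suml.
rewrite exchange_big /=; apply: eq_bigr => j _.
under eq_bigr => l _ do rewrite natrM (GRing.natr_mod_pchar charF) -mulrA.
by rewrite -mulr_sumr -/(evalcode p w D _) -/code code_genpow exprM.
Qed.

End NormClass.

Import GRing.Theory.

(** * Polynomials with prescribed norm classes *)

Section Nodes.
Variables (p : nat).
Hypothesis pp : prime p.
Let p1 : 1 < p := prime_gt1 pp.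

Lemma node_modn x : node p x %% p = (x %% p.-1).+1.
Proof.
have H : x %% p.-1 < p.-1 by rewrite ltn_pmod //; lia.
by rewrite /node addn1 -addnS mulnC modnMDl modn_small //; lia.
Qed.

Lemma node_gt0 x : 0 < node p x.
Proof. by rewrite /node addn1. Qed.

Lemma node_ndvd x : ~~ (p %| node p x).
Proof. by rewrite /dvdn node_modn. Qed.

Lemma node_inj : injective (node p).
Proof.
move=> x y E; have := congr1 (modn^~ p) E; rewrite /= !node_modn => -[Em].
by move: E; rewrite /node Em => E; rewrite (divn_eq x p.-1) (divn_eq y p.-1) Em; nia.
Qed.

(** Sharp: [p.-1 * p ^ h.-1] is the number of exponents below p^h that p does not divide. *)
Lemma node_lt h x : 0 < h -> x < p.-1 * p ^ h.-1 -> node p x < p ^ h.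
Proof.
move=> h0 Hx; have Ha : x %/ p.-1 < p ^ h.-1 by rewrite ltn_divLR //; lia.
have Hb : x %% p.-1 < p.-1 by rewrite ltn_pmod //; lia.
rewrite /node -{1}(prednK h0) expnS; move: (x %/ _) (x %% _) (p ^ _) Ha Hb => a b r; nia.
Qed.

End Nodes.

Section Fibers.
Local Open Scope ring_scope.
Variables (p h N c : nat).
Hypothesis pp : prime p.
Hypothesis h0 : (0 < h)%N.
Let D := (2 * h)%N.
Hypothesis DN : (p ^ D <= N)%N.
Hypothesis Pc : primitive_feedback N p D c.
Let p1 : (1 < p)%N := prime_gt1 pp.
Let p0 : (0 < p)%N := prime_gt0 pp.
Let D1 : (1 < D)%N. Proof. by rewrite /D; lia. Qed.
Let E := (\sum_(j < D) p ^ j)%N.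

Section Root.
Variables (F : fieldType) (w : F).
Hypothesis charF : p \in [pchar F].
Hypothesis wD : w ^+ D = evalcode p w D c.

(** Here D = 2h is used. If m <= h, then b' p^m is still below q, so the exponents agree as
    integers, and m = 0 because p does not divide b. If m > h, raising to the power p^(D - m)
    exchanges the roles of b and b', with D - m < h. *)
Lemma not_conjugate1 b b' m : (0 < b < p ^ h)%N -> (0 < b' < p ^ h)%N ->
  ~~ (p %| b)%N -> ~~ (p %| b')%N -> (m < D)%N -> w ^+ b = w ^+ (b' * p ^ m) -> b = b'.
Proof.
move=> Hb Hb' nb nb' mD H.
have qE : (p ^ D = p ^ h * p ^ h)%N by rewrite -expnD /D mul2n addnn.
have inj := w_exp_inj pp D1 DN Pc charF wD.
have wq := w_expq pp D1 DN Pc charF wD.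
have small x r : (0 < x < p ^ h)%N -> (r <= h)%N -> (0 < x * p ^ r < p ^ D)%N.
  move=> /andP[x0 xh] rh; rewrite muln_gt0 x0 expn_gt0 p0 /= qE.
  apply: (@leq_trans (p ^ h * p ^ r)); first by rewrite ltn_pmul2r // expn_gt0 p0.
  by rewrite leq_mul2l leq_exp2l // rh orbT.
have bs x : (0 < x < p ^ h)%N -> (0 < x < p ^ D)%N.
  by move=> /small/(_ (leq0n h)); rewrite muln1.
have [mh|hm] := leqP m h.
  have := inj _ _ (bs _ Hb) (small _ _ Hb' mh) H.
  case: m {mD H mh} => [|m]; first by rewrite muln1.
  by move=> Eb; case/negP: nb; rewrite Eb expnS; apply/dvdn_mull/dvdn_mulr.
have H2 : w ^+ (b * p ^ (D - m)) = w ^+ b'.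
  by rewrite exprM H -exprM -mulnA -expnD subnKC ?wq // ltnW.
have := inj _ _ (small _ _ Hb (_ : D - m <= h)%N) (bs _ Hb') H2.
rewrite /D => /(_ ltac:(lia)) Eb; case/negP: nb'.
have e : (2 * h - m = (2 * h - m).-1.+1)%N by rewrite /D in mD; lia.
by rewrite -Eb e expnS; apply/dvdn_mull/dvdn_mulr.
Qed.

(** Applying Frobenius D - j more times removes it from the left side, since
    [w ^+ (i * q) = w ^+ i]; a surplus of D on the right is dropped likewise. *)
Lemma not_conjugate b b' j j' : (0 < b < p ^ h)%N -> (0 < b' < p ^ h)%N ->
  ~~ (p %| b)%N -> ~~ (p %| b')%N -> (j < D)%N -> (j' < D)%N ->
  (w ^+ b) ^+ (p ^ j) = (w ^+ b') ^+ (p ^ j') -> b = b'.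
Proof.
move=> Hb Hb' nb nb' jD j'D; rewrite -!exprM => H.
have wq := w_expq pp D1 DN Pc charF wD.
have H2 : w ^+ b = w ^+ (b' * p ^ (j' + (D - j))).
  by rewrite expnD mulnA [RHS]exprM -H -exprM -mulnA -expnD subnKC ?wq // ltnW.
have [jj|jj] := leqP j j'.
  apply: (@not_conjugate1 b b' (j' - j)) => //; first lia.
  rewrite H2 (_ : j' + (D - j) = (j' - j) + D)%N; last lia.
  by rewrite expnD mulnA wq.
by apply: (@not_conjugate1 b b' (j' + (D - j))) => //; lia.
Qed.

Definition polycode t (Y : nat) (a : F) : F := \sum_(j < t) (Y %/ p ^ j)%:R * a ^+ j.

Lemma polycode_frobenius t Y a j :
  polycode t Y a ^+ (p ^ j) = polycode t Y (a ^+ (p ^ j)).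
Proof.
rewrite frobenius_sum //; apply: eq_bigr => l _.
by rewrite exprMn frobenius_natr // -!exprM mulnC.
Qed.

Lemma fiber_bound_points t (alpha : 'I_t -> F) (g : 'I_t -> F) (Ys : seq nat) :
  uniq Ys -> (forall Y, Y \in Ys -> Y < p ^ t)%N ->
  (forall i i' j j', i != i' -> (j < D)%N -> (j' < D)%N ->
     alpha i ^+ (p ^ j) != alpha i' ^+ (p ^ j')) ->
  (forall Y i, Y \in Ys -> polycode t Y (alpha i) ^+ E = g i) ->
  (size Ys <= D ^ t)%N.
Proof.
move=> UY Yt conj HY.
pose l i j : 'cV[F]_t := \col_r (alpha i ^+ (p ^ j)) ^+ r.
pose z (a : 'I_(size Ys)) : 'rV[F]_t := \row_r (nth 0%N Ys a %/ p ^ r)%:R.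
have YI (a : 'I_(size Ys)) : nth 0%N Ys a \in Ys by rewrite mem_nth.
apply: (@bezout_product_forms F t D _ l g z); first lia.
- move=> a b /rowP Hz; apply: val_inj; apply/eqP.
  rewrite -(nth_uniq 0%N (ltn_ord a) (ltn_ord b) UY); apply/eqP.
  apply: (@digits_ext p p0 t); [exact: Yt|exact: Yt|].
  move=> r rt; have := Hz (Ordinal rt); rewrite !mxE /= => /eqP.
  move: (_ %/ _)%N (_ %/ _)%N => y x /eqP Exy.
  (* Equality in F only yields congruence modulo p; the difference is written [x + p.-1 * y] to stay
     in nat. *)
  have e : (y + p.-1 * y = p * y)%N by rewrite -{2}(prednK p0) mulSn.
  have : (p %| x + p.-1 * y)%N.
    rewrite (dvdn_pcharf charF) natrD Exy -natrD e natrM (pcharf0 charF) mul0r //.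
  rewrite /dvdn => /eqP H.
  rewrite -(modnMDl y x p) (_ : y * p + x = (x + p.-1 * y) + y)%N; last by nia.
  by rewrite -modnDml H add0n.
- move=> s; rewrite unitmxE unitfE.
  pose v : 'rV[F]_t := \row_j alpha j ^+ (p ^ s j).
  rewrite (_ : \matrix_(i, j) _ = Vandermonde t v); last by apply/matrixP => i j; rewrite !mxE.
  rewrite det_Vandermonde; apply/prodf_neq0 => i _; apply/prodf_neq0 => j ij.
  rewrite !mxE subr_eq0; apply: conj => //.
  by rewrite -(inj_eq val_inj) /= gtn_eqF.
(* E is the sum of the p^j, so the E-th power is the product of the D Frobenius images, that is, of
   the values at the D conjugates. *)
- move=> a i; rewrite -(HY _ i (YI a)) /E.
  rewrite (eq_bigr (fun j : 'I_D => polycode t (nth 0%N Ys a) (alpha i) ^+ (p ^ j))); last first.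
    move=> j _; rewrite polycode_frobenius mxE; apply: eq_bigr => r _.
    by rewrite !mxE.
  by rewrite -prodrXr.
Qed.

End Root.

(* [None] stands for the point 0, at which a coded polynomial takes the value of its digit Y mod p. *)
Definition classat t (x : option nat) (Y : nat) : nat :=
  if x is Some x then nodeclass N p D c t x Y else (Y %% p)%N.

(** The point 0 is treated like a node: all its conjugates are 0, hence different from those of the
    other points, which are powers of w, and fixing the value there fixes its E-th power. *)
Lemma fiber_bound t (xs : seq (option nat)) (G : option nat -> nat) (Ys : seq nat) :
  (p ^ t <= N)%N -> (0 < t)%N ->
  uniq xs -> size xs = t -> (forall x, Some x \in xs -> x < p.-1 * p ^ h.-1)%N ->
  uniq Ys -> (forall Y, Y \in Ys -> Y < p ^ t)%N ->
  (forall x Y, x \in xs -> Y \in Ys -> classat t x Y = G x) ->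
  (size Ys <= D ^ t)%N.
Proof.
move=> tN t0 Ux sx Hx UY Yt HG.
have [F [w [charF wD]]] := exists_root c pp D1.
pose point (x : option nat) : F := if x is Some x then w ^+ (node p x) else 0.
(* Classes carry no field element, so the right-hand sides of the equations are taken from a first
   member [Y0]; equality of classes with [Y0] gives equality of norms. *)
case EY: Ys => [|Y0 Ys0]; first by [].
rewrite -EY.
have Y0Y : Y0 \in Ys by rewrite EY mem_head.
have xI (i : 'I_t) : nth None xs i \in xs by rewrite mem_nth // sx.
apply: (@fiber_bound_points F charF t (fun i => point (nth None xs i))
   (fun i => polycode t Y0 (point (nth None xs i)) ^+ E) Ys UY Yt).
- move=> i i' j j' ii' jD j'D.
  have : nth None xs i != nth None xs i' by rewrite nth_uniq ?sx.
  have := xI i; have := xI i'; case: (nth None xs i') (nth None xs i) => [x'|] [x|] //= I' I ne.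
  + apply: contra ne => /eqP/not_conjugate H; apply/eqP; congr Some; apply: (node_inj pp).
    apply: H; rewrite ?node_gt0 ?node_ndvd ?node_lt ?Hx //.
  + by rewrite expr0n expn_eq0 (gtn_eqF p0) /= eq_sym !expf_eq0 (negbTE (w_neq0 pp D1 DN Pc charF wD)) !andbF.
  + by rewrite expr0n expn_eq0 (gtn_eqF p0) /= !expf_eq0 (negbTE (w_neq0 pp D1 DN Pc charF wD)) !andbF.
- move=> Y i YY; have := HG _ _ (xI i) YY; have := HG _ _ (xI i) Y0Y.
  case: (nth None xs i) => [x|] <- /=.
    move=> H; have L b Y' : (polyval N p D c t b Y' < p ^ D)%N.
      rewrite /polyval; have -> : (\sum_(0 <= l < D) (\sum_(0 <= j < t) (Y' %/ cpow N p j %% p)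
        * (genpow N p D c (b * j) %/ cpow N p l)) %% p * cpow N p l
        = \sum_(0 <= l < D) (\sum_(0 <= j < t) (Y' %/ cpow N p j %% p)
        * (genpow N p D c (b * j) %/ cpow N p l)) %% p * p ^ l)%N.
        by apply: eq_big_nat => l /andP[_ lD]; rewrite [in X in (_ * X)%N](cpow_exact pp DN (ltnW lD)).
      by rewrite (digits_lt p0 D (fun l => _)).
    have := normclassP pp D1 DN Pc charF wD (L _ Y) (L _ Y0) H.
    by rewrite !code_polyval.
  have P0 Y' : polycode t Y' 0 = (Y' %% p)%:R :> F.
    rewrite /polycode (GRing.natr_mod_pchar charF) (bigD1 (Ordinal t0)) //= expn0 divn1 mulr1.
    rewrite big1 ?addr0 // => -[[|j] Hj] //= _; by rewrite expr0n mulr0.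
  by move=> H; rewrite !P0 H.
Qed.

End Fibers.

(** * Primes between a number and its square *)

Lemma central_binomial_ge m : 2 ^ m <= 'C(2 * m, m).
Proof.
elim: m => [|m IH]; first by rewrite muln0 bin0.
have -> : 2 * m.+1 = (2 * m).+2 by lia.
have e : 'C((2 * m).+1, m.+1) = 'C((2 * m).+1, m).
  by rewrite -(@bin_sub _ m); [congr ('C(_, _))|]; lia.
rewrite binS e expnS mul2n -addnn.
have : 'C(2 * m, m) <= 'C((2 * m).+1, m) by case: m {IH e} => [|m]; rewrite ?bin0 // binS leq_addr.
lia.
Qed.

(** Legendre's formula: the k-th term is floor(2m/r^k) - 2 floor(m/r^k), which is at most 1, and 0
    once r^k > 2m. *)
Lemma logn_central_binomial r m : prime r ->
  logn r 'C(2 * m, m) <= \sum_(1 <= k < (2 * m).+1) (r ^ k <= 2 * m).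
Proof.
move=> pr.
have m2 : 2 * m - m = m by lia.
have H := @bin_fact (2 * m) m ltac:(lia); rewrite m2 in H.
have C0 : 0 < 'C(2 * m, m) by rewrite bin_gt0; lia.
have := congr1 (logn r) H; rewrite !lognM ?muln_gt0 ?fact_gt0 // !logn_fact //.
have -> : \sum_(1 <= k < m.+1) m %/ r ^ k = \sum_(1 <= k < (2 * m).+1) m %/ r ^ k.
  rewrite [in RHS](big_cat_nat _ (n := m.+1)) //=; last lia.
  rewrite [X in _ = _ + X]big1_seq ?addn0 // => k; rewrite mem_index_iota => /andP[_ Hk].
  rewrite divn_small //; apply: leq_ltn_trans (_ : k.-1 < r ^ k); first lia.
  by apply: leq_ltn_trans (leq_pred k) (ltn_expl _ (prime_gt1 pr)).
set A := \sum_(_ <= _ < _) _; set B := \sum_(_ <= _ < _) _; set S := \sum_(_ <= _ < _) _.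
suff : B <= A + A + S by lia.
rewrite /A /B /S -!big_split /=; apply: leq_sum => k _.
have r0 : 0 < r ^ k by rewrite expn_gt0 prime_gt0.
case: (leqP (r ^ k) (2 * m)) => Hk; last by rewrite divn_small.
have := ltn_ceil m r0; have := leq_trunc_div (2 * m) (r ^ k).
move: (m %/ r ^ k) (2 * m %/ r ^ k) => x y; move: (r ^ k) r0 Hk => z; nia.
Qed.

Lemma prime_dvdn_fact r n : prime r -> r %| n`! -> r <= n.
Proof.
move=> pr; elim: n => [|n IH]; first by rewrite dvdn1 => /eqP E; rewrite E in pr.
by rewrite factS Euclid_dvdM // => /orP[/dvdn_leq -> //|/IH]; lia.
Qed.

(** Otherwise, with 2m = 2^(2a), the at most 2^a primes dividing C(2m, m) would be at most 2^a, each
    contributing a power of at most 2m. Comparing (2m)^(2^a) with the lower bound 2^m gives 2^(a -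
    1) <= 2a, which fails from a = 5 on. *)
Lemma prime_gap a : 5 <= a -> exists2 p, prime p & 2 ^ a < p <= 2 ^ (2 * a).
Proof.
move=> a5; set M := 2 ^ (2 * a).
case: (boolP (has (fun p => prime p && (2 ^ a < p)) (iota 0 M.+1))) => [/hasP[p]|/hasPn Hn].
  by rewrite mem_iota => Hp /andP[pp pa]; exists p => //; rewrite pa; lia.
pose m := 2 ^ (2 * a).-1.
have mM : 2 * m = M by rewrite /m /M -expnS; congr (2 ^ _); lia.
have C0 : 0 < 'C(2 * m, m) by rewrite bin_gt0; lia.
have small r : r \in primes 'C(2 * m, m) -> r <= 2 ^ a.
  rewrite mem_primes => /and3P[pr _ rC]; rewrite leqNgt; apply/negP => ra.
  have rM : r <= 2 * m.
    have : r %| (2 * m)`! by apply: dvdn_trans rC _; rewrite -(@bin_fact (2 * m) m ltac:(lia)); apply: dvdn_mulr.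
    exact: prime_dvdn_fact.
  by have := Hn r; rewrite mem_iota pr ra /= => /(_ ltac:(lia)).
have pw r : prime r -> r ^ logn r 'C(2 * m, m) <= M.
  move=> pr; apply: leq_trans (_ : r ^ trunc_log r (2 * m) <= _); last first.
    by rewrite mM; apply: trunc_logP; rewrite ?prime_gt1 // expn_gt0.
  rewrite leq_exp2l ?prime_gt1 //; apply: leq_trans (logn_central_binomial m pr) _.
  apply: (@leq_trans (\sum_(1 <= k < (2 * m).+1) (k <= trunc_log r (2 * m)))).
    apply: leq_sum => k _; case: (leqP (r ^ k) (2 * m)) => // Hk.
    by rewrite trunc_log_max ?prime_gt1.
  elim: (2 * m) (trunc_log r (2 * m)) => [|n IH] L; first by rewrite big_geq.
  rewrite big_nat_recr //=; case: (leqP n.+1 L) => H; last by rewrite addn0.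
  apply: leq_trans H; rewrite addn1 ltnS; apply: leq_trans (_ : \sum_(1 <= k < n.+1) 1 <= _).
    by apply: leq_sum => k _; apply: leq_b1.
  by rewrite sum_nat_const_nat; lia.
have up : 'C(2 * m, m) <= M ^ (2 ^ a).
  rewrite {1}(prod_prime_decomp C0) prime_decompE big_map /=.
  apply: (@leq_trans (\prod_(r <- primes 'C(2 * m, m)) M)).
    rewrite big_seq [X in _ <= X]big_seq; apply: leq_prod => r.
    by rewrite mem_primes => /and3P[pr _ _]; apply: pw.
  rewrite big_const_seq count_predT iter_muln_1 leq_exp2l; last first.
    by rewrite /M -(expn0 2) ltn_exp2l //; lia.
  rewrite -[X in _ <= X](size_iota 1); apply: uniq_leq_size; first exact: primes_uniq.
  move=> r Hr; rewrite mem_iota; have := small r Hr.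
  by move: Hr; rewrite mem_primes => /and3P[/prime_gt0]; lia.
have := leq_trans (central_binomial_ge m) up.
rewrite /M -expnM leq_exp2l // /m => H; exfalso.
have e1 : 2 ^ (2 * a).-1 = 2 ^ a.-1 * 2 ^ a by rewrite -expnD; congr (2 ^ _); lia.
move: H; rewrite e1 leq_pmul2r ?expn_gt0 // leqNgt => /negP; apply.
have [b ->] : exists b, a = b + 5 by exists (a - 5); lia.
elim: b => [//|b IH].
have -> : (b.+1 + 5).-1 = (b + 5).-1.+1 by lia.
by rewrite expnS; lia.
Qed.

(** * Counting and averaging *)

Section Selection.
Variable b : nat -> bool.

Let before z := \sum_(0 <= i < z) b i.

Let beforeS z : before z.+1 = before z + b z.
Proof. by rewrite /before big_nat_recr. Qed.

Let before_mono z z' : z <= z' -> before z <= before z'.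
Proof. by elim: z' => [|z' IH]; [case: z|rewrite leq_eqVlt => /orP[/eqP -> //|/IH]; rewrite beforeS; lia]. Qed.

Let sel M r := find (fun z => b z && (before z == r)) (iota 0 M).

Lemma selected_prop M r : r < before M -> sel M r < M /\ b (sel M r).
Proof.
move=> rM; have H : has (fun z => b z && (before z == r)) (iota 0 M).
  apply/hasP; elim: M rM => [|M IH]; first by rewrite /before big_geq.
  rewrite beforeS => H; case: (ltnP r (before M)) => [/IH[z]|Hr].
    by rewrite mem_iota => Hz Pz; exists z => //; rewrite mem_iota; lia.
  have bM : b M by move: H; case: (b M) => //=; lia.
  by exists M; rewrite ?mem_iota ?bM /=; lia.
have Hs : sel M r < M by rewrite -[X in _ < X](size_iota 0) -has_find.
by split=> //; have /andP[] := nth_find 0 H; rewrite nth_iota.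
Qed.

(** The rank increases strictly after a hit, so no earlier hit has the rank of z. *)
Lemma selected_before M z : z < M -> b z -> before z < before M /\ sel M (before z) = z.
Proof.
move=> zM bz; split.
  by have := before_mono zM; rewrite beforeS bz; lia.
rewrite /sel -(subnKC (ltnW zM)) iotaD find_cat size_iota add0n ifF.
  have -> : M - z = (M - z).-1.+1 by lia.
  by rewrite /= bz eqxx /= addn0.
apply/hasP => -[y]; rewrite mem_iota add0n => /andP[_ yz] /andP[by_ /eqP E].
by have := before_mono yz; rewrite beforeS by_ E; lia.
Qed.

End Selection.

Lemma ffact_le n i : n ^_ i <= n ^ i.
Proof.
elim: i n => // i IH n; rewrite ffactnSr expnSr; apply: leq_mul (IH n) (leq_subr _ _).
Qed.

(** This is (1 + 1/n)^n <= 3. After the first, the binomial terms are at most n^n / 2^i because (i +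
    1)! >= 2^i; the partial sums are bounded by (3 - 2/2^m) n^n, here with denominators cleared. *)
Lemma succ_exp_le n : n.+1 ^ n <= 3 * n ^ n.
Proof.
have T i : i < n -> 2 ^ i * ('C(n, i.+1) * n ^ (n - i.+1)) <= n ^ n.
  move=> Hi; apply: (@leq_trans ((i.+1)`! * ('C(n, i.+1) * n ^ (n - i.+1)))).
    rewrite leq_mul2r; apply/orP; right.
    elim: i {Hi} => // i IH; rewrite expnS factS; apply: leq_mul IH; lia.
  rewrite mulnA [_ * 'C(_, _)]mulnC bin_ffact -[in X in _ <= X](subnK Hi) expnD mulnC.
  by rewrite subnK // leq_mul2l ffact_le orbT.
have S m : m <= n -> 2 ^ m * (\sum_(0 <= i < m.+1) 'C(n, i) * n ^ (n - i)) <= (3 * 2 ^ m - 2) * n ^ n.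
  elim: m => [|m IH] Hm; first by rewrite big_nat1 bin0 subn0; lia.
  rewrite big_nat_recr // mulnDr expnS.
  have := IH (ltnW Hm); have := T m Hm; have : 0 < 2 ^ m by rewrite expn_gt0.
  move: (\sum_(_ <= _ < _) _) ('C(_, _) * _) (2 ^ m) (n ^ n) => s u v w; nia.
have := S n (leqnn n).
have -> : \sum_(0 <= i < n.+1) 'C(n, i) * n ^ (n - i) = n.+1 ^ n.
  rewrite big_mkord -[in RHS]addn1 expnDn; apply: eq_bigr => i _; by rewrite exp1n muln1.
have : 0 < 2 ^ n by rewrite expn_gt0.
move: (2 ^ n) (n ^ n) (n.+1 ^ n) => v w u; nia.
Qed.

Lemma exp_le_fact n : n ^ n <= 3 ^ n * n`!.
Proof.
elim: n => // n IH; rewrite expnS factS [3 ^ _]expnS.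
by have := succ_exp_le n; move: (n.+1 ^ n) (n ^ n) (3 ^ n) (n`!) IH => a b c f; nia.
Qed.

Lemma third_exp_le_fact h : (2 * h) ^ (6 * h) <= (6 * h)`!.
Proof.
have := exp_le_fact (6 * h); rewrite {1}(_ : 6 * h = 3 * (2 * h)); last lia.
by rewrite expnMn leq_pmul2l // expn_gt0.
Qed.

Section Averaging.
Variables (P p k L lam d : nat) (f : 'I_P -> {ffun 'I_k -> 'I_p}).
Hypothesis PE : P = p ^ k * p.
Hypothesis p0 : 0 < p.
Hypothesis Lp : L <= p.
Hypothesis lam0 : 0 < lam.
Hypothesis Ld : lam * d <= L.
Hypothesis fiber : forall c v, #|[set Y : 'I_P | (f Y == c) && (Y %% p == v)]| <= lam.

Lemma popular_class : 0 < d -> exists c (Ys : seq nat),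
  [/\ size Ys = d, uniq [seq Y %% p | Y <- Ys] &
      forall Y, Y \in Ys -> Y %% p < L /\ exists Y' : 'I_P, Y' = Y :> nat /\ f Y' = c].
Proof.
move=> d0; have L0 : 0 < L by apply: leq_trans Ld; rewrite muln_gt0 lam0.
pose V c := [set v : 'I_L | [exists Y : 'I_P, (f Y == c) && (Y %% p == v)]].
case: (pickP (fun c => d <= #|V c|)) => [c Hc|Hn]; last first.
  pose Z := [set Y : 'I_P | Y %% p < L].
  have Zge : L * p ^ k <= #|Z|.
    have lt (x : 'I_L * 'I_(p ^ k)) : x.2 * p + x.1 < P.
      by rewrite PE; case: x => [[a Ha] [b Hb]] /=; nia.
    pose g x : 'I_P := Ordinal (lt x).
    have gi : injective g.
      move=> [a b] [a' b'] /(congr1 val) /= E.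
      have Ea : a = a' :> nat.
        have := congr1 (modn^~ p) E; rewrite /= !modnMDl !modn_small //.
          exact: leq_trans (ltn_ord a') Lp.
        exact: leq_trans (ltn_ord a) Lp.
      move/eqP: E; rewrite Ea eqn_add2r eqn_pmul2r // => /eqP Eb.
      by congr (_, _); apply: val_inj.
    rewrite -[L in X in X <= _]card_ord -[p ^ k in X in X <= _]card_ord -card_prod -(card_imset _ gi).
    apply: subset_leq_card; apply/subsetP => y /imsetP[x _ ->].
    rewrite inE /= modnMDl modn_small ?ltn_ord //.
    exact: leq_trans (ltn_ord _) Lp.
  have Zle : #|Z| <= \sum_c \sum_(v in V c) lam.
    apply: (@leq_trans (\sum_c \sum_(v in V c) #|[set Y : 'I_P | (f Y == c) && (Y %% p == v)]|)).
      rewrite -sum1_card (partition_big f xpredT) //=; apply: leq_sum => c _.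
      pose h (Y : 'I_P) : 'I_L := insubd (Ordinal L0) (Y %% p).
      have hE (Y : 'I_P) : Y %% p < L -> h Y = Y %% p :> nat by move=> H; rewrite val_insubd H.
      rewrite (partition_big h (mem (V c))) /=; last first.
        move=> Y /andP[]; rewrite inE => HY fY.
        by rewrite inE; apply/existsP; exists Y; rewrite fY hE ?eqxx.
      apply: leq_sum => v _; rewrite sum1_card; apply: subset_leq_card; apply/subsetP => Y.
      rewrite !inE => /andP[/andP[HY ->] /eqP <-]; have {}HY : Y %% p < L by [move: HY; rewrite ?inE].
      by rewrite (hE _ HY) /=.
    by apply: leq_sum => c _; apply: leq_sum => v _; apply: fiber.
  have := leq_trans Zge Zle.
  have : \sum_c \sum_(v in V c) lam <= \sum_(c : {ffun 'I_k -> 'I_p}) d.-1 * lam.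
    apply: leq_sum => c _; rewrite sum_nat_const leq_mul2r; apply/orP; right.
    by have := Hn c; rewrite leqNgt => /negbFE; lia.
  rewrite sum_nat_const card_ffun !card_ord => H1 /leq_trans/(_ H1).
  rewrite mulnC leq_pmul2l ?expn_gt0 ?p0 // => H2.
  have := leq_trans Ld H2; rewrite mulnC leq_pmul2r //; lia.
pose py (v : nat) : nat := if [pick Y : 'I_P | (f Y == c) && (Y %% p == v)] is Some Y then Y else 0.
pose vs := take d [seq nat_of_ord v | v <- enum (V c)].
have vsP v : v \in vs -> v < L /\ exists Y' : 'I_P, [/\ Y' = py v :> nat, f Y' = c & Y' %% p = v].
  move=> /mem_take/mapP[v']; rewrite mem_enum inE => /existsP[Y HY] ->; split=> //.
  rewrite /py; case: pickP => [Y' /andP[/eqP fY /eqP Yv]|/(_ Y)]; last by rewrite HY.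
  by exists Y'.
exists c, [seq py v | v <- vs]; split.
- by rewrite size_map size_takel // size_map -cardE.
- rewrite -map_comp (_ : map _ vs = vs).
    by apply: take_uniq; rewrite map_inj_uniq ?enum_uniq //; apply: val_inj.
  by rewrite -[RHS]map_id; apply/eq_in_map => v /vsP[_ [Y [E _ Yv]]] /=; rewrite -E Yv.
- move=> Y /mapP[v /vsP[vL [Y' [E fY Yv]]] ->]; rewrite -E; split; first by rewrite Yv.
  by exists Y'.
Qed.

End Averaging.

(** * Correctness of the reduction *)

Lemma isprimeP p : isprime p = prime p.
Proof.
apply/andP/idP => [[p1 /allP H]|pp].
  apply/primeP; split=> // q qp; case: (ltnP q p) => [q_lt|pq]; last first.
    by rewrite orbC eqn_leq pq dvdn_leq // ltnW.
  have := H q; rewrite mem_iota q_lt => /(_ isT) /orP[|]; last by rewrite -/(dvdn q p) qp.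
  by case: q qp {q_lt} => [|[|q]] //; rewrite dvd0n => /eqP E; rewrite E in p1.
split; first exact: prime_gt1.
apply/allP => q; rewrite mem_iota add0n => /andP[_ qp]; case: (leqP q 1) => //= q1.
apply/negP => qdp; have /primeP[_ /(_ q qdp)] := pp.
by move=> /orP[/eqP E|/eqP E]; [rewrite E in q1|rewrite E ltnn in qp].
Qed.

Lemma nth_pairs (s : seq (nat * nat)) i :
  nth 0 (flatten [seq [:: uv.1; uv.2] | uv <- s]) (2 * i) = (nth (0, 0) s i).1 /\
  nth 0 (flatten [seq [:: uv.1; uv.2] | uv <- s]) (2 * i).+1 = (nth (0, 0) s i).2.
Proof.
elim: s i => [|uv s IH] i; first by rewrite !nth_nil.
case: i => [|i] //; rewrite mulnS /=; exact: IH.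
Qed.

Section Instance.
Variables (n : nat) (e : rel 'I_n) (k : nat).
Hypothesis eG : simple_graph e.

Let inp := init_mem (encode_instance e k).

Lemma inp_k : in_k inp = k. Proof. by []. Qed.
Lemma inp_n : in_n inp = n. Proof. by []. Qed.

Lemma inp_edge i : inp (4 + 2 * i) = (nth (0, 0) (edge_list e) i).1 /\
  inp (5 + 2 * i) = (nth (0, 0) (edge_list e) i).2.
Proof. exact: nth_pairs. Qed.

Lemma mem_edge_list a b :
  reflect (exists u v : 'I_n, [/\ u = a :> nat, v = b :> nat, u < v & e u v])
    ((a, b) \in edge_list e).
Proof.
apply: (iffP mapP) => [[[u v]]|[u [v [<- <- uv euv]]]].
  by rewrite mem_filter /= => /andP[/andP[uv euv] _] [-> ->]; exists u, v.
exists (u, v) => //; rewrite mem_filter uv euv /=.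
by apply/allpairsP; exists (u, v); rewrite !mem_enum.
Qed.

Lemma in_edgeE (u v : 'I_n) : in_edge inp u v = e u v.
Proof.
have [eS eI] := eG.
have E i : i < in_m inp -> (inp (4 + 2 * i), inp (5 + 2 * i)) \in edge_list e.
  by move=> Hi; have [-> ->] := inp_edge i; rewrite -surjective_pairing mem_nth.
apply/hasP/idP => [[i]|euv].
  rewrite mem_iota add0n => /andP[_ /E /mem_edge_list[x [y [<- <- xy exy]]]].
  by move=> /orP[] /andP[/eqP/val_inj <- /eqP/val_inj <-] //; rewrite eS.
have {}H (a b : 'I_n) : a < b -> e a b -> exists2 i, i \in iota 0 (in_m inp) &
    (inp (4 + 2 * i) == a) && (inp (5 + 2 * i) == b).
  move=> ab eab; have : (nat_of_ord a, nat_of_ord b) \in edge_list e.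
    by apply/mem_edge_list; exists a, b.
  move=> /(nthP (0, 0))[i Hi Ei]; exists i; first by rewrite mem_iota.
  by have [-> ->] := inp_edge i; rewrite Ei !eqxx.
case: (ltngtP u v) => [uv|vu|/val_inj uv].
- by have [i Hi Pi] := H u v uv euv; exists i => //; rewrite Pi.
- by have [i Hi Pi] := H v u vu ltac:(by rewrite eS); exists i => //; rewrite Pi orbT.
- by move: euv; rewrite uv eI.
Qed.

End Instance.

Section Decoding.
Variables (n : nat) (e : rel 'I_n) (k L N : nat).
Hypothesis k6 : 6 %| k.+1.
Let inp := init_mem (encode_instance e k).
Let h := k.+1 %/ 6.
Let t := k.+1.
Hypothesis witness : exists2 r, prime r & [/\ L <= r, 2 * n * k <= r ^ h & r ^ t <= N].

Let p := chr inp N L.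

Lemma h_gt0 : 0 < h.
Proof. by rewrite /h divn_gt0 // dvdn_leq. Qed.

Lemma tE : t = 6 * h.
Proof. by rewrite mulnC /h divnK. Qed.

(** The search returns the least admissible number, so p is at most the witness r. Thus p^t <= N,
    and powers of p up to exponent t escape the cut-off. *)
Lemma chr_spec : [/\ prime p, L <= p, 2 * n * k <= p ^ h & p ^ t <= N].
Proof.
have [r pr [Lr mr rN]] := witness.
have r1 := prime_gt1 pr.
have hN : r ^ h <= N by apply: leq_trans rN; rewrite leq_exp2l // tE; move: h_gt0; lia.
have rltN : r < N.
  apply: leq_trans rN; rewrite -{1}[r]expn1 ltn_exp2l // tE; move: h_gt0; lia.
pose P q := [&& isprime q, L <= q & 2 * n * k <= cpow N q h].
have Pr : P r by rewrite /P isprimeP pr Lr cpowE ?prime_gt0 // leq_min (leq_trans mr hN).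
have H : has P (iota 0 N) by apply/hasP; exists r => //; rewrite mem_iota.
have pE : p = find P (iota 0 N) by [].
have pN : p < N by rewrite pE -[X in _ < X](size_iota 0) -has_find.
have := nth_find 0 H; rewrite -pE nth_iota // add0n /P isprimeP => /and3P[pp Lp].
rewrite cpowE ?prime_gt0 // leq_min => /andP[_ mp].
have pr_le : p <= r.
  rewrite leqNgt; apply/negP => rp; have := @before_find _ 0 P (iota 0 N) r; rewrite -pE => /(_ rp).
  by rewrite nth_iota ?add0n ?Pr.
by split=> //; apply: leq_trans rN; rewrite leq_exp2r.
Qed.

Lemma p_prime : prime p. Proof. by case: chr_spec. Qed.
Lemma p_ge : L <= p. Proof. by case: chr_spec. Qed.

Lemma npolyE : npoly inp N L = p ^ t.
Proof.
rewrite /npoly cpowE ?prime_gt0 ?p_prime //; apply/minn_idPr.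
by case: chr_spec.
Qed.

Let DN : p ^ (2 * h) <= N.
Proof.
case: chr_spec => pp _ _; apply: leq_trans; rewrite leq_exp2l ?prime_gt1 // tE; lia.
Qed.

Lemma fb_primitive : primitive_feedback N p (2 * h) (fb inp N L).
Proof. by apply: feedbackP DN; [exact: p_prime|move: h_gt0; lia]. Qed.

Lemma gcls_lt x Y : gcls inp N L x Y < p.
Proof.
rewrite /gcls /nodeclass /normclass; have p1 := prime_gt1 p_prime.
case: ifP => _; first by rewrite prednK ?prime_gt0 ?p_prime.
by apply: leq_trans (_ : _ <= p.-1) _; [rewrite ltn_pmod; lia|lia].
Qed.

(** The factor 2 in [2 * n * k <= p ^ h] pays for p <= 2(p - 1). *)
Lemma node_range x : x < n * k -> x < p.-1 * p ^ h.-1.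
Proof.
case: chr_spec => pp _ mp _ /leq_trans; apply.
have p1 := prime_gt1 pp; have h0 := h_gt0.
move: mp; rewrite -{1}(prednK h0) expnS; have : p <= 2 * p.-1 by lia.
move: (p ^ h.-1) => q; nia.
Qed.

(* The bound behind (H2) and, with [None] among the points, behind the averaging for (H1). *)
Lemma class_fiber (xs : seq (option nat)) (G : option nat -> nat) (Ys : seq nat) :
  uniq xs -> size xs = t -> (forall x, Some x \in xs -> x < n * k) ->
  uniq Ys -> (forall Y, Y \in Ys -> Y < p ^ t) ->
  (forall x Y, x \in xs -> Y \in Ys ->
     (if x is Some x then gcls inp N L x Y else Y %% p) = G x) ->
  size Ys <= t`!.
Proof.
move=> Ux sx Hx UY Yt HG.
have [pp _ _ tN] := chr_spec.
have := @fiber_bound p h N (fb inp N L) pp h_gt0 DN fb_primitive t xs G Ys tN isT Ux sx _ UY Yt _.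
rewrite {2}tE; move=> H; apply: leq_trans (H _ _) _.
- by move=> x /Hx /node_range.
- by move=> x Y xx YY; rewrite -(HG x Y xx YY); case: x {xx}.
- by rewrite tE third_exp_le_fact.
Qed.

End Decoding.

Lemma lt_mixed a A b m : a < A -> b < m -> a * m + b < A * m.
Proof. nia. Qed.

Lemma mixed_div a b m : b < m -> (a * m + b) %/ m = a.
Proof. by move=> bm; rewrite divnMDl ?divn_small ?addn0 //; lia. Qed.

Lemma mixed_mod a b m : b < m -> (a * m + b) %% m = b.
Proof. by move=> bm; rewrite modnMDl modn_small. Qed.

Lemma pair_rank_lt i j k : i < j -> j < k -> (j * j.-1) %/ 2 + i < 'C(k, 2).
Proof.
move=> ij jk; rewrite divn2 -bin2; apply: (@leq_trans 'C(j.+1, 2)); last exact: leq_bin2l.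
by rewrite binS bin1 -addnS leq_add2l.
Qed.

Lemma pair_unrank k r : r < 'C(k, 2) ->
  exists ij : 'I_k * 'I_k, ij.1 < ij.2 /\ (ij.2 * ij.2.-1) %/ 2 + ij.1 = r.
Proof.
elim: k r => // k IH r; rewrite binS bin1 => Hr.
case: (ltnP r 'C(k, 2)) => [/IH[[i j] [ij E]]|Hk].
  by exists (widen_ord (leqnSn k) i, widen_ord (leqnSn k) j).
have ik : r - 'C(k, 2) < k.+1 by lia.
exists (Ordinal ik, ord_max) => /=; rewrite divn2 -bin2; lia.
Qed.

Section Construction.
Variables (Delta n : nat) (e : rel 'I_n) (k d L N X : nat).
Hypothesis Delta0 : 0 < Delta.
Hypothesis eG : simple_graph e.
Hypothesis k6 : 6 %| k.+1.
Let inp := init_mem (encode_instance e k).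
Let t := k.+1.
Hypothesis HL : t`! * d <= L.
Hypothesis d0 : 0 < d.
Hypothesis witness : exists2 r, prime r & [/\ L <= r, 2 * n * k <= r ^ (k.+1 %/ 6) & r ^ t <= N].
Hypothesis HX : d ^ L <= X.
Hypothesis HN : d ^ L <= N.

Let p := chr inp N L.
Let gc := gcls inp N L.
Let P := npoly inp N L.
Let pp : prime p. Proof. exact: (p_prime e k6 witness). Qed.
Let p0 : 0 < p := prime_gt0 pp.
Let PE : P = p ^ t. Proof. exact: (npolyE e k6 witness). Qed.
Let P0 : 0 < P. Proof. by rewrite PE expn_gt0 p0. Qed.
Let X0 : 0 < X. Proof. by apply: leq_trans HX; rewrite expn_gt0 d0. Qed.
Let k5 : 5 <= k. Proof. exact: dvdn_leq (ltn0Sn k) k6. Qed.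

Lemma popular_values (xs : 'I_k -> nat) : injective xs -> (forall i, xs i < n * k) ->
  exists (c : 'I_k -> nat) (Ys : seq nat),
  [/\ forall i, c i < p, size Ys = d, uniq [seq Y %% p | Y <- Ys] &
      forall Y, Y \in Ys -> [/\ Y < P, Y %% p < L & forall i, gc (xs i) Y = c i]].
Proof.
move=> xsI xsn.
pose f (Y : 'I_P) : {ffun 'I_k -> 'I_p} :=
  [ffun i => Ordinal (gcls_lt e k6 witness (xs i) Y)].
have PE' : P = p ^ k * p by rewrite PE expnSr.
have pL : L <= p := p_ge e k6 witness.
have [|c [Ys [sY uY HY]]] := @popular_class P p k L t`! d f PE' p0 pL (fact_gt0 t) HL _ d0.
  move=> c v; rewrite cardE -(size_map val).
  (* The point 0 joins the k nodes to give t conditions: residue v there, and at a node the class c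
     i of the unique i with [xs i = x]. *)
  pose G (x : option nat) : nat := if x is Some x then
    if [pick i | xs i == x] is Some i then c i else 0 else v.
  apply: (@class_fiber n e k L N k6 witness (None :: [seq Some (xs i) | i <- enum 'I_k]) G).
  - rewrite /= map_inj_uniq ?enum_uniq ?andbT; last by move=> i j [/xsI].
    by apply/mapP => -[].
  - by rewrite /= size_map size_enum_ord.
  - by move=> x; rewrite inE => /mapP[i _ [->]].
  - by rewrite map_inj_uniq ?enum_uniq //; apply: val_inj.
  - by move=> Y /mapP[Y' _ ->]; rewrite -PE ltn_ord.
  - move=> x Y; rewrite inE => Hx /mapP[Y'].
    rewrite mem_enum inE => /andP[/eqP fY /eqP Yv] ->; move: Hx.
    case/orP => [/eqP -> //|/mapP[i _ ->]] /=.
    case: pickP => [i' /eqP/xsI ->|/(_ i)]; last by rewrite eqxx.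
    by rewrite -fY ffunE.
exists (fun i => c i), Ys; split=> // Y /HY[YL [Y' [E fY]]]; split=> //.
- by rewrite -E ltn_ord.
- by move=> i; rewrite -E -fY ffunE.
Qed.

Definition enc_A chi u v i j c1 c2 delta :=
  ((((((chi * n + u) * n + v) * k + i) * k + j) * p + c1) * p + c2) * Delta + delta.

Lemma enc_AP chi u v i j c1 c2 delta :
  chi < X -> u < n -> v < n -> i < k -> j < k -> c1 < p -> c2 < p -> delta < Delta ->
  let x := enc_A chi u v i j c1 c2 delta in
  [/\ x < num_A Delta inp N L X,
      [/\ a_chi Delta inp N L x = chi, a_u Delta inp N L x = u & a_v Delta inp N L x = v],
      a_i Delta inp N L x = i /\ a_j Delta inp N L x = j,
      a_c1 Delta inp N L x = c1 /\ a_c2 Delta inp N L x = c2 & a_delta Delta x = delta].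
Proof.
move=> *; rewrite /num_A /a_chi /a_u /a_v /a_i /a_j /a_c1 /a_c2 /a_delta /enc_A -/p inp_k inp_n.
rewrite !(mixed_div, mixed_mod) //; split=> //.
by do 7 apply: lt_mixed => //.
Qed.

(** The copy number delta is absent: up to [Delta] vertices share all other fields, which accounts
    for the factor [Delta] in both (H1) and (H2). *)
Lemma a_fields_inj x y :
  [/\ a_chi Delta inp N L x = a_chi Delta inp N L y, a_u Delta inp N L x = a_u Delta inp N L y
    & a_v Delta inp N L x = a_v Delta inp N L y] ->
  a_i Delta inp N L x = a_i Delta inp N L y -> a_j Delta inp N L x = a_j Delta inp N L y ->
  a_c1 Delta inp N L x = a_c1 Delta inp N L y -> a_c2 Delta inp N L x = a_c2 Delta inp N L y ->
  x %/ Delta = y %/ Delta.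
Proof.
have K m a b : a %/ m = b %/ m -> a %% m = b %% m -> a = b.
  by move=> E1 E2; rewrite (divn_eq a m) (divn_eq b m) E1 E2.
move=> [E1 E2 E3] E4 E5 E6 E7.
apply: (K _ _ _ _ E7); apply: (K _ _ _ _ E6); apply: (K _ _ _ _ E5); apply: (K _ _ _ _ E4).
by apply: (K _ _ _ _ E3); apply: (K _ _ _ _ E2).
Qed.

Lemma num_B_gt0 : 0 < num_B inp N L X.
Proof. by rewrite /num_B muln_gt0 X0. Qed.

Let NA := num_A Delta inp N L X.
Let NB := num_B inp N L X.
Let NE := num_E Delta inp N L X.
Let w := [seq out_word Delta inp N d L X i | i <- iota 0 (out_size Delta inp N L X)].
Let adjA := adj Delta inp N L.

Lemma size_w : size w = 3 + NA + NB + 2 * NE.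
Proof. by rewrite size_map size_iota. Qed.

Lemma nth_w i : i < 3 + NA + NB + 2 * NE -> nth 0 w i = out_word Delta inp N d L X i.
Proof. by move=> Hi; rewrite (nth_map 0) ?size_iota // nth_iota. Qed.

Lemma w_na : o_na w = NA. Proof. by rewrite /o_na nth_w. Qed.
Lemma w_nb : o_nb w = NB. Proof. by rewrite /o_nb nth_w //; lia. Qed.
Lemma w_m : o_m w = NE. Proof. by rewrite /o_m nth_w //; lia. Qed.

Lemma w_alpha x : x < NA -> o_alpha w x = col_A Delta inp N L x.
Proof.
move=> Hx; rewrite /o_alpha nth_w; last lia.
by rewrite /out_word -/NA; do ?(case: ifP => ?; try lia); rewrite addKn.
Qed.

Lemma w_beta y : y < NB -> o_beta w y = col_B inp N d L y.
Proof.
move=> Hy; rewrite /o_beta w_na nth_w; last lia.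
by rewrite /out_word -/NA -/NB; do ?(case: ifP => ?; try lia); rewrite addKn.
Qed.

Lemma w_edge r : r < NE -> o_edge w r = (sel_E Delta inp N L X r %/ NB, sel_E Delta inp N L X r %% NB).
Proof.
move=> Hr; rewrite /o_edge w_na w_nb !nth_w; [|lia|lia].
have big x : 3 + NA + NB <= x -> out_word Delta inp N d L X x = let r := x - (3 + NA + NB) in
    if r %% 2 == 0 then sel_E Delta inp N L X (r %/ 2) %/ NB else sel_E Delta inp N L X (r %/ 2) %% NB.
  by move=> Hx; rewrite /out_word -/NA -/NB; do ?(case: ifP => ?; try lia).
rewrite !big; [|lia|lia].
have -> : 3 + NA + NB + 2 * r - (3 + NA + NB) = r * 2 by lia.
have -> : 3 + NA + NB + 2 * r + 1 - (3 + NA + NB) = r * 2 + 1 by lia.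
by rewrite /= mulnK // modnMl mixed_mod // mixed_div.
Qed.

Lemma w_edge_range r : r < NE -> [/\ (o_edge w r).1 < NA, (o_edge w r).2 < NB &
  adjA (o_edge w r).1 (o_edge w r).2].
Proof.
move=> Hr; rewrite w_edge //=.
have [sM sA] := selected_prop (b := fun z => adjA (z %/ NB) (z %% NB)) Hr.
by split=> //; [rewrite ltn_divLR ?num_B_gt0|rewrite ltn_mod num_B_gt0].
Qed.

Lemma w_adj x y : x < NA -> y < NB -> o_adj w x y = adjA x y.
Proof.
move=> Hx Hy; apply/mapP/idP => [[r]|Hxy].
  rewrite mem_iota add0n w_m => Hr E.
  by have [_ _] := w_edge_range Hr; rewrite -E.
have zM : x * NB + y < NA * NB by apply: lt_mixed.
have [|H1 H2] := selected_before (b := fun z => adjA (z %/ NB) (z %% NB)) zM.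
  by rewrite mixed_div // mixed_mod.
exists (\sum_(0 <= i < x * NB + y) adjA (i %/ NB) (i %% NB)).
  by rewrite mem_iota w_m.
rewrite w_edge // /sel_E; move: H2 => /= H2.
by rewrite H2 mixed_div // mixed_mod.
Qed.

Lemma w_wf : wf_output w (Delta * 'C(k, 2)) d.
Proof.
rewrite /wf_output w_na w_nb w_m size_w eqxx /=; apply/and3P; split; last first.
- apply/andP; split; apply/allP => r; rewrite mem_iota add0n => /andP[_ /w_edge_range[]] //.
- apply/allP => y; rewrite mem_iota add0n => /andP[_ Hy]; rewrite w_beta // /col_B addn1 /=.
  by rewrite ltn_pmod.
apply/allP => x; rewrite mem_iota add0n => /andP[_ Hx]; rewrite w_alpha // /col_A.
have C0 : 0 < 'C(k, 2) by rewrite bin_gt0; lia.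
case: ifP => H; last by rewrite /= muln_gt0 Delta0.
rewrite addn1 /=.
have jk : a_j Delta inp N L x < k by rewrite /a_j inp_k ltn_pmod //; lia.
have := pair_rank_lt H jk; have : a_delta Delta x < Delta by rewrite ltn_pmod.
by move=> H1 H2; rewrite ![Delta * _]mulnC; apply: lt_mixed.
Qed.

Lemma clique_H1 : has_clique e k -> H1_prop w (Delta * 'C(k, 2)) d.
Proof.
move=> [K [cK clK]].
pose v (i : 'I_k) : 'I_n := enum_val (cast_ord (esym cK) i).
have vI : injective v by move=> i j /enum_val_inj/cast_ord_inj.
have vK i : v i \in K by apply: enum_valP.
pose xs (i : 'I_k) : nat := v i * k + i.
have xsI : injective xs.
  move=> i j E; apply: val_inj; rewrite /= -(mixed_mod (v i) (ltn_ord i)) -(mixed_mod (v j) (ltn_ord j)).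
  by rewrite -/(xs i) -/(xs j) E.
have xsn i : xs i < n * k by apply: lt_mixed.
have [c [Ys [cp sY uY HY]]] := popular_values xsI xsn.
pose ys := [seq Y %% p | Y <- Ys].
(* The colouring that numbers the d residues in [ys] by position, written in base d; [%% d] only
   gives a legal digit to the other residues. *)
pose chi := \sum_(0 <= l < L) (index l ys %% d) * d ^ l.
have chiX : chi < X by apply: leq_trans HX; apply: (digits_lt d0 L (index^~ ys)).
have chiY Y : Y \in Ys -> chi %/ cpow N d (Y %% p) %% d = index (Y %% p) ys.
  move=> YY; have [_ YL _] := HY Y YY.
  rewrite cpowE // (minn_idPr _); last by apply: leq_trans HN; rewrite leq_pexp2l // ltnW.
  rewrite (digits_nth d0 (index^~ ys) YL) modn_small //.
  by rewrite -[X in _ < X]sY -(size_map (modn^~ p)) index_mem; apply: map_f.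
have [rk Hrk] := fin_all_exists (fun r : 'I_('C(k, 2)) => pair_unrank (ltn_ord r)).
have oC (o : 'I_(Delta * 'C(k, 2))) : o %/ Delta < 'C(k, 2) by rewrite ltn_divLR // -[ltnRHS]mulnC ltn_ord.
(* The vertex meant to get colour o + 1 has copy number [o %% Delta] and the pair of rank
   [o %/ Delta]. *)
pose ij o := rk (Ordinal (oC o)).
pose sx o := enc_A chi (v (ij o).1) (v (ij o).2) (ij o).1 (ij o).2 (c (ij o).1) (c (ij o).2) (o %% Delta).
have sxP o := enc_AP chiX (ltn_ord (v (ij o).1)) (ltn_ord (v (ij o).2)) (ltn_ord (ij o).1)
   (ltn_ord (ij o).2) (cp (ij o).1) (cp (ij o).2) (ltn_pmod o Delta0).
have sxA o : sx o < NA by case: (sxP o).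
have sxcol o : o_alpha w (sx o) = o + 1.
  rewrite w_alpha // /col_A; have [_ _ [-> ->] _ ->] := sxP o.
  have [-> E] := Hrk (Ordinal (oC o)); rewrite -/(ij o) in E.
  by rewrite E /= mulnC -divn_eq.
have TB Y : Y \in Ys -> chi * P + Y < NB.
  by move=> /HY[YP _ _]; apply: lt_mixed.
exists [seq sx o | o <- enum 'I_(Delta * 'C(k, 2))], [seq chi * P + Y | Y <- Ys].
have uA : uniq [seq o_alpha w x | x <- [seq sx o | o <- enum 'I_(Delta * 'C(k, 2))]].
  rewrite -map_comp (@eq_map _ _ _ (fun o => nat_of_ord o + 1)) => [|o]; last exact: sxcol.
  by rewrite map_inj_uniq ?enum_uniq // => a b E; apply: val_inj; rewrite /= in E *; lia.
have uB : uniq [seq o_beta w y | y <- [seq chi * P + Y | Y <- Ys]].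
  have -> : [seq o_beta w y | y <- [seq chi * P + Y | Y <- Ys]] = [seq index y ys + 1 | y <- ys].
    rewrite -!map_comp; apply/eq_in_map => Y YY /=.
    rewrite w_beta ?TB // /col_B -/P mixed_div ?mixed_mod ?chiY //; by have [] := HY Y YY.
  rewrite map_inj_in_uniq // => a b Ha Hb E.
  have {}E : index a ys = index b ys by lia.
  by rewrite -(nth_index 0 Ha) E nth_index.
split.
- split=> //; last by rewrite size_map size_enum_ord.
  rewrite /is_subset_A (map_uniq uA) w_na; apply/allP => x /mapP[o _ ->]; exact: sxA.
- split=> //; last by rewrite size_map.
  by rewrite /is_subset_B (map_uniq uB) w_nb; apply/allP => y /mapP[Y YY ->]; exact: TB.
apply/allP => y /mapP[Y YY ->]; apply/allP => x /mapP[o _ ->].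
rewrite w_adj ?TB //; have [YP _ HG] := HY Y YY.
have [_ [E1 E2 E3] [E4 E5] [E6 E7] _] := sxP o.
rewrite /adjA /adj E1 E2 E3 E4 E5 E6 E7 -/P mixed_div // mixed_mod // eqxx /= inp_k.
have [lt_ij _] := Hrk (Ordinal (oC o)); rewrite -/(ij o) in lt_ij.
rewrite lt_ij in_edgeE // clK ?vK //=; last first.
  by apply/eqP => /vI E; move: lt_ij; rewrite E ltnn.
by rewrite -/gc (HG (ij o).1) (HG (ij o).2) !eqxx.
Qed.

(** F lies among the C(|V|, 2) two-element subsets of its cover V. The counts force |V| = k, and
    then F is all of them. *)
Lemma cover_card (T : finType) (F : {set {set T}}) :
  1 < k -> (forall A, A \in F -> #|A| = 2) -> 'C(k, 2) <= #|F| -> #|cover F| <= k ->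
  #|cover F| = k /\ forall a b, a \in cover F -> b \in cover F -> a != b -> [set a; b] \in F.
Proof.
move=> k1 F2 HF HV; set V := cover F in HV *.
pose All := [set A : {set T} | A \subset V & #|A| == 2].
have sub : F \subset All.
  by apply/subsetP => A AF; rewrite inE F2 // eqxx andbT; apply: bigcup_sup.
have cA : #|All| = 'C(#|V|, 2) by apply: cards_draws.
have le := subset_leq_card sub; rewrite cA in le.
have Vk : #|V| = k.
  apply/eqP; rewrite eqn_leq HV leqNgt; apply/negP => Vlt.
  have : 'C(#|V|, 2) < 'C(k, 2).
    apply: (@leq_trans 'C(#|V|.+1, 2)); last exact: leq_bin2l.
    rewrite [X in _ < X]binS bin1 -addn1 leq_add2l lt0n; apply/negP => /eqP V0.
    by move: HF; rewrite leqNgt; have := le; rewrite V0 bin0n leqn0 => /eqP ->; rewrite bin_gt0 k1.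
  by rewrite ltnNge (leq_trans HF le).
split=> // a b aV bV ab.
have FA : F = All by apply/eqP; rewrite eqEcard sub cA Vk.
have abV : [set a; b] \subset V by apply/subsetP => x; rewrite !inE => /orP[] /eqP ->.
by rewrite {1}FA inE abV cards2 ab.
Qed.

Lemma no_clique_H2 : ~ has_clique e k -> H2_prop w (Delta * ('C(k, 2) - 1) + 1) t`!.
Proof.
move=> ncl S; rewrite /is_subset_A w_na => /andP[uS /allP SA] sS.
rewrite leqNgt; apply/negP => big; apply: ncl.
pose T := common_nbrs w S.
have uT : uniq T by rewrite filter_uniq // iota_uniq.
have TP y : y \in T -> y < NB /\ forall x, x \in S -> adjA x y.
  rewrite mem_filter mem_iota add0n w_nb => /andP[/allP Hy yB]; split=> // x xS.
  by rewrite -w_adj ?SA ?Hy.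
have S0 : 0 < size S by rewrite sS addn1.
have T0 : 0 < size T by apply: leq_ltn_trans big.
(* A single common neighbour already fixes the colouring and, node by node, the classes stored in
   every vertex of S; a vertex of S is then determined by its edge and delta. *)
pose y0 := nth 0 T 0; have y0T : y0 \in T by rewrite mem_nth.
have nk0 : 0 < n * k.
  have /SA : nth 0 S 0 \in S by rewrite mem_nth.
  rewrite /NA /num_A inp_n inp_k; case: (posnP (n * k)) => // nk.
  by rewrite (_ : X * n * n * k * k = X * n * k * (n * k)) ?nk ?muln0; [|nia].
have n0 : 0 < n by move: nk0; case: n.
have k0 : 0 < k by lia.
pose un (x : nat) := a_u Delta inp N L x; pose vn x := a_v Delta inp N L x.
pose i_ x := a_i Delta inp N L x; pose j_ x := a_j Delta inp N L x.
have un_lt x : un x < n by rewrite /un /a_u inp_n ltn_mod.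
have vn_lt x : vn x < n by rewrite /vn /a_v inp_n ltn_mod.
have i_lt x : i_ x < k by rewrite /i_ /a_i inp_k ltn_mod.
have j_lt x : j_ x < k by rewrite /j_ /a_j inp_k ltn_mod.
pose nd1 x : 'I_(n * k) := Ordinal (lt_mixed (un_lt x) (i_lt x)).
pose nd2 x : 'I_(n * k) := Ordinal (lt_mixed (vn_lt x) (j_lt x)).
have adjP x y : x \in S -> y \in T -> [/\ a_chi Delta inp N L x = y %/ P, i_ x < j_ x,
   in_edge inp (un x) (vn x), gc (nd1 x) (y %% P) = a_c1 Delta inp N L x &
   gc (nd2 x) (y %% P) = a_c2 Delta inp N L x].
  move=> xS /TP[_ /(_ x xS)]; rewrite /adjA /adj => /and5P[/eqP E0 ij uv /eqP E1 /eqP E2].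
  by rewrite -E1 -E2.
have nd12 x : x \in S -> nd1 x != nd2 x.
  move=> xS; apply/eqP => /(congr1 val) /= E; have [_ ij _ _ _] := adjP x y0 xS y0T.
  have := congr1 (modn^~ k) E; rewrite /= !mixed_mod // => Eij.
  by move: ij; rewrite Eij ltnn.
pose ed (x : nat) : {set 'I_(n * k)} := [set nd1 x; nd2 x].
pose F := [set ed (nat_of_ord x) | x in [set o : 'I_NA | nat_of_ord o \in S]].
have FP A : A \in F -> exists2 x : nat, x \in S & A = ed x.
  by move=> /imsetP[x]; rewrite inE => xS ->; exists (nat_of_ord x).
have FS x : x \in S -> ed x \in F.
  by move=> xS; apply/imsetP; exists (Ordinal (SA x xS)); rewrite ?inE.
have ed_inj x x' : x \in S -> x' \in S -> ed x = ed x' -> x %/ Delta = x' %/ Delta.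
  move=> xS xS' E.
  have [c1 ij1 _ g11 g12] := adjP x y0 xS y0T; have [c2 ij2 _ g21 g22] := adjP x' y0 xS' y0T.
  have [e1 e2] : nd1 x = nd1 x' /\ nd2 x = nd2 x'.
    have m1 y : nd1 y %% k = i_ y by rewrite /= mixed_mod.
    have m2 y : nd2 y %% k = j_ y by rewrite /= mixed_mod.
    have A1 : nd1 x \in ed x' by rewrite -E set21.
    have A2 : nd2 x \in ed x' by rewrite -E set22.
    move: A1 A2; rewrite !inE => /orP[] /eqP E1 /orP[] /eqP E2 //.
    - by have := nd12 x xS; rewrite E1 E2 eqxx.
    (* The unordered edge determines its orientation, since the first end has the smaller second
       coordinate. *)
    - by move: ij1; rewrite -m1 -m2 E1 E2 m1 m2; lia.
    - by have := nd12 x xS; rewrite E1 E2 eqxx.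
  have dv y y' : nd1 y = nd1 y' -> un y = un y' /\ i_ y = i_ y'.
    move=> /(congr1 val) /= Ey; have := congr1 (divn^~ k) Ey; have := congr1 (modn^~ k) Ey.
    by rewrite /= !mixed_mod ?mixed_div.
  have dv2 y y' : nd2 y = nd2 y' -> vn y = vn y' /\ j_ y = j_ y'.
    move=> /(congr1 val) /= Ey; have := congr1 (divn^~ k) Ey; have := congr1 (modn^~ k) Ey.
    by rewrite /= !mixed_mod ?mixed_div.
  have [u1 i1] := dv _ _ e1; have [v1 j1] := dv2 _ _ e2.
  apply: a_fields_inj; rewrite ?c1 ?c2 //; first by rewrite -g11 -g21 e1.
  by rewrite -g12 -g22 e2.
have F2 A : A \in F -> #|A| = 2.
  by move=> /FP[x xS ->]; rewrite cards2 nd12.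
(* Pigeonhole: at most [Delta] vertices of S share an edge, and S has more than Delta (s - 1)
   members. *)
have Fge : 'C(k, 2) <= #|F|.
  have C0 : 0 < 'C(k, 2) by rewrite bin_gt0; lia.
  rewrite leqNgt; apply/negP => Flt.
  have : size S <= #|F| * Delta.
    pose g (x : nat) : {set 'I_(n * k)} * 'I_Delta := (ed x, Ordinal (ltn_pmod x Delta0)).
    have -> : #|F| * Delta = size (enum (setX F [set: 'I_Delta])).
      by rewrite -cardE cardsX cardsT card_ord.
    rewrite -(size_map g).
    apply: uniq_leq_size.
      rewrite map_inj_in_uniq // => x x' xS xS' [E1 E2].
      by rewrite (divn_eq x Delta) (divn_eq x' Delta) (ed_inj _ _ xS xS' E1) E2.
    move=> [A o] /mapP[x xS [-> ->]]; by rewrite mem_enum !inE FS.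
  rewrite sS; have : #|F| * Delta <= ('C(k, 2) - 1) * Delta by rewrite leq_mul2r; apply/orP; right; lia.
  by rewrite mulnC; lia.
have covF a : a \in cover F -> exists x, x \in S /\ (a = nd1 x \/ a = nd2 x).
  move=> /bigcupP[A /FP[x xS ->]]; rewrite !inE => /orP[] /eqP ->; exists x; split=> //; by [left|right].
have [Vk|Vbig] := leqP #|cover F| k.
  have [cV allV] := cover_card (ltac:(lia) : 1 < k) F2 Fge Vk.
  have divn_lt (a : 'I_(n * k)) : a %/ k < n by rewrite ltn_divLR.
  pose pr (a : 'I_(n * k)) : 'I_n := Ordinal (divn_lt a).
  have epr a b : a \in cover F -> b \in cover F -> a != b -> e (pr a) (pr b).
    move=> aV bV ab; have /FP[x xS Eab] := allV a b aV bV ab.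
    have [_ _ uv _ _] := adjP x y0 xS y0T.
    have e1 : pr (nd1 x) = Ordinal (un_lt x) by apply: val_inj; rewrite /= mixed_div.
    have e2 : pr (nd2 x) = Ordinal (vn_lt x) by apply: val_inj; rewrite /= mixed_div.
    have {}uv : e (pr (nd1 x)) (pr (nd2 x)) by rewrite e1 e2 -(in_edgeE k eG).
    have [eS _] := eG.
    have := set21 a b; have := set22 a b; rewrite Eab !inE.
    move=> /orP[] /eqP Eb /orP[] /eqP Ea; rewrite Ea Eb // in ab *.
    - by rewrite eqxx in ab.
    - by rewrite eS.
    - by rewrite eqxx in ab.
  (* Distinct nodes of the cover project to adjacent vertices of G; irreflexivity makes the
     projection injective, so its image still has k elements. *)
  exists (pr @: cover F); split.
    rewrite card_in_imset // => a b aV bV E; apply/eqP; apply/negP => /negP ab.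
    by have := epr a b aV bV ab; rewrite E; case: eG => _ ->.
  move=> _ _ /imsetP[a aV ->] /imsetP[b bV ->] ne; apply: epr => //.
  by apply: contra_neq ne => ->.
exfalso; move: big; rewrite ltnNge => /negP; apply.
(* All common neighbours carry the colouring of the vertices of S, so they differ in their
   polynomials, to which the bound for t prescribed classes applies. *)
have pT y : y \in T -> y %/ P = y0 %/ P.
  have xS : nth 0 S 0 \in S by rewrite mem_nth.
  by move=> yT; have [<- _ _ _ _] := adjP _ _ xS yT; have [<- _ _ _ _] := adjP _ _ xS y0T.
rewrite -/T -(size_map (modn^~ P)).
pose xs := take t (enum (cover F)).
have xsF a : a \in xs -> a \in cover F by move=> /mem_take; rewrite mem_enum.
pose G (o : option nat) := if o is Some x then gc x (y0 %% P) else 0.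
apply: (@class_fiber n e k L N k6 witness [seq Some (nat_of_ord a) | a <- xs] G).
- rewrite map_inj_uniq; last by move=> a b [/val_inj].
  by apply: take_uniq; apply: enum_uniq.
- by rewrite size_map size_takel // -cardE.
- by move=> x /mapP[a _ [->]].
- rewrite map_inj_in_uniq // => y y' yT yT' E.
  by rewrite (divn_eq y P) (divn_eq y' P) (pT _ yT) (pT _ yT') E.
- by move=> Y /mapP[y _ ->]; rewrite -PE ltn_mod.
- move=> x Y /mapP[a /xsF/covF[z [zS Ha]] ->] /mapP[y yT ->] /=.
  have [_ _ _ g1 g2] := adjP z y zS yT; have [_ _ _ g3 g4] := adjP z y0 zS y0T.
  by case: Ha => ->; rewrite -/gc ?g1 ?g3 ?g2 ?g4.
Qed.

End Construction.

(** * The theorem *)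

Section Halting.
Variables (p : program) (d : nat -> nat).
Hypothesis Hp : forall k, exists t, runs_within p [:: k] t [:: d k].

Lemma exec_add s t c : exec p (s + t) c = exec p t (exec p s c).
Proof.
elim: t c => [|t IH] c; first by rewrite addn0.
by rewrite addnS !execS IH.
Qed.

Lemma exec_halted t c : halted p c -> exec p t c = c.
Proof.
have E t' : exec p t'.+1 c = if step p c is Some c' then exec p t' c' else c by [].
by rewrite /halted; case: t => [|t] //; rewrite E; case: (step p c).
Qed.

Let ex_halt k : exists t, halted p (exec p t (init [:: k])).
Proof. by have [t [H _]] := Hp k; exists t. Qed.

(** The least halting time, since the simulation counts exactly the steps up to the first halt. *)
Definition halt_time k := ex_minn (ex_halt k).

Lemma halt_time_min k t : t < halt_time k -> ~~ halted p (exec p t (init [:: k])).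
Proof.
rewrite /halt_time; case: ex_minnP => m _ Hm; rewrite ltnNge; apply: contra; exact: Hm.
Qed.

Lemma halt_time_runs k : runs_within p [:: k] (halt_time k) [:: d k].
Proof.
rewrite /halt_time; case: ex_minnP => m Hm mmin; split=> //.
have [t [Ht <-]] := Hp k; rewrite [in RHS](_ : exec p t (init [:: k]) = exec p m (init [:: k])) //.
by rewrite -{1}(subnKC (mmin _ Ht)) exec_add exec_halted.
Qed.

End Halting.

(** Each stage can only append a power of 2. This one dominates t! d, because t! <= t^t <= 2^(t t)
    and d <= 2^d. *)
Definition stage_L (k d : nat) : nat := 2 ^ (k.+1 * k.+1 + d).
Definition stage_X (d L : nat) : nat := 2 ^ (d * L).
(* Large enough for (S (n + 1))^12 to exceed p^(k + 1), where p is the prime of [prime_witness]. *)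
Definition stage_S (k d T L X : nat) : nat := 2 ^ ((L + 6) * k.+1 + (k + d + T + L + X)).

Definition stages (inp : nat -> nat) (E0 : seq nat) : seq nat :=
  let d := nth 0 E0 0 in let T := nth 0 E0 1 in
  let L := stage_L (in_k inp) d in let X := stage_X d L in
  E0 ++ [:: L; X; stage_S (in_k inp) d T L X].

Lemma prep_stages : prep 5 stages.
Proof.
have P1 : ptime 2 (fun inp E => (in_k inp).+1 * (in_k inp).+1 + nth 0 E 0).
  by rewrite /in_k; repeat polystep.
have P2 : ptime 3 (fun _ E => nth 0 E 0 * nth 0 E 2) by repeat polystep.
have P3 : ptime 4 (fun inp E => (nth 0 E 2 + 6) * (in_k inp).+1
   + (in_k inp + nth 0 E 0 + nth 0 E 1 + nth 0 E 2 + nth 0 E 3)).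
  by rewrite /in_k; repeat polystep.
have [Hs H] := prep_stage (prep_stage (prep_stage prep_base P1) P2) P3.
split=> [inp [|d [|T []]] //|].
have [code [w [c Hc]]] := H; exists code, w, c => R inp [|d [|T [|x E0]]] B M // s0.
exact: (Hc R inp [:: d; T] B M).
Qed.

(** 12 = 6 * 2: the exponent is t = 6h, and the prime is known only up to squaring. *)
Definition big_N (inp : nat -> nat) (S : nat) : nat := (S * (in_n inp).+1) ^ 12.

Lemma fact_stage_L k d : (k.+1)`! * d <= stage_L k d.
Proof.
rewrite /stage_L expnD; apply: leq_mul; last exact/ltnW/ltn_expl.
apply: (@leq_trans (k.+1 ^ k.+1)).
  elim: k.+1 => // m IH; rewrite factS expnS leq_mul2l; apply/orP; right.
  by apply: leq_trans IH _; case: m => // m; rewrite leq_exp2r.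
by rewrite expnM leq_exp2r // ltnW // ltn_expl.
Qed.

Lemma stage_X_ge d L : d ^ L <= stage_X d L.
Proof.
rewrite /stage_X expnM; case: L => // L.
by rewrite leq_exp2r // ltnW // ltn_expl.
Qed.

(** Take the least a >= L + 5 with 2nk <= 2^(a h) and a prime between 2^a and 2^(2a). Either a = L +
    5, and 2^(a h) depends on k and L alone, or minimality gives 2^(a h) < 2nk 2^h, which is linear
    in n. *)
Lemma prime_witness n k d T L X (S := stage_S k d T L X) : 6 %| k.+1 ->
  exists2 r, prime r & [/\ L <= r, 2 * n * k <= r ^ (k.+1 %/ 6) & r ^ k.+1 <= (S * n.+1) ^ 12].
Proof.
move=> k6; set h := k.+1 %/ 6.
have tE : k.+1 = 6 * h by rewrite mulnC divnK.
have h0 : 0 < h by rewrite lt0n; apply/eqP => h0; rewrite h0 in tE.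
have ex : exists a, (L + 5 <= a) && (2 * n * k <= 2 ^ (a * h)).
  exists (L + 5 + 2 * n * k); rewrite leq_addr /=; apply: ltnW.
  apply: leq_trans (ltn_expl _ (ltnSn 1)) _; rewrite leq_exp2l //; nia.
case: (ex_minnP ex) => a /andP[aL ah] amin.
have [|r pr /andP[r1 r2]] := @prime_gap a; first lia.
have S0 : 2 ^ ((L + 6) * k.+1) <= S by rewrite /S /stage_S leq_exp2l // leq_addr.
have aS : 2 ^ (a * h) <= S * n.+1.
  case: (leqP a (L + 5)) => Ha.
    apply: leq_trans (leq_pmulr _ _) => //; apply: leq_trans S0.
    by rewrite leq_exp2l //; nia.
  have Hlt : 2 ^ (a.-1 * h) < 2 * n * k.
    rewrite ltnNge; apply/negP => H; have := amin a.-1; rewrite H andbT => /(_ ltac:(lia)); lia.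
  have -> : a * h = a.-1 * h + h by nia.
  have k2 : 2 * k * 2 ^ h <= S.
    apply: leq_trans S0; apply: (@leq_trans (2 ^ (k.+1 + h))); last by rewrite leq_exp2l //; nia.
    rewrite expnD leq_mul2r expnS leq_mul2l /=; apply/orP; right.
    by apply/ltnW/ltn_expl.
  rewrite expnD; move: (2 ^ _) (2 ^ h) Hlt k2 => u v; nia.
exists r => //; split.
- apply: leq_trans (ltnW r1); apply: leq_trans (_ : a <= _); first lia.
  exact/ltnW/ltn_expl.
- by apply: leq_trans ah _; rewrite expnM leq_exp2r // ltnW.
- apply: leq_trans (_ : (2 ^ (a * h)) ^ 12 <= _); last by rewrite leq_exp2r.
  rewrite tE; apply: (@leq_trans ((2 ^ (2 * a)) ^ (6 * h))); first by rewrite leq_exp2r //; lia.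
  by rewrite -!expnM leq_exp2l //; nia.
Qed.

Lemma nth_sumn (s : seq nat) i : nth 0 s i <= sumn s.
Proof. by elim: s i => [|x s IH] [|i] //=; [exact: leq_addr|apply: leq_trans (IH i) (leq_addl _ _)]. Qed.

Lemma edge_list_bound n (e : rel 'I_n) k i :
  init_mem (encode_instance e k) i <= k + 2 * gsize e + 3.
Proof.
rewrite /gsize; case: i => [|[|[|[|i]]]] /=; try lia.
  rewrite size_flatten /shape -map_comp.
  have -> : sumn [seq (size \o (fun uv : nat * nat => [:: uv.1; uv.2])) x | x <- edge_list e]
    = 2 * size (edge_list e) by elim: (edge_list e) => //= x s ->; lia.
  by lia.
apply: (@leq_trans n); last lia.
have : all (fun x => x < n) (flatten [seq [:: uv.1; uv.2] | uv <- edge_list e]).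
  apply/allP => x /flattenP[s /mapP[[a b] /mem_edge_list[u [v [<- <- _ _]]] ->]].
  by rewrite !inE => /orP[] /eqP ->; rewrite /= ltn_ord.
case: (ltnP i (size (flatten [seq [:: uv.1; uv.2] | uv <- edge_list e]))) => Hi; last by rewrite nth_default.
by move=> /all_nthP/(_ i Hi)/ltnW.
Qed.

Theorem theorem4p2 (Delta : nat) (d : nat -> nat) :
  0 < Delta ->
  (forall n, 0 < n -> 0 < d n) ->
  computable d ->
  exists (P : program) (f : nat -> nat) (c : nat),
    computable f /\
    forall (n : nat) (e : rel 'I_n) (k : nat),
      simple_graph e -> 6 %| k.+1 ->
      exists (t : nat) (w : seq nat),
        [/\ t <= f k * (gsize e).+1 ^ c,
            runs_within P (encode_instance e k) t w,
            wf_output w (Delta * 'C(k, 2)) (d k),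
            (has_clique e k -> H1_prop w (Delta * 'C(k, 2)) (d k)) &
            (~ has_clique e k ->
               H2_prop w (Delta * ('C(k, 2) - 1) + 1) (k.+1)`!)].
Proof.
move=> Delta0 dpos [p Hp].
pose T := halt_time Hp.
(* The environment lists d(k), T(k), L, X and S in the entries 0 to 4; entry 5 will be the position
   in the output word. *)
have pN : ptime 5 (fun inp E => big_N inp (nth 0 E 4)).
  by rewrite /big_N /in_n; apply: ptime_expc; repeat polystep.
have pLen : ptime 5 (fun inp E => out_size Delta inp (big_N inp (nth 0 E 4)) (nth 0 E 2) (nth 0 E 3)).
  by apply: ptime_out_size => //; repeat polystep.
have pOut : ptime 6 (fun inp E => out_word Delta inp (big_N inp (nth 0 E 4)) (nth 0 E 0) (nth 0 E 2)
    (nth 0 E 3) (nth 0 E 5)).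
  apply: ptime_out_word; try by repeat polystep.
  by rewrite /big_N /in_n; apply: ptime_expc; repeat polystep.
have [P [c HP]] := pipeline (halt_time_runs Hp) (@halt_time_min _ _ Hp) prep_stages pLen pOut.
have [cl Hl] := ptime_value pLen.
pose C := ((cl + 1).+1 + 2).+1 * c.
pose S k := let L := stage_L k (d k) in stage_S k (d k) (T k) L (stage_X (d k) L).
(* The 5 comes from [B0 + 2 <= 5 * S k * (gsize e).+1]; C combines the exponent of the pipeline with
   that of the word length. *)
exists P, (fun k => (5 * S k) ^ C), C; split.
  (* Computability of f: the same pipeline with a word of length 1, whose only letter is a fixed
     power of 5 S, read off the environment. *)
  have pLen1 : ptime 5 (fun _ _ => 1) by exact: ptime_const.
  have pOut1 : ptime 6 (fun _ E => (5 * nth 0 E 4) ^ C).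
    by apply: ptime_expc; repeat polystep.
  have [Q [c' HQ]] := pipeline (halt_time_runs Hp) (@halt_time_min _ _ Hp) prep_stages pLen1 pOut1.
  exists Q => k.
  pose E := stages (init_mem [:: k]) [:: d k; T k].
  have [|||t _ Ht] := HQ [:: k] (k + 1 + T k + sumn E); last by exists t.
  - split=> i; first by case: i => [|[|i]] /=; rewrite ?nth_nil; lia.
    by apply: leq_trans (nth_sumn _ _) _; rewrite -/T -/E leq_addl.
  - by change (T k <= k + 1 + T k + sumn E); lia.
  - by change (1 <= k + 1 + T k + sumn E); lia.
move=> n e k eG k6.
have k0 : 0 < k by case: k k6.
have d0 := dpos k k0.
pose L := stage_L k (d k); pose X := stage_X (d k) L.
pose N := (S k * n.+1) ^ 12.
pose inp := init_mem (encode_instance e k).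
pose E := stages inp [:: d k; T k].
have EE : E = [:: d k; T k; L; X; S k] by [].
have NE : big_N inp (nth 0 E 4) = N by [].
have [HkS HdS HTS HLS HXS] : [/\ k <= S k, d k <= S k, T k <= S k, L <= S k & X <= S k].
  have lt m m' : m <= m' -> m <= 2 ^ m' by move=> /leq_trans; apply; apply/ltnW/ltn_expl.
  by rewrite /S /stage_S -/L -/X; split; apply: lt; lia.
have S0 : 0 < S k by apply: leq_trans HkS.
pose B0 := S k * (2 * gsize e + 4).
have inpB i : inp i <= B0.
  by apply: leq_trans (edge_list_bound e k i) _; rewrite /B0; nia.
have EB i : nth 0 E i <= B0.
  apply: (@leq_trans (S k)); last by rewrite /B0 leq_pmulr; lia.
  by rewrite EE; case: i => [|[|[|[|[|i]]]]] //=; rewrite nth_nil.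
have lenB := Hl inp E B0 erefl (conj inpB EB).
have [|||t Ht run] := HP (encode_instance e k) (B0 + (B0 + 2) ^ cl).
- by split=> i; [apply: leq_trans (inpB i) _|apply: leq_trans (EB i) _]; rewrite leq_addr.
- by apply: leq_trans (leq_addr _ _); apply: leq_trans (EB 1).
- by apply: leq_trans lenB _; rewrite leq_addl.
exists t, [seq out_word Delta inp N (d k) L X i | i <- iota 0 (out_size Delta inp N L X)].
have HX : d k ^ L <= X by exact: stage_X_ge.
have HN : d k ^ L <= N.
  apply: leq_trans HX _; apply: leq_trans HXS _; rewrite /N.
  by rewrite -{1}[S k]expn1 expnMn; apply: (@leq_trans (S k ^ 12)); rewrite ?leq_pexp2l // leq_pmulr // expn_gt0.
have wit := @prime_witness n k (d k) (T k) L X k6.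
have HL : (k.+1)`! * d k <= L by exact: fact_stage_L.
split.
- apply: leq_trans Ht _; rewrite -expnMn.
  have Y : B0 + (B0 + 2) ^ cl <= (B0 + 2) ^ (cl + 1).+1.
    by rewrite addnC; apply: pb_add; [|exact: pb_id].
  apply: leq_trans (pb_comp _ Y) _; rewrite -/C.
  have Z : B0 + 2 <= 5 * S k * (gsize e).+1 by rewrite /B0; nia.
  by case: (C) => // C'; rewrite leq_exp2r.
- rewrite (_ : map _ _ = [seq out_word Delta inp (big_N inp (nth 0 (rcons E i) 4)) (nth 0 (rcons E i) 0)
     (nth 0 (rcons E i) 2) (nth 0 (rcons E i) 3) (nth 0 (rcons E i) 5) | i <- iota 0 (out_size Delta inp N L X)]) //.
- by apply: w_wf.
- by apply: clique_H1.
- by apply: no_clique_H2.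
Qed.
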